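(* Let $\gamma>0$. The slice hyperholomorphic RBF space $\mathcal{H}_{\gamma,S}(\mathbb{H})$ is a reproducing kernel Hilbert space whose kernel is given by $$K_{\gamma,S}(q,p)=e^{-\frac{q^2}{\gamma^2}}\,e_{*}^{\frac{2}{\gamma^2}}(q\bar p)\,e^{-\frac{\bar p^2}{\gamma^2}}.$$ The reproducing kernel property is given by the following integral representation (for $I\in\mathbb{S}$): $$f(p)=\left(\frac{2}{\pi\gamma^2}\right)\int_{\mathbb{C}_I}\overline{K_{\gamma,S}(q,p)}\,f_I(q)\,e^{\frac{(q-\bar q)^2}{\gamma^2}}\,d\lambda_I(q),\qquad p\in\mathbb{H},\quad\forall f\in\mathcal{H}_{\gamma,S}(\mathbb{H}).$$
   Context: $\mathbb{H}$ denotes the real quaternions, with conjugation $q\mapsto\bar q$ and modulus $|q|$; $\mathbb{S}=\{I\in\mathbb{H}: I^2=-1\}$; for $I\in\mathbb{S}$, $\mathbb{C}_I=\mathbb{R}+I\mathbb{R}$; every $q\in\mathbb{H}$ is of the form $q=x+Iy$ with $x,y\in\mathbb{R}$, $I\in\mathbb{S}$. The exponential of a quaternion is defined by the usual power series. For $\nu>0$ and $q,p\in\mathbb{H}$, $$e_*^{\nu}(q\bar p)=\sum_{n=0}^\infty\frac{\nu^n q^n\bar p^n}{n!}.$$ A function $f:\mathbb{H}\to\mathbb{H}$ is left slice hyperholomorphic, written $f\in\mathcal{SH}_L(\mathbb{H})$, if $f(x+Iy)=\alpha(x,y)+I\beta(x,y)$ for all $x,y\in\mathbb{R}$, $I\in\mathbb{S}$,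 where $\alpha,\beta:\mathbb{R}^2\to\mathbb{H}$ satisfy $\alpha(x,-y)=\alpha(x,y)$, $\beta(x,-y)=-\beta(x,y)$ and the Cauchy-Riemann system $\partial_x\alpha-\partial_y\beta=0$, $\partial_y\alpha+\partial_x\beta=0$. For $\gamma>0$, the slice hyperholomorphic RBF space $\mathcal{H}_{\gamma,S}(\mathbb{H})$ is the right quaternionic vector space of all $f\in\mathcal{SH}_L(\mathbb{H})$ with $$\|f\|_{\mathcal{H}_{\gamma,S}(\mathbb{H})}^2=\frac{2}{\pi\gamma^2}\int_{\mathbb{C}_I}|f_I(q)|^2e^{\frac{(q-\bar q)^2}{\gamma^2}}d\lambda_I(q)<\infty ,$$ with inner product $\langle f,g\rangle_{\mathcal{H}_{\gamma,S}(\mathbb{H})}=\frac{2}{\pi\gamma^2}\int_{\mathbb{C}_I}\overline{g_I(q)}f_I(q)e^{\frac{(q-\bar q)^2}{\gamma^2}}d\lambda_I(q)$, where $f_I=f|_{\mathbb{C}_I}$ and $d\lambda_I(q)=dx\,dy$ for $q=x+Iy$; the space does not depend on the choice of $I\in\mathbb{S}$. *)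

(* Defs.v *)
From HB Require Import structures.
From mathcomp Require Import all_boot all_order all_algebra.
From mathcomp Require Import all_classical all_reals all_analysis.
From mathcomp Require Import ring.
Set Implicit Arguments.
Unset Strict Implicit.
Unset Printing Implicit Defensive.
Import Order.TTheory GRing.Theory Num.Theory.
Import numFieldNormedType.Exports.
Local Open Scope classical_set_scope.
Local Open Scope ring_scope.

(* The row (a, b, c, d) stands for a + b i + c j + d k.  The norm [`|q|]
   inherited from 'rV[R]_4 is the sup norm of the coordinates: it only serves to
   provide the topology, the Euclidean modulus is [qmod] below. *)
Definition quat (R : realType) : Type := 'rV[R]_4.

HB.instance Definition _ (R : realType) :=
  NormedModule.copy (quat R) 'rV[R]_4.
HB.instance Definition _ (R : realType) := Complete.copy (quat R) 'rV[R]_4.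

Section quaternion_ring.
Variable R : realType.
Implicit Types p q r : quat R.

Definition mkquat (a b c d : R) : quat R := \row_(i < 4) nth 0 [:: a; b; c; d] i.

Definition qre q : R := q 0 0.
Definition qim_i q : R := q 0 1.
Definition qim_j q : R := q 0 2.
Definition qim_k q : R := q 0 3.

Definition qmul p q : quat R :=
  mkquat
    (qre p * qre q - qim_i p * qim_i q - qim_j p * qim_j q - qim_k p * qim_k q)
    (qre p * qim_i q + qim_i p * qre q + qim_j p * qim_k q - qim_k p * qim_j q)
    (qre p * qim_j q - qim_i p * qim_k q + qim_j p * qre q + qim_k p * qim_i q)
    (qre p * qim_k q + qim_i p * qim_j q - qim_j p * qim_i q + qim_k p * qre q).

Definition qone : quat R := mkquat 1 0 0 0.

Fact qre_mk a b c d : qre (mkquat a b c d) = a. Proof. by rewrite /qre mxE. Qed.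
Fact qim_i_mk a b c d : qim_i (mkquat a b c d) = b. Proof. by rewrite /qim_i mxE. Qed.
Fact qim_j_mk a b c d : qim_j (mkquat a b c d) = c. Proof. by rewrite /qim_j mxE. Qed.
Fact qim_k_mk a b c d : qim_k (mkquat a b c d) = d. Proof. by rewrite /qim_k mxE. Qed.
Fact qreD p q : qre (p + q) = qre p + qre q. Proof. by rewrite /qre mxE. Qed.
Fact qim_iD p q : qim_i (p + q) = qim_i p + qim_i q. Proof. by rewrite /qim_i mxE. Qed.
Fact qim_jD p q : qim_j (p + q) = qim_j p + qim_j q. Proof. by rewrite /qim_j mxE. Qed.
Fact qim_kD p q : qim_k (p + q) = qim_k p + qim_k q. Proof. by rewrite /qim_k mxE. Qed.
Fact qreZ (a : R) q : qre (a *: q) = a * qre q. Proof. by rewrite /qre mxE. Qed.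
Fact qim_iZ (a : R) q : qim_i (a *: q) = a * qim_i q. Proof. by rewrite /qim_i mxE. Qed.
Fact qim_jZ (a : R) q : qim_j (a *: q) = a * qim_j q. Proof. by rewrite /qim_j mxE. Qed.
Fact qim_kZ (a : R) q : qim_k (a *: q) = a * qim_k q. Proof. by rewrite /qim_k mxE. Qed.

Definition quatE := (qre_mk, qim_i_mk, qim_j_mk, qim_k_mk, qreD, qim_iD, qim_jD,
  qim_kD, qreZ, qim_iZ, qim_jZ, qim_kZ).

Fact quatP p q : qre p = qre q -> qim_i p = qim_i q -> qim_j p = qim_j q ->
  qim_k p = qim_k q -> p = q.
Proof.
move=> h0 h1 h2 h3; apply/rowP => -[[|[|[|[|//]]]] hi].
- by rewrite (_ : Ordinal hi = 0) //; apply: val_inj.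
- by rewrite (_ : Ordinal hi = 1) //; apply: val_inj.
- by rewrite (_ : Ordinal hi = 2) //; apply: val_inj.
- by rewrite (_ : Ordinal hi = 3) //; apply: val_inj.
Qed.

Fact qmulA : associative qmul.
Proof. by move=> p q r; apply: quatP; rewrite !quatE; ring. Qed.

Fact qmul1q : left_id qone qmul.
Proof. by move=> p; apply: quatP; rewrite !quatE; ring. Qed.

Fact qmulq1 : right_id qone qmul.
Proof. by move=> p; apply: quatP; rewrite !quatE; ring. Qed.

Fact qmulDl : left_distributive qmul +%R.
Proof. by move=> p q r; apply: quatP; rewrite !quatE; ring. Qed.

Fact qmulDr : right_distributive qmul +%R.
Proof. by move=> p q r; apply: quatP; rewrite !quatE; ring. Qed.

Fact qone_neq0 : qone != 0.
Proof.
by apply/eqP => /(congr1 qre); rewrite quatE /qre mxE => /eqP; rewrite oner_eq0.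
Qed.

HB.instance Definition _ :=
  GRing.Zmodule_isNzRing.Build (quat R) qmulA qmul1q qmulq1 qmulDl qmulDr
    qone_neq0.

Fact qscaleAl (a : R) p q : a *: (p * q) = (a *: p) * q.
Proof. by apply: quatP; rewrite !quatE; ring. Qed.

Fact qscaleAr (a : R) p q : a *: (p * q) = p * (a *: q).
Proof. by apply: quatP; rewrite !quatE; ring. Qed.

HB.instance Definition _ := GRing.Lmodule_isLalgebra.Build R (quat R) qscaleAl.
HB.instance Definition _ := GRing.Lalgebra_isAlgebra.Build R (quat R) qscaleAr.

End quaternion_ring.

Section quaternions.
Variable R : realType.
Implicit Types (p q I : quat R) (z : R * R).

Definition qconj q : quat R :=
  mkquat (qre q) (- qim_i q) (- qim_j q) (- qim_k q).

Definition qmod q : R :=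
  Num.sqrt (qre q ^+ 2 + qim_i q ^+ 2 + qim_j q ^+ 2 + qim_k q ^+ 2).

Definition imag_units : set (quat R) := [set I | I ^+ 2 = - 1].

(* The point x + I y of the slice C_I, for z = (x, y). *)
Definition slice I z : quat R := z.1%:A + z.2 *: I.

Definition qexp q : quat R := limn (series (fun n => n`!%:R^-1 *: q ^+ n)).

(* The function written e_*^nu(q \bar p). *)
Definition estar (nu : R) q p : quat R :=
  limn (series (fun n => (nu ^+ n / n`!%:R) *: (q ^+ n * qconj p ^+ n))).

Definition plane_measure :
    {measure set (measurableTypeR R * measurableTypeR R) -> \bar R} :=
  (@lebesgue_measure R \x @lebesgue_measure R)%E.

Definition qintegrable (F : R * R -> quat R) : Prop :=
  [/\ plane_measure.-integrable setT (fun z => (qre (F z))%:E),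
      plane_measure.-integrable setT (fun z => (qim_i (F z))%:E),
      plane_measure.-integrable setT (fun z => (qim_j (F z))%:E) &
      plane_measure.-integrable setT (fun z => (qim_k (F z))%:E)].

Definition qintegral (F : R * R -> quat R) : quat R :=
  mkquat (\int[plane_measure]_z qre (F z)) (\int[plane_measure]_z qim_i (F z))
    (\int[plane_measure]_z qim_j (F z)) (\int[plane_measure]_z qim_k (F z)).

(* [f] is left slice hyperholomorphic.  The components are required to be
   real-differentiable on R^2: the mere existence of the partial derivatives
   would not even imply continuity. *)
Definition slice_hyperholomorphic (f : quat R -> quat R) : Prop :=
  exists alpha beta : R * R -> quat R,
  [/\ forall I z, imag_units I -> f (slice I z) = alpha z + I * beta z,
      forall x y, alpha (x, - y) = alpha (x, y) /\
                  beta (x, - y) = - beta (x, y),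
      forall z, differentiable alpha z /\ differentiable beta z &
      forall z, 'D_(1, 0) alpha z - 'D_(0, 1) beta z = 0 /\
                'D_(0, 1) alpha z + 'D_(1, 0) beta z = 0].

End quaternions.

Section hilbert_spaces.
Variables (R : realType) (X : Type).
Implicit Types (V : set (X -> quat R)) (f g h : X -> quat R) (a : quat R).
Implicit Types (ip : (X -> quat R) -> (X -> quat R) -> quat R).
Implicit Types (nrm : (X -> quat R) -> R).

(* The pairing is right linear in its first argument, following the convention
   <f, g> = \int \overline{g} f; being Hermitian, it is conjugate linear in the
   second one. *)
Record right_hilbert_space V ip nrm : Prop := {
  rhs_zero : V (fun=> 0);
  rhs_add : forall f g, V f -> V g -> V (fun x => f x + g x);
  rhs_scale : forall f a, V f -> V (fun x => f x * a);
  rhs_ip_add : forall f g h, V f -> V g -> V h ->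
    ip (fun x => f x + g x) h = ip f h + ip g h;
  rhs_ip_scale : forall f g a, V f -> V g -> ip (fun x => f x * a) g = ip f g * a;
  rhs_ip_herm : forall f g, V f -> V g -> ip g f = qconj (ip f g);
  rhs_ip_norm : forall f, V f -> ip f f = (nrm f ^+ 2)%:A;
  rhs_norm_ge0 : forall f, V f -> 0 <= nrm f;
  rhs_norm_eq0 : forall f, V f -> nrm f = 0 -> f = (fun=> 0);
  rhs_complete : forall u : nat -> X -> quat R, (forall n, V (u n)) ->
    (forall e : R, 0 < e -> exists N : nat, forall m n,
       (N <= m)%N -> (N <= n)%N -> nrm (fun x => u m x - u n x) < e) ->
    exists2 f, V f & (nrm (fun x => u n x - f x) @[n --> \oo] --> (0 : R))
}.

Record reproducing_kernel_hilbert_space V ip nrm (K : X -> X -> quat R) : Prop := {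
  rkhs_hilbert : right_hilbert_space V ip nrm;
  rkhs_kernel : forall p, V (K ^~ p);
  rkhs_reproducing : forall f p, V f -> f p = ip f (K ^~ p)
}.

End hilbert_spaces.

Section rbf.
Variables (R : realType) (gamma : R).
Implicit Types (f g : quat R -> quat R) (p q I : quat R).

(* e^{(q - \bar q)^2 / gamma^2}; it is real, since q - \bar q is purely
   imaginary, whence the use of its real part in [rbf_sqnorm]. *)
Definition rbf_weight q : quat R :=
  qexp ((gamma ^+ 2)^-1 *: (q - qconj q) ^+ 2).

Definition rbf_sqnorm I f : \bar R :=
  ((2 / (pi * gamma ^+ 2))%:E *
   \int[@plane_measure R]_z
     (qmod (f (slice I z)) ^+ 2 * qre (rbf_weight (slice I z)))%:E)%E.

Definition rbf_norm I f : R := Num.sqrt (fine (rbf_sqnorm I f)).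

Definition rbf_space I : set (quat R -> quat R) :=
  [set f | slice_hyperholomorphic f /\ (rbf_sqnorm I f < +oo)%E].

Definition rbf_integrand f g q : quat R := qconj (g q) * f q * rbf_weight q.

Definition rbf_inner I f g : quat R :=
  (2 / (pi * gamma ^+ 2)) *: qintegral (rbf_integrand f g \o slice I).

Definition rbf_kernel q p : quat R :=
  qexp (- ((gamma ^+ 2)^-1 *: q ^+ 2)) * estar (2 / gamma ^+ 2) q p *
  qexp (- ((gamma ^+ 2)^-1 *: qconj p ^+ 2)).

End rbf.

(* Main.v *)
(* Restricted to a slice C_I, a slice hyperholomorphic function is an H-valued
   holomorphic function F; conversely F determines f through the representation
   formula f(x + J y) = (1 - J I)/2 F(x + I y) + (1 + J I)/2 F(x - I y).  The
   whole statement thus reduces to a single slice, where the kernel is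
     k_u(z) = exp (- (z - \bar u)^2 / gamma^2).
   Completing the square, \overline{k_u(z + u)} times the weight at z + u is the
   Gaussian exp (- 2 |z|^2 / gamma^2) times a holomorphic function of z equal to
   1 at 0, so that the reproducing formula is the mean value property of a
   holomorphic function with respect to a rotation invariant Gaussian measure.
   The circle mean value property is itself derived from Goursat's theorem for
   functions which are merely real-differentiable.

   For completeness, the reproducing formula bounds the values of F and its
   second order Taylor remainder by the norm of F.  Hence a Cauchy sequence
   converges pointwise together with its derivatives, the Taylor bound passes to
   the limit and makes the limit holomorphic, and Fatou's lemma gives
   convergence in norm.  Independence of the slice is the parallelogram identity
   applied to alpha + I beta and alpha - I beta, the values of f at x + I y and
   x - I y. *)
Require Import Defs.
From HB Require Import structures.
From mathcomp Require Import all_boot all_order all_algebra.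
From mathcomp Require Import all_classical all_reals all_analysis.
From mathcomp Require Import measurable_realfun ring lra.
Set Implicit Arguments.
Unset Strict Implicit.
Unset Printing Implicit Defensive.
Import Order.TTheory GRing.Theory Num.Theory.
Import numFieldNormedType.Exports.
Local Open Scope classical_set_scope.
Local Open Scope ring_scope.

(** The obstacle is that the components are differentiable with no continuity of the partial
    derivatives: a circle mean cannot be differentiated under the integral sign, whence the
    bisection argument of Goursat. The completeness proof likewise uses neither power series nor
    Cauchy estimates. The kernel being explicit, its Taylor remainder in u has norm O(|h|^2), and
    pairing with F carries this bound over to F; the derivative of F at z is then controlled by the
    values at z and z + 1 and one remainder.

    As H is not commutative, sides matter. Holomorphy and the representation coefficients in q act
    from the left; the coefficients in p stand to the right of the kernel and return to the left
    when the pairing conjugates it. The coefficients (1 - J I)/2 and (1 + J I)/2 pass through power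
    series by relations e a = b e, which make sense even when e is not invertible.

    All estimates are qualitative: the weighted inequality of arithmetic and geometric means stands
    in for Cauchy-Schwarz, and sup norm and modulus are compared up to a factor 2. *)

Section quaternion_algebra.
Variable R : realType.
Implicit Types (p q I J : quat R) (z w : R * R) (a b : R).

(** * Algebra of quaternions, modulus and slices *)

Lemma qreN q : qre (- q) = - qre q. Proof. by rewrite /qre mxE. Qed.
Lemma qim_iN q : qim_i (- q) = - qim_i q. Proof. by rewrite /qim_i mxE. Qed.
Lemma qim_jN q : qim_j (- q) = - qim_j q. Proof. by rewrite /qim_j mxE. Qed.
Lemma qim_kN q : qim_k (- q) = - qim_k q. Proof. by rewrite /qim_k mxE. Qed.
Lemma qre0 : qre (0 : quat R) = 0. Proof. by rewrite /qre mxE. Qed.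
Lemma qim_i0 : qim_i (0 : quat R) = 0. Proof. by rewrite /qim_i mxE. Qed.
Lemma qim_j0 : qim_j (0 : quat R) = 0. Proof. by rewrite /qim_j mxE. Qed.
Lemma qim_k0 : qim_k (0 : quat R) = 0. Proof. by rewrite /qim_k mxE. Qed.
Lemma qre1 : qre (1 : quat R) = 1. Proof. exact: qre_mk. Qed.
Lemma qim_i1 : qim_i (1 : quat R) = 0. Proof. exact: qim_i_mk. Qed.
Lemma qim_j1 : qim_j (1 : quat R) = 0. Proof. exact: qim_j_mk. Qed.
Lemma qim_k1 : qim_k (1 : quat R) = 0. Proof. exact: qim_k_mk. Qed.
Lemma qreM p q : qre (p * q) =
  qre p * qre q - qim_i p * qim_i q - qim_j p * qim_j q - qim_k p * qim_k q.
Proof. exact: qre_mk. Qed.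
Lemma qim_iM p q : qim_i (p * q) =
  qre p * qim_i q + qim_i p * qre q + qim_j p * qim_k q - qim_k p * qim_j q.
Proof. exact: qim_i_mk. Qed.
Lemma qim_jM p q : qim_j (p * q) =
  qre p * qim_j q - qim_i p * qim_k q + qim_j p * qre q + qim_k p * qim_i q.
Proof. exact: qim_j_mk. Qed.
Lemma qim_kM p q : qim_k (p * q) =
  qre p * qim_k q + qim_i p * qim_j q - qim_j p * qim_i q + qim_k p * qre q.
Proof. exact: qim_k_mk. Qed.

Definition quatX := (@quatE R, qreN, qim_iN, qim_jN, qim_kN, qre0, qim_i0,
  qim_j0, qim_k0, qre1, qim_i1, qim_j1, qim_k1, qreM, qim_iM, qim_jM, qim_kM).

Lemma qconjD p q : qconj (p + q) = qconj p + qconj q.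
Proof. by apply: quatP; rewrite !quatX; ring. Qed.
Lemma qconjN q : qconj (- q) = - qconj q.
Proof. by apply: quatP; rewrite !quatX; ring. Qed.
Lemma qconjZ a q : qconj (a *: q) = a *: qconj q.
Proof. by apply: quatP; rewrite !quatX; ring. Qed.
Lemma qconjM p q : qconj (p * q) = qconj q * qconj p.
Proof. by apply: quatP; rewrite !quatX; ring. Qed.
Lemma qconjK q : qconj (qconj q) = q.
Proof. by apply: quatP; rewrite !quatX; ring. Qed.
Lemma qconj1 : qconj 1 = 1 :> quat R.
Proof. by apply: quatP; rewrite !quatX; ring. Qed.

Lemma qmod_ge0 q : 0 <= qmod q.
Proof. exact: sqrtr_ge0. Qed.
Lemma qmod_sqr q :
  qmod q ^+ 2 = qre q ^+ 2 + qim_i q ^+ 2 + qim_j q ^+ 2 + qim_k q ^+ 2.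
Proof. by rewrite /qmod sqr_sqrtr// !addr_ge0 ?sqr_ge0. Qed.

Lemma qmodP q a : 0 <= a ->
  a ^+ 2 = qre q ^+ 2 + qim_i q ^+ 2 + qim_j q ^+ 2 + qim_k q ^+ 2 ->
  qmod q = a.
Proof. by move=> a0 e; rewrite /qmod -e sqrtr_sqr ger0_norm. Qed.

Lemma qmodM p q : qmod (p * q) = qmod p * qmod q.
Proof.
apply: qmodP; first by rewrite mulr_ge0 ?qmod_ge0.
by rewrite exprMn !qmod_sqr !quatX; ring.
Qed.
Lemma qmodZ a q : qmod (a *: q) = `|a| * qmod q.
Proof.
apply: qmodP; first by rewrite mulr_ge0 ?qmod_ge0.
by rewrite exprMn real_normK ?num_real// !qmod_sqr !quatX; ring.
Qed.
Lemma qmodN q : qmod (- q) = qmod q.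
Proof. by rewrite /qmod !quatX !sqrrN. Qed.
Lemma qmod0 : qmod 0 = 0 :> R.
Proof. by apply: qmodP => //; rewrite !quatX; ring. Qed.
Lemma qmod1 : qmod 1 = 1 :> R.
Proof. by apply: qmodP => //; rewrite !quatX; ring. Qed.
Lemma qmodX q n : qmod (q ^+ n) = qmod q ^+ n.
Proof.
by elim: n => [|n ih]; rewrite ?expr0 ?qmod1// !exprS qmodM ih.
Qed.
Lemma qmod_conj q : qmod (qconj q) = qmod q.
Proof. by rewrite /qmod /qconj !quatX !sqrrN. Qed.
Lemma mul_qconj q : qconj q * q = (qmod q ^+ 2)%:A.
Proof. by apply: quatP; rewrite qmod_sqr !quatX; ring. Qed.

Lemma ler_qre_qmod q : `|qre q| <= qmod q.
Proof.
rewrite -(ler_pXn2r (n:=2)) ?nnegrE ?qmod_ge0//.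
rewrite real_normK ?num_real// qmod_sqr -!addrA lerDl !addr_ge0 ?sqr_ge0//.
Qed.
Lemma ler_qim_i_qmod q : `|qim_i q| <= qmod q.
Proof.
rewrite -(ler_pXn2r (n:=2)) ?nnegrE ?qmod_ge0//.
rewrite real_normK ?num_real// qmod_sqr.
have := sqr_ge0 (qre q); have := sqr_ge0 (qim_j q); have := sqr_ge0 (qim_k q).
lra.
Qed.
Lemma ler_qim_j_qmod q : `|qim_j q| <= qmod q.
Proof.
rewrite -(ler_pXn2r (n:=2)) ?nnegrE ?qmod_ge0//.
rewrite real_normK ?num_real// qmod_sqr.
have := sqr_ge0 (qre q); have := sqr_ge0 (qim_i q); have := sqr_ge0 (qim_k q).
lra.
Qed.
Lemma ler_qim_k_qmod q : `|qim_k q| <= qmod q.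
Proof.
rewrite -(ler_pXn2r (n:=2)) ?nnegrE ?qmod_ge0//.
rewrite real_normK ?num_real// qmod_sqr.
have := sqr_ge0 (qre q); have := sqr_ge0 (qim_j q); have := sqr_ge0 (qim_i q).
lra.
Qed.

(** Cauchy-Schwarz in R^4 comes from multiplicativity of the modulus: Re(conj p q) is at most |conj
    p q| = |p| |q|. *)
Lemma ler_qmodD p q : qmod (p + q) <= qmod p + qmod q.
Proof.
rewrite -(ler_pXn2r (n:=2)) ?nnegrE ?addr_ge0 ?qmod_ge0//.
rewrite sqrrD !qmod_sqr.
have : qre (qconj p * q) <= qmod p * qmod q.
  apply: le_trans (ler_norm _) _; rewrite -(qmod_conj p) -qmodM.
  exact: ler_qre_qmod.
rewrite /qconj !quatX => h; rewrite mulr2n; nra.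
Qed.

Lemma ler_qmodB p q : qmod (p - q) <= qmod p + qmod q.
Proof. by rewrite -(qmodN q) ler_qmodD. Qed.

Lemma ler_qmod_sum (n : nat) (F : nat -> quat R) :
  qmod (\sum_(0 <= i < n) F i) <= \sum_(0 <= i < n) qmod (F i).
Proof.
elim: n => [|n ih]; first by rewrite !big_nil qmod0.
by rewrite !big_nat_recr//= (le_trans (ler_qmodD _ _))// lerD2r.
Qed.

Lemma qmod_eq0 q : qmod q = 0 -> q = 0.
Proof.
move=> q0; apply: quatP; rewrite !quatX; apply/eqP; rewrite -normr_le0 -q0.
- exact: ler_qre_qmod.
- exact: ler_qim_i_qmod.
- exact: ler_qim_j_qmod.
- exact: ler_qim_k_qmod.
Qed.

(** With [ler_qmod_norm], this compares the sup norm, which carries the topology, with the modulus,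
    in which the estimates are made; the factor 2 there is the square root of the dimension 4. *)
Lemma ler_norm_qmod q : `|q| <= qmod q.
Proof.
have [->|q0] := eqVneq q 0; first by rewrite qmod0 normr0.
have [[i j] ->] : exists i, `|q| = `|q i.1 i.2|.
  by apply: mx_norm_neq0; apply: contra_neq q0 => /mx_norm_eq0.
rewrite (ord1 i) /=; case: j => -[|[|[|[|//]]]] hj.
- by rewrite (_ : Ordinal hj = 0) ?ler_qre_qmod//; apply: val_inj.
- by rewrite (_ : Ordinal hj = 1) ?ler_qim_i_qmod//; apply: val_inj.
- by rewrite (_ : Ordinal hj = 2) ?ler_qim_j_qmod//; apply: val_inj.
- by rewrite (_ : Ordinal hj = 3) ?ler_qim_k_qmod//; apply: val_inj.
Qed.

Lemma ler_coord_norm q (j : 'I_4) : `|q 0 j| <= `|q|.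
Proof.
rewrite [leRHS]/Num.norm/= mx_normrE.
by apply/bigmax_geP; right => /=; exists (0, j).
Qed.

Lemma ler_qmod_norm q : qmod q <= 2 * `|q|.
Proof.
rewrite -(ler_pXn2r (n:=2)) ?nnegrE ?mulr_ge0 ?qmod_ge0//.
rewrite exprMn qmod_sqr.
have h (j : 'I_4) : (q 0 j) ^+ 2 <= `|q| ^+ 2.
  by rewrite -real_normK ?num_real// lerXn2r ?nnegrE ?ler_coord_norm.
have := h 0; have := h 1; have := h 2; have := h 3.
rewrite /qre /qim_i /qim_j /qim_k; lra.
Qed.

Lemma imag_unit_qre I : imag_units I -> qre I = 0.
Proof.
rewrite /imag_units /= expr2 => h.
have := congr1 (@qre R) h; have := congr1 (@qim_i R) h.
have := congr1 (@qim_j R) h; have := congr1 (@qim_k R) h.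
rewrite !quatX => hk hj hi hr.
(* The imaginary parts of I I = -1 read 2 Re(I) Im(I) = 0; a nonzero real part would make I real,
   with a nonnegative square. *)
have [//|r0] := eqVneq (qre I) 0.
have i0 : qim_i I = 0 by apply: (mulfI r0); lra.
have j0 : qim_j I = 0 by apply: (mulfI r0); lra.
have k0 : qim_k I = 0 by apply: (mulfI r0); lra.
have := sqr_ge0 (qre I); rewrite i0 j0 k0 in hr; nra.
Qed.

Lemma imag_unit_conj I : imag_units I -> qconj I = - I.
Proof.
move=> /imag_unit_qre h; apply: quatP; rewrite !quatX ?h//; ring.
Qed.

Lemma imag_unitM I : imag_units I -> I * I = - 1.
Proof. by rewrite -expr2. Qed.

Lemma imag_unit_sqr I : imag_units I ->
  qim_i I ^+ 2 + qim_j I ^+ 2 + qim_k I ^+ 2 = 1.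
Proof.
move=> hI; have := congr1 (@qre R) (imag_unitM hI).
by rewrite !quatX imag_unit_qre//; lra.
Qed.

Lemma qmod_imag_unit I : imag_units I -> qmod I = 1.
Proof.
move=> hI; apply: qmodP => //.
by have := imag_unit_sqr hI; rewrite imag_unit_qre//; lra.
Qed.

Lemma imag_unitsP I : qre I = 0 ->
  qim_i I ^+ 2 + qim_j I ^+ 2 + qim_k I ^+ 2 = 1 -> imag_units I.
Proof.
move=> r0 h; rewrite /imag_units /= expr2.
by apply: quatP; rewrite !quatX r0; lra.
Qed.

Lemma exists_slice q : exists2 I, imag_units I & exists z, q = slice I z.
Proof.
pose n := Num.sqrt (qim_i q ^+ 2 + qim_j q ^+ 2 + qim_k q ^+ 2).
have n2 : n ^+ 2 = qim_i q ^+ 2 + qim_j q ^+ 2 + qim_k q ^+ 2.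
  by rewrite sqr_sqrtr// !addr_ge0 ?sqr_ge0.
have [n0|n0] := eqVneq n 0.
(* A real quaternion lies on every slice; the unit i is an arbitrary choice. *)
- exists (mkquat 0 1 0 0); first by apply: imag_unitsP; rewrite !quatX; ring.
  exists (qre q, 0); move: n2; rewrite n0 expr0n/= => h.
  have := sqr_ge0 (qim_i q); have := sqr_ge0 (qim_j q).
  have := sqr_ge0 (qim_k q) => h1 h2 h3.
  have zz x : x ^+ 2 = 0 -> x = 0 :> R by move/eqP; rewrite sqrf_eq0 => /eqP.
  have e1 : qim_i q = 0 by apply: zz; lra.
  have e2 : qim_j q = 0 by apply: zz; lra.
  have e3 : qim_k q = 0 by apply: zz; lra.
  by apply: quatP; rewrite /slice !quatX/= ?e1 ?e2 ?e3; ring.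
- exists (mkquat 0 (qim_i q / n) (qim_j q / n) (qim_k q / n)).
    apply: imag_unitsP; rewrite !quatX//.
    rewrite !expr_div_n -!mulrDl -n2 divff// sqrf_eq0//.
  exists (qre q, n).
  by apply: quatP; rewrite /slice !quatX/= ?mulr0 ?add0r ?addr0 ?mulr1// mulrC divfK.
Qed.

Lemma sliceD I z w : slice I (z + w) = slice I z + slice I w.
Proof. by rewrite /slice/= !scalerDl addrACA. Qed.
Lemma sliceZ I a z : slice I (a *: z) = a *: slice I z.
Proof. by rewrite /slice/= scalerDr !scalerA. Qed.
Lemma sliceN I z : slice I (- z) = - slice I z.
Proof. by rewrite -scaleN1r sliceZ scaleN1r. Qed.
Lemma sliceB I z w : slice I (z - w) = slice I z - slice I w.
Proof. by rewrite sliceD sliceN. Qed.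
Lemma slice0 I : slice I 0 = 0.
Proof. by rewrite /slice/= !scale0r addr0. Qed.
Lemma slice_real I a : slice I (a, 0) = a%:A.
Proof. by rewrite /slice/= scale0r addr0. Qed.
Lemma slice01 I : slice I (0, 1) = I.
Proof. by rewrite /slice/= scale0r add0r scale1r. Qed.
Lemma slice10 I : slice I (1, 0) = 1.
Proof. by rewrite slice_real scale1r. Qed.

Lemma sliceM I z w : imag_units I ->
  slice I z * slice I w =
  slice I (z.1 * w.1 - z.2 * w.2, z.1 * w.2 + z.2 * w.1).
Proof.
move=> hI; rewrite /slice/= mulrDl !mulrDr.
rewrite -!scalerAl -!scalerAr !mul1r !mulr1 !scalerA (imag_unitM hI).
by rewrite scalerN [X in _ + X = _]addrC addrACA -scalerBl -scalerDl.
Qed.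

Lemma qconj_slice I z : imag_units I -> qconj (slice I z) = slice I (z.1, - z.2).
Proof.
by move=> hI; rewrite /slice qconjD !qconjZ qconj1 imag_unit_conj//= scalerN scaleNr.
Qed.

Lemma qmod_slice I z : imag_units I -> qmod (slice I z) ^+ 2 = z.1 ^+ 2 + z.2 ^+ 2.
Proof.
move=> hI; rewrite qmod_sqr /slice !quatX imag_unit_qre//.
by have := imag_unit_sqr hI; nra.
Qed.

Lemma sliceC I z w : imag_units I -> slice I z * slice I w = slice I w * slice I z.
Proof. by move=> hI; rewrite !sliceM//; congr slice; congr pair; ring. Qed.

End quaternion_algebra.

(** * Differentiability in epsilon-delta form *)

Section differentials.
Variables (R : realType) (V W : normedModType R).

Lemma differentiable_eps (f : V -> W) x : differentiable f x ->
  forall e : R, 0 < e -> exists2 d : R, 0 < d &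
    forall h, `|h| < d -> `|f (x + h) - f x - 'd f x h| <= e * `|h|.
Proof.
move=> /diff_locally/eqaddoP h e e0.
have /nbhs_ballP[d /= d0 hd] := h _ e0.
exists d => // u ud; have := hd u; rewrite -ball_normE/= sub0r normrN => /(_ ud).
by rewrite !fctE /= (addrC u x) opprD addrA.
Qed.

Lemma eps_is_diff (f : V -> W) x (D : {linear V -> W}) : continuous D ->
  (forall e : R, 0 < e -> exists2 d : R, 0 < d &
    forall h, `|h| < d -> `|f (x + h) - f x - D h| <= e * `|h|) ->
  is_diff x f D.
Proof.
move=> cD hD.
have fD : f \o shift x = cst (f x) + (D : V -> W) +o_ (0 : V) id.
  apply/eqaddoP => e e0; have [d d0 hd] := hD _ e0.
  apply/nbhs_ballP; exists d => //= u; rewrite -ball_normE/= sub0r normrN => ud.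
  by have := hd u ud; rewrite !fctE /= (addrC u x) opprD addrA.
have dD : 'd f x = D :> (V -> W) by apply: diff_unique.
split => //; apply/diff_locallyP; rewrite dD; split => //.
Qed.

End differentials.

(** * Goursat's theorem on rectangles *)

Section mean_value.
Variable R : realType.

(** End points are included and [a = b] is allowed, since the rectangles of the bisection may be
    flat. *)
Lemma MVT_closed (f df : R -> R) (a b : R) : a <= b ->
  (forall x, a <= x <= b -> is_derive x (1 : R) f (df x)) ->
  exists2 c, a <= c <= b & f b - f a = df c * (b - a).
Proof.
move=> ab hf.
have [||c] := @MVT_segment R f df a b ab.
- by move=> x; rewrite in_itv/= => /andP[/ltW ax /ltW xb]; apply: hf; rewrite ax.
- apply: derivable_within_continuous => x; rewrite in_itv/= => xab.
  by have [] := hf _ xab.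
by rewrite in_itv/=; exists c.
Qed.

End mean_value.

Section second_difference.
Variables (R : realType).
Implicit Types (s t l m e : R).

(** Both linear parts involve the same derivative [D], which is the Cauchy-Riemann relation, so
    [m * (u1 - u2)] and [l * (v1 - v2)] cancel and only remainders are left. The factors [t + m - t]
    and [s + l - s] are the interval lengths as the mean value theorem produces them. *)
Lemma second_difference_eq s t l m D x0 x1 x2 y0 y1 y2 u1 u2 v1 v2 :
  u1 - u2 = l * D -> v1 - v2 = m * D ->
  (x1 - x2) * (t + m - t) - (y1 - y2) * (s + l - s) =
  m * ((x1 - x0 - u1) - (x2 - x0 - u2)) -
  l * ((y1 - y0 - v1) - (y2 - y0 - v2)) :> R.
Proof.
move=> hu hv; have -> : u1 = u2 + l * D by lra.
have -> : v1 = v2 + m * D by lra.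
ring.
Qed.

Lemma second_difference_le l m e p1 p2 p3 p4 : 0 <= l -> 0 <= m ->
  `|p1| <= e / 2 * (l + m) -> `|p2| <= e / 2 * (l + m) ->
  `|p3| <= e / 2 * (l + m) -> `|p4| <= e / 2 * (l + m) ->
  `|m * (p1 - p2) - l * (p3 - p4)| <= e * (l + m) ^+ 2.
Proof.
move=> l0 m0; rewrite !ler_norml => A1 A2 B1 B2.
have hp : `|p1 - p2| <= e * (l + m) by rewrite ler_norml; lra.
have hq : `|p3 - p4| <= e * (l + m) by rewrite ler_norml; lra.
rewrite -ler_norml.
apply: le_trans (ler_normB _ _) _; rewrite !normrM (ger0_norm m0) (ger0_norm l0).
have := ler_wpM2l m0 hp; have := ler_wpM2l l0 hq; lra.
Qed.

End second_difference.

Section goursat.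
Variables (R : realType) (A B : R * R -> R) (G H : R -> R -> R).
Variables (a b c d : R).
Hypotheses (dA : forall z, differentiable A z)
  (dB : forall z, differentiable B z).
Hypothesis AB : forall z, 'D_(1, 0) A z = 'D_(0, 1) B z.
Hypothesis GA : forall s t, c <= t <= d -> is_derive t (1 : R) (G s) (A (s, t)).
Hypothesis HB : forall s t, a <= s <= b ->
  is_derive s (1 : R) (H ^~ t) (B (s, t)).

(** The integral of B ds + A dt along the boundary of the rectangle with lower corner (s, t) and
    sides l, m, expressed through the antiderivatives [G] and [H]. *)
Let E (s t l m : R) :=
  (G (s + l) (t + m) - G (s + l) t - G s (t + m) + G s t) -
  (H (s + l) (t + m) - H (s + l) t - H s (t + m) + H s t).

(** Boundary integrals add up over the four quarters, so one quarter carries at least a fourth of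
    the absolute value. *)
Let E_quarter (p : R * R) (l m : R) : exists q : R * R,
  ((q.1 = p.1 \/ q.1 = p.1 + l / 2) /\ (q.2 = p.2 \/ q.2 = p.2 + m / 2)) /\
  `|E p.1 p.2 l m| <= 4 * `|E q.1 q.2 (l / 2) (m / 2)|.
Proof.
case: p => s t /=; apply: contrapT => hn.
have h q : ((q.1 = s \/ q.1 = s + l / 2) /\ (q.2 = t \/ q.2 = t + m / 2)) ->
    4 * `|E q.1 q.2 (l / 2) (m / 2)| < `|E s t l m|.
  by move=> hq; rewrite ltNge; apply/negP => hE; apply: hn; exists q.
have h1 := h (s, t) (conj (or_introl erefl) (or_introl erefl)).
have h2 := h (s + l / 2, t) (conj (or_intror erefl) (or_introl erefl)).
have h3 := h (s, t + m / 2) (conj (or_introl erefl) (or_intror erefl)).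
have h4 := h (s + l / 2, t + m / 2) (conj (or_intror erefl) (or_intror erefl)).
have e : E s t l m = E s t (l / 2) (m / 2) + E (s + l / 2) t (l / 2) (m / 2) +
   (E s (t + m / 2) (l / 2) (m / 2) +
    E (s + l / 2) (t + m / 2) (l / 2) (m / 2)).
  have hl : s + l / 2 + l / 2 = s + l by field.
  have hm : t + m / 2 + m / 2 = t + m by field.
  by rewrite /E hl hm; ring.
have := ler_normD (E s t (l / 2) (m / 2) + E (s + l / 2) t (l / 2) (m / 2))
  (E s (t + m / 2) (l / 2) (m / 2) +
    E (s + l / 2) (t + m / 2) (l / 2) (m / 2)).
have := ler_normD (E s t (l / 2) (m / 2)) (E (s + l / 2) t (l / 2) (m / 2)).
have := ler_normD (E s (t + m / 2) (l / 2) (m / 2))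
    (E (s + l / 2) (t + m / 2) (l / 2) (m / 2)).
move: h1 h2 h3 h4; rewrite -e /=; lra.
Qed.

(** Differentiability is used at the single point (x, y). The mean value theorem turns each pair of
    opposite sides into an increment of [A] or [B]; after replacing these by their affine
    approximations at (x, y), the linear parts cancel by [AB]. *)
Let E_small (x y : R) : forall e : R, 0 < e -> exists2 k : R, 0 < k &
  forall s t l m, 0 <= l -> 0 <= m -> a <= s -> s + l <= b -> c <= t ->
    t + m <= d -> s <= x <= s + l -> t <= y <= t + m -> l + m < k ->
    `|E s t l m| <= e * (l + m) ^+ 2.
Proof.
move=> e e0; have e20 : 0 < e / 2 by rewrite divr_gt0.
have [k1 k10 h1] := differentiable_eps (dA (x, y)) e20.
have [k2 k20 h2] := differentiable_eps (dB (x, y)) e20.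
exists (Num.min k1 k2); first by rewrite lt_min k10.
move=> s t l m l0 m0 as_ slb ct tmd sx ty; rewrite lt_min => /andP[lm1 lm2].
have hn s' t' : s <= s' <= s + l -> t <= t' <= t + m ->
    `|((s', t') : R * R) - (x, y)| <= l + m.
  move=> hs ht; rewrite /Num.norm/= ge_max; apply/andP; split.
    by rewrite ler_norml/=; lra.
  by rewrite ler_norml/=; lra.
have hA s' t' : s <= s' <= s + l -> t <= t' <= t + m ->
    `|A (s', t') - A (x, y) - 'd A (x, y) ((s', t') - (x, y))| <=
    e / 2 * (l + m).
  move=> hs ht; have hn' := hn _ _ hs ht.
  have := h1 ((s', t') - (x, y)) (le_lt_trans hn' lm1).
  rewrite (subrKC ((x, y) : R * R)) => /le_trans; apply; rewrite ler_wpM2l// ltW//.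
have hB s' t' : s <= s' <= s + l -> t <= t' <= t + m ->
    `|B (s', t') - B (x, y) - 'd B (x, y) ((s', t') - (x, y))| <=
    e / 2 * (l + m).
  move=> hs ht; have hn' := hn _ _ hs ht.
  have := h2 ((s', t') - (x, y)) (le_lt_trans hn' lm2).
  rewrite (subrKC ((x, y) : R * R)) => /le_trans; apply; rewrite ler_wpM2l// ltW//.
have [||xi hxi Gxi] := @MVT_closed R (fun t => G (s + l) t - G s t)
    (fun t => A (s + l, t) - A (s, t)) t (t + m).
- lra.
- move=> t' ht'; apply: is_deriveB; apply: GA; lra.
have [||eta heta Heta] := @MVT_closed R (fun s => H s (t + m) - H s t)
    (fun s => B (s, t + m) - B (s, t)) s (s + l).
- lra.
- move=> s' hs'; apply: (is_deriveB (f := H ^~ (t + m)) (g := H ^~ t)); apply: HB; lra.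
have sI : s <= s <= s + l by lra.
have slI : s <= s + l <= s + l by lra.
have tI : t <= t <= t + m by lra.
have tmI : t <= t + m <= t + m by lra.
have A1 := hA _ _ slI hxi; have A2 := hA _ _ sI hxi.
have B1 := hB _ _ heta tmI; have B2 := hB _ _ heta tI.
have dAl : 'd A (x, y) ((s + l, xi) - (x, y)) - 'd A (x, y) ((s, xi) - (x, y)) =
    l * 'D_(1, 0) A (x, y).
  rewrite deriveE// -linearB -linearZ; congr ('d A _ _).
  by congr pair; rewrite /= ?scaler0; [rewrite [l *: 1]mulr1|]; ring.
have dBl : 'd B (x, y) ((eta, t + m) - (x, y)) -
    'd B (x, y) ((eta, t) - (x, y)) = m * 'D_(0, 1) B (x, y).
  rewrite deriveE// -linearB -linearZ; congr ('d B _ _).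
  by congr pair; rewrite /= ?scaler0; [|rewrite [m *: 1]mulr1]; ring.
have -> : E s t l m = m * ((A (s + l, xi) - A (x, y) -
     'd A (x, y) ((s + l, xi) - (x, y))) - (A (s, xi) - A (x, y) -
     'd A (x, y) ((s, xi) - (x, y)))) - l * ((B (eta, t + m) - B (x, y) -
     'd B (x, y) ((eta, t + m) - (x, y))) - (B (eta, t) - B (x, y) -
     'd B (x, y) ((eta, t) - (x, y)))).
  have -> : E s t l m = ((G (s + l) (t + m) - G s (t + m)) -
     (G (s + l) t - G s t)) - ((H (s + l) (t + m) - H (s + l) t) -
     (H s (t + m) - H s t)) by rewrite /E; ring.
  by rewrite AB in dAl; rewrite Gxi Heta; exact: second_difference_eq dAl dBl.
exact: second_difference_le.
Qed.

Lemma goursat_rectangle : a <= b -> c <= d ->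
  G b d - G b c - G a d + G a c = H b d - H b c - H a d + H a c.
Proof.
move=> ab cd; apply/eqP; rewrite -subr_eq0; apply/eqP.
pose l n := (b - a) / 2 ^+ n; pose m n := (d - c) / 2 ^+ n.
have lS n : l n / 2 = l n.+1 by rewrite /l exprSr invfM mulrA.
have mS n : m n / 2 = m n.+1 by rewrite /m exprSr invfM mulrA.
have l0 n : 0 <= l n by rewrite divr_ge0 ?subr_ge0// exprn_ge0.
have m0 n : 0 <= m n by rewrite divr_ge0 ?subr_ge0// exprn_ge0.
pose step n p := projT1 (cid (E_quarter p (l n) (m n))).
pose P := fix P n := if n is k.+1 then step k (P k) else (a, c).
have stepP n : (((P n.+1).1 = (P n).1 \/ (P n.+1).1 = (P n).1 + l n / 2) /\
     ((P n.+1).2 = (P n).2 \/ (P n.+1).2 = (P n).2 + m n / 2)) /\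
    `|E (P n).1 (P n).2 (l n) (m n)| <=
     4 * `|E (P n.+1).1 (P n.+1).2 (l n / 2) (m n / 2)|.
  by rewrite /= /step; case: cid.
have P1S n : (P n).1 <= (P n.+1).1 /\ (P n.+1).1 + l n.+1 <= (P n).1 + l n.
  by have := l0 n; rewrite -lS; case: (stepP n) => -[[->|->] _] _; lra.
have P2S n : (P n).2 <= (P n.+1).2 /\ (P n.+1).2 + m n.+1 <= (P n).2 + m n.
  by have := m0 n; rewrite -mS; case: (stepP n) => -[_ [->|->]] _; lra.
have P1mono : {homo (fun n => (P n).1) : i j / (i <= j)%N >-> i <= j}.
  by apply: homo_leq => // [x y z /le_trans|n]; [apply|case: (P1S n)].
have P2mono : {homo (fun n => (P n).2) : i j / (i <= j)%N >-> i <= j}.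
  by apply: homo_leq => // [x y z /le_trans|n]; [apply|case: (P2S n)].
have P1anti : {homo (fun n => (P n).1 + l n) : i j / (i <= j)%N >-> j <= i}.
  by apply: (@homo_leq _ _ (fun x y => y <= x)) => // [x y z xy yz|n];
    [exact: le_trans yz xy|case: (P1S n)].
have P2anti : {homo (fun n => (P n).2 + m n) : i j / (i <= j)%N >-> j <= i}.
  by apply: (@homo_leq _ _ (fun x y => y <= x)) => // [x y z xy yz|n];
    [exact: le_trans yz xy|case: (P2S n)].
have P1le i j : (P i).1 <= (P j).1 + l j.
  case: (leqP i j) => ij; first by rewrite (le_trans (P1mono _ _ ij))// lerDl.
  by rewrite (le_trans _ (P1anti _ _ (ltnW ij)))// lerDl.
have P2le i j : (P i).2 <= (P j).2 + m j.
  case: (leqP i j) => ij; first by rewrite (le_trans (P2mono _ _ ij))// lerDl.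
  by rewrite (le_trans _ (P2anti _ _ (ltnW ij)))// lerDl.
(* The lower corners increase and stay below every upper corner, so the suprema give a point common
   to all rectangles. *)
pose x := sup (range (fun n => (P n).1)); pose y := sup (range (fun n => (P n).2)).
have xP n : (P n).1 <= x <= (P n).1 + l n.
  apply/andP; split.
    by apply: ub_le_sup; [exists ((P 0).1 + l 0) => _ [i _ <-]; exact: P1le|exists n].
  by apply: ge_sup; [exists (P n).1, n|move=> _ [i _ <-]; exact: P1le].
have yP n : (P n).2 <= y <= (P n).2 + m n.
  apply/andP; split.
    by apply: ub_le_sup; [exists ((P 0).2 + m 0) => _ [i _ <-]; exact: P2le|exists n].
  by apply: ge_sup; [exists (P n).2, n|move=> _ [i _ <-]; exact: P2le].
have l0E : l 0 = b - a by rewrite /l expr0 divr1.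
have m0E : m 0 = d - c by rewrite /m expr0 divr1.
have Pab n : a <= (P n).1 /\ (P n).1 + l n <= b.
  by have := P1mono 0 n (leq0n n); have := P1anti 0 n (leq0n n);
    rewrite /= l0E; lra.
have Pcd n : c <= (P n).2 /\ (P n).2 + m n <= d.
  by have := P2mono 0 n (leq0n n); have := P2anti 0 n (leq0n n);
    rewrite /= m0E; lra.
have E0 : E a c (b - a) (d - c) = G b d - G b c - G a d + G a c -
    (H b d - H b c - H a d + H a c).
  by rewrite /E !(addrC a) !(addrC c) !subrK.
have En n : `|E a c (b - a) (d - c)| <= 4 ^+ n * `|E (P n).1 (P n).2 (l n) (m n)|.
  elim: n => [|n ih]; first by rewrite expr0 mul1r l0E m0E.
  apply: le_trans ih _; rewrite exprSr -mulrA ler_wpM2l ?exprn_ge0//.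
  by rewrite -lS -mS; case: (stepP n).
rewrite -E0; apply/eqP; rewrite -normr_le0; apply/ler_addgt0Pr => e e0.
rewrite add0r.
(* The summand 1 keeps [k] positive for a flat rectangle. The tolerance e / k^2 below is chosen so
   that 4^n (e / k^2) (k / 2^n)^2 is exactly e. *)
pose k := (b - a + (d - c)) + 1.
have k0 : 0 < k by rewrite /k; lra.
have [r r0 hr] := @E_small x y (e / k ^+ 2) (divr_gt0 e0 (exprn_gt0 _ k0)).
have [n hn] : exists n : nat, k / r < n%:R.
  exists (Num.truncn (k / r)).+1.
  by apply: truncnS_gt; rewrite num_real.
have lmn : l n + m n <= k / 2 ^+ n.
  by rewrite /l /m -mulrDl ler_wpM2r ?invr_ge0 ?exprn_ge0// /k; lra.
have n2 : n%:R <= 2 ^+ n :> R by rewrite -natrX ler_nat ltnW// ltn_expl.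
have lmr : l n + m n < r.
  apply: le_lt_trans lmn _; rewrite ltr_pdivrMr ?exprn_gt0//.
  rewrite mulrC -ltr_pdivrMr//; exact: lt_le_trans hn n2.
have [P1a P1b] := Pab n; have [P2a P2b] := Pcd n.
have hE := hr _ _ _ _ (l0 n) (m0 n) P1a P1b P2a P2b (xP n) (yP n) lmr.
apply: le_trans (En n) _.
apply: le_trans (ler_wpM2l (exprn_ge0 _ _) hE) _ => //.
have lmn2 : (l n + m n) ^+ 2 <= (k / 2 ^+ n) ^+ 2.
  by rewrite lerXn2r// nnegrE ?addr_ge0// divr_ge0 ?exprn_ge0// ltW.
apply: le_trans (ler_wpM2l (exprn_ge0 _ _) (ler_wpM2l _ lmn2)) _ => //.
  by rewrite divr_ge0 ?exprn_ge0// ltW.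
have -> : 4 ^+ n = (2 ^+ n) ^+ 2 :> R by rewrite -exprM mulnC exprM; congr (_ ^+ n); ring.
have : 2 ^+ n != 0 :> R by rewrite expf_neq0.
have : k != 0 by rewrite gt_eqF.
move: (2 ^+ n) => u kn un.
rewrite le_eqVlt; apply/orP; left; apply/eqP; field; rewrite ?kn ?un//.
Qed.

End goursat.

(** * Measurability and measure-preserving maps of the plane *)

Section plane_measure.
Variable R : realType.
Local Notation mR := (measurableTypeR R).
Local Notation mu := (@lebesgue_measure R).
Local Notation plane := (@plane_measure R).

(** Measurability refers to the product sigma-algebra, so an open set of the plane is written as the
    countable union of the boxes with rational centre and radius 1 / (n + 1) that it contains. *)
Lemma continuous_measurable_fun2 (f : R * R -> R) : continuous f ->
  measurable_fun [set: mR * mR] (f : mR * mR -> mR).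
Proof.
move=> cf; apply: (measurability _ (measurable_realfun.RGenOpens.measurableE R)).
move=> _ [_ [a [b ->] <-]]; rewrite setTI.
have oU : open (f @^-1` `]a, b[%classic).
  by move/continuousP : cf; apply; exact: interval_open.
set U := (X in open X) in oU.
pose box (q : rat * rat * nat) : set (R * R) :=
  ball (ratr q.1.1 : R) (q.2.+1%:R^-1) `*` ball (ratr q.1.2 : R) (q.2.+1%:R^-1).
rewrite [X in measurable X](_ : _ =
    \bigcup_q (if pselect (box q `<=` U) then box q else set0)); last first.
  apply/seteqP; split => [[x y] Uxy|z [q _]]; last by case: pselect => [h /h|].
  have /nbhs_ballP[e /= e0 he] := open_nbhs_nbhs (conj oU Uxy).
  (* Then 2 / (n + 1) < e, so a box of radius 1 / (n + 1) containing (x, y) lies in the ball of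
     radius e around it. *)
  pose n := Num.truncn (2 / e).
  have n0 : 0 < n.+1%:R^-1 :> R by rewrite invr_gt0.
  have hn : 2 / n.+1%:R < e.
    rewrite ltr_pdivrMr ?ltr0n// mulrC -ltr_pdivrMr//.
    by apply: truncnS_gt; rewrite num_real.
  have tri (t q t' : R) : `|q - t| < n.+1%:R^-1 -> `|q - t'| < n.+1%:R^-1 ->
      `|t - t'| < e.
    move: hn; set u : R := n.+1%:R^-1; move: u => u hu.
    by rewrite !ltr_norml; lra.
  have rat_near (t : R) : exists q : rat, `|ratr q - t| < n.+1%:R^-1.
    have [|q] := @rat_in_itvoo R (t - n.+1%:R^-1) (t + n.+1%:R^-1).
      by rewrite ltrD2l; apply: lt_trans n0; rewrite oppr_lt0.
    by rewrite in_itv/= => hq; exists q; rewrite ltr_distl.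
  have [q1 h1] := rat_near x; have [q2 h2] := rat_near y.
  exists ((q1, q2), n) => //; case: pselect => nh; last first.
    exfalso; apply: nh => z.
    case: z => x' y' /= [h1' h2']; apply: he; split=> /=.
      by move: h1'; rewrite -!ball_normE/=; exact: tri.
    by move: h2'; rewrite -!ball_normE/=; exact: tri.
  by split; rewrite /= -ball_normE/=.
apply: countable_bigcupT_measurable => // q.
case: pselect => hq; last exact: measurable0.
apply: measurableX; apply: open_measurable; apply: ball_open; rewrite invr_gt0.
Qed.

Definition plane_preserving (h : R * R -> R * R) : Prop :=
  measurable_fun [set: mR * mR] (h : mR * mR -> mR * mR) /\
  forall A : set (mR * mR), measurable A -> plane (h @^-1` A) = plane A.

Lemma plane_preserving_comp h k : plane_preserving h -> plane_preserving k ->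
  plane_preserving (h \o k).
Proof.
move=> [mh hh] [mk hk]; split; first exact: measurableT_comp.
move=> A mA; rewrite comp_preimage hk ?hh//.
by rewrite -[X in measurable X]setTI; exact: mh.
Qed.

(** The image measure agrees with the product measure on rectangles, which determine it. *)
Lemma plane_preserving_swap : plane_preserving (fun z => (z.2, z.1)).
Proof.
have ms : measurable_fun [set: mR * mR] (fun z : mR * mR => (z.2, z.1) : mR * mR).
  exact: measurable_fun_pair.
split => // A mA.
have := @product_measure_unique _ _ mR mR R mu mu
  (pushforward plane (fun z : mR * mR => (z.2, z.1) : mR * mR)).
move=> /(_ ms) H; rewrite [RHS]H// => B C mB mC.
transitivity (plane (C `*` B)).
  by congr (plane _); apply/seteqP; split => -[x y] /= [].
by rewrite muleC; exact: product_measure1E.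
Qed.

(** The plane measure is by definition the integral of the measures of vertical sections, and these
    are preserved one by one. *)
Lemma plane_preserving_vertical (psi : R -> R -> R) :
  measurable_fun [set: mR * mR] (fun z : mR * mR => psi z.1 z.2 : mR) ->
  (forall x (A : set mR), measurable A -> mu (psi x @^-1` A) = mu A) ->
  plane_preserving (fun z => (z.1, psi z.1 z.2)).
Proof.
move=> mpsi hpsi; split; first exact: measurable_fun_pair.
move=> A mA; rewrite /plane_measure /product_measure1.
apply: eq_integral => x _ /=.
rewrite -(hpsi x (xsection A x)); last exact: measurable_xsection.
by congr (mu _); apply/seteqP; split => y; rewrite /xsection/= !inE.
Qed.

Lemma lebesgue_measure_shift (a : R) (A : set mR) : measurable A ->
  mu ((fun x => x + a) @^-1` A) = mu A.
Proof.
move=> mA.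
have ms : measurable_fun [set: mR] ((fun x => x + a) : mR -> mR).
  exact: measurable_funD.
have := @lebesgue_measure_unique R (pushforward mu ((fun x => x + a) : mR -> mR)).
move=> /(_ ms) H; rewrite [RHS]H// => _ [[b c]] _ <-.
transitivity (mu `]b - a, c - a]%classic); last first.
  by congr (mu _); apply/seteqP; split => x /=; rewrite !in_itv/= ltrBlDr lerBrDr.
rewrite !lebesgue_measure_itv/= !lte_fin ltrD2r.
by case: ifPn => // _; rewrite -!EFinB; congr EFin; ring.
Qed.

Lemma plane_preserving_horizontal (psi : R -> R -> R) :
  measurable_fun [set: mR * mR] (fun z : mR * mR => psi z.1 z.2 : mR) ->
  (forall x (A : set mR), measurable A -> mu (psi x @^-1` A) = mu A) ->
  plane_preserving (fun z => (psi z.2 z.1, z.2)).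
Proof.
move=> mpsi hpsi.
rewrite [X in plane_preserving X](_ : _ = (fun z => (z.2, z.1)) \o
  ((fun z => (z.1, psi z.1 z.2)) \o (fun z => (z.2, z.1))))//.
apply: plane_preserving_comp; first exact: plane_preserving_swap.
apply: plane_preserving_comp; last exact: plane_preserving_swap.
exact: plane_preserving_vertical.
Qed.

Lemma plane_preserving_vshear (t : R) :
  plane_preserving (fun z => (z.1, z.2 + t * z.1)).
Proof.
apply: (@plane_preserving_vertical (fun x y => y + t * x)).
  apply: measurable_funD => //; exact: measurable_funM.
by move=> x A; exact: lebesgue_measure_shift.
Qed.

Lemma plane_preserving_hshear (t : R) :
  plane_preserving (fun z => (z.1 + t * z.2, z.2)).
Proof.
apply: (@plane_preserving_horizontal (fun x y => y + t * x)).
  apply: measurable_funD => //; exact: measurable_funM.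
by move=> x A; exact: lebesgue_measure_shift.
Qed.

Lemma plane_preserving_reflection : plane_preserving (fun z => (z.1, - z.2)).
Proof.
apply: (@plane_preserving_vertical (fun x y => - y)).
  exact: measurableT_comp.
by move=> x A mA; rewrite -[RHS]lebesgue_measureN.
Qed.

Lemma plane_preserving_shift (a : R * R) : plane_preserving (fun z => z + a).
Proof.
rewrite [X in plane_preserving X](_ : _ = (fun z => (z.1 + a.1, z.2)) \o
  (fun z => (z.1, z.2 + a.2))); last by apply/funext => -[x y].
apply: plane_preserving_comp.
  apply: (@plane_preserving_horizontal (fun x y => y + a.1)).
    exact: measurable_funD.
  by move=> x A; exact: lebesgue_measure_shift.
apply: (@plane_preserving_vertical (fun x y => y + a.2)).
  exact: measurable_funD.
by move=> x A; exact: lebesgue_measure_shift.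
Qed.

Definition rotation (c s : R) (z : R * R) : R * R :=
  (c * z.1 - s * z.2, s * z.1 + c * z.2).

(** For s nonzero, a rotation is a vertical shear by s between two horizontal shears by (c - 1) / s,
    which reduces invariance to translations of the line. For s = 0, c is 1 or -1, and the half turn
    is composed of swaps and reflections. *)
Lemma plane_preserving_rotation (c s : R) : c ^+ 2 + s ^+ 2 = 1 ->
  plane_preserving (rotation c s).
Proof.
move=> cs; have [s0|s0] := eqVneq s 0.
- have : (c - 1) * (c + 1) = 0 by rewrite s0 in cs; nra.
  move=> /eqP; rewrite mulf_eq0 => /orP[/eqP c1|/eqP c1].
    have -> : rotation c s = (fun z => z + 0).
      have c1' : c = 1 by lra.
      apply/funext => -[x y].
      by rewrite /rotation s0 c1' addr0/= !mul1r !mul0r subr0 add0r.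
    exact: plane_preserving_shift.
  rewrite [X in plane_preserving X](_ : _ = (fun z => (z.2, z.1)) \o
    ((fun z => (z.1, - z.2)) \o ((fun z => (z.2, z.1)) \o
       (fun z => (z.1, - z.2))))); last first.
    have c1' : c = -1 by lra.
    by apply/funext => -[x y]; rewrite /rotation s0 c1'/= !mulN1r !mul0r subr0 add0r.
  apply: plane_preserving_comp; first exact: plane_preserving_swap.
  apply: plane_preserving_comp; first exact: plane_preserving_reflection.
  apply: plane_preserving_comp; first exact: plane_preserving_swap.
  exact: plane_preserving_reflection.
- rewrite [X in plane_preserving X](_ : _ =
    (fun z => (z.1 + ((c - 1) / s) * z.2, z.2)) \o
    ((fun z => (z.1, z.2 + s * z.1)) \o
    (fun z => (z.1 + ((c - 1) / s) * z.2, z.2)))); last first.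
    apply/funext => -[x y]; rewrite /rotation/=.
    have e0 : (c - 1) / s * s = c - 1 by rewrite divfK.
    have e : s * ((c - 1) / s) = c - 1 by field.
    have e2 : (c - 1) / s * (c + 1) = - s.
      have -> : (c - 1) / s * (c + 1) = (c ^+ 2 - 1) / s by field.
      have -> : c ^+ 2 - 1 = - s * s by lra.
      by field.
    move: e e2 e0; set t := (c - 1) / s => e e2 e0.
    congr pair; last by rewrite mulrDr mulrA e; ring.
    have -> : x + t * y + t * (y + s * (x + t * y)) =
        x + (t * s) * x + t * (2 + (t * s)) * y by ring.
    by rewrite e0 (_ : 2 + (c - 1) = c + 1) ?e2; ring.
  apply: plane_preserving_comp; first exact: plane_preserving_hshear.
  apply: plane_preserving_comp; first exact: plane_preserving_vshear.
  exact: plane_preserving_hshear.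
Qed.

End plane_measure.

(** * Integrals under measure-preserving maps, and averaging *)

Section measure_preserving.
Context d (T : measurableType d) (R : realType).
Variables (mu : {measure set T -> \bar R}) (h : T -> T).
Hypothesis mh : measurable_fun [set: T] h.
Hypothesis hh : forall A, measurable A -> mu (h @^-1` A) = mu A.
Local Open Scope ereal_scope.

Lemma ge0_integral_preserving (f : T -> \bar R) : measurable_fun setT f ->
  (forall z, 0 <= f z) -> \int[mu]_z f (h z) = \int[mu]_z f z.
Proof.
move=> mf f0.
transitivity (\int[pushforward mu h]_z f z).
  by rewrite ge0_integral_pushforward.
by apply: eq_measure_integral => A mA _; exact: hh.
Qed.

Lemma integrable_preserving (f : T -> \bar R) :
  mu.-integrable setT f -> mu.-integrable setT (f \o h).
Proof.
move=> /integrableP[mf fi]; apply/integrableP; split.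
  exact: measurableT_comp.
have := ge0_integral_preserving (f := abse \o f).
by move=> /= ->//; exact: measurableT_comp.
Qed.

Lemma integral_preserving (f : T -> \bar R) :
  mu.-integrable setT f -> \int[mu]_z f (h z) = \int[mu]_z f z.
Proof.
move=> /integrableP[mf _]; rewrite [LHS]integralE [RHS]integralE.
congr (_ - _); [rewrite -[RHS](ge0_integral_preserving (f := f^\+))//|
  rewrite -[RHS](ge0_integral_preserving (f := f^\-))//].
- by apply: eq_integral => x _; rewrite !funeposE.
- exact: measurable_funepos.
- by apply: eq_integral => x _; rewrite !funenegE.
- exact: measurable_funeneg.
Qed.

End measure_preserving.

Section averaging.
Context d d' (T : measurableType d) (S : measurableType d') (R : realType).
Variables (m1 : {sigma_finite_measure set T -> \bar R}).
Variables (m2 : {sigma_finite_measure set S -> \bar R}).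
Variables (rho : T * S -> T) (D : set S) (c : R) (k g : T -> R) (k0 : R).
Hypotheses (mrho : measurable_fun setT rho) (mD : measurable D).
Hypotheses (c0 : (0 < c)%R) (m2D : m2 D = c%:E).
Hypothesis rhoP : forall s A, measurable A ->
  m1 ((fun z => rho (z, s)) @^-1` A) = m1 A.
Hypotheses (mk : measurable_fun setT k) (mg : measurable_fun setT g).
Hypothesis grho : forall z s, g (rho (z, s)) = g z.
Hypothesis ki : forall z, m2.-integrable D (fun s => (k (rho (z, s)))%:E).
Hypothesis kmean : forall z,
  (\int[m2]_(s in D) (k (rho (z, s)))%:E = (c * k0)%:E)%E.
Hypothesis gi : m1.-integrable setT (fun z => (g z)%:E).
Hypothesis kgi : m1.-integrable setT (fun z => (k z * g z)%:E).
Local Open Scope ereal_scope.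

(* Averaging over the maps [rho (_, s)] changes neither the measure nor the
   weight [g], and turns [k] into the constant [k0]. *)
Lemma integral_averaging :
  \int[m1]_z (k z * g z)%:E = k0%:E * \int[m1]_z (g z)%:E.
Proof.
(* Fubini for [F]: integrating first over [D] gives [c * k0] times the integral of [g], by [kmean];
   integrating first over [T] gives [c] times the left-hand side, because each [rho (_, t)]
   preserves [m1] and [g]. *)
pose F (w : T * S) : \bar R := (k (rho w) * g w.1 * \1_D w.2)%:E.
have mrho1 s : measurable_fun setT (fun z => rho (z, s)).
  exact: measurable_fun_pair1.
have mF : measurable_fun setT F.
  apply/measurable_EFinP; apply: measurable_funM.
    by apply: measurable_funM; exact: measurableT_comp.
  exact: measurableT_comp.
have inner t : (fun z => F (z, t)) =
    (fun z => (\1_D t)%:E * ((fun w => (k w * g w)%:E) \o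
       (fun z => rho (z, t))) z).
  by apply/funext => z; rewrite /F/= -EFinM grho; congr EFin; rewrite mulrC.
have rho_int t := integrable_preserving (mrho1 t) (rhoP t) kgi.
have C_fin : \int[m1]_z `|(k z * g z)%:E| < +oo by case/integrableP : kgi.
have mkg : measurable_fun setT (fun z => (k z * g z)%:E).
  by case/integrableP : kgi.
have int1D : \int[m2]_s (\1_D s)%:E = c%:E.
  by rewrite integral_indic// setIT; exact: m2D.
have Fi : (m1 \x m2).-integrable setT F.
  apply/(integrable21ltyP _ _ mF).
  have -> : (\int[m2]_y \int[m1]_x `|F (x, y)| =
      \int[m2]_y ((\1_D y)%:E * \int[m1]_z `|(k z * g z)%:E|)).
    apply: eq_integral => t _.
    rewrite -(ge0_integral_preserving (mrho1 t) (rhoP t)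
      (f := fun z => `|(k z * g z)%:E|))//; last exact: measurableT_comp.
    rewrite -ge0_integralZl//; last first.
      apply: (measurableT_comp (f := abse)) => //.
      exact: (measurableT_comp mkg).
    apply: eq_integral => z _.
    have -> : F (z, t) = ((\1_D t)%:E * ((fun w => (k w * g w)%:E) \o
       (fun z => rho (z, t))) z) by exact: (f_equal (fun u => u z) (inner t)).
    by rewrite abseM gee0_abs// lee_fin.
  rewrite ge0_integralZr//.
  - by rewrite int1D lte_mul_pinfty// lee_fin ltW.
  - exact/measurable_EFinP.
  - exact: integral_ge0.
have e1 : \int[m1]_z \int[m2]_t F (z, t) =
    (c * k0)%:E * \int[m1]_z (g z)%:E.
  rewrite -integralZl//; apply: eq_integral => z _.
  rewrite -(kmean z) muleC -integralZl//.
  rewrite [RHS]integral_mkcond; apply: eq_integral => t _.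
  rewrite patchE /F/= indicE; case: ifPn => tD; last by rewrite mulr0.
  by rewrite mulr1 mulrC EFinM.
have [r hr] : exists r, \int[m1]_z (k z * g z)%:E = r%:E.
  by exists (fine (\int[m1]_z (k z * g z)%:E)); rewrite fineK//;
    exact: integrable_fin_num.
have [u hu] : exists r, \int[m1]_z (g z)%:E = r%:E.
  by exists (fine (\int[m1]_z (g z)%:E)); rewrite fineK//;
    exact: integrable_fin_num.
have e2 : \int[m2]_t \int[m1]_z F (z, t) = c%:E * r%:E.
  have -> : \int[m2]_t \int[m1]_z F (z, t) = \int[m2]_t ((\1_D t)%:E * r%:E).
    apply: eq_integral => t _; rewrite inner integralZl//.
    by rewrite (integral_preserving (mrho1 t) (rhoP t) kgi) hr.
  under eq_integral do rewrite muleC.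
  rewrite integralZl//; last first.
    apply/integrableP; split; first exact/measurable_EFinP.
    by under eq_integral do rewrite gee0_abs ?lee_fin//; rewrite int1D ltry.
  by rewrite int1D muleC.
have := Fubini Fi; rewrite e1 e2 hr hu -!EFinM => -[e]; congr EFin.
by apply: (mulfI (lt0r_neq0 c0)); rewrite -e mulrA.
Qed.

End averaging.

(** * Differentials of quaternion-valued maps; holomorphy on a slice *)

Section differential_calculus.
Variables (R : realType).
Implicit Types (V W : normedModType R).

Lemma linear_le_continuous V W (f : {linear V -> W}) (M : R) :
  (forall v, `|f v| <= M * `|v|) -> continuous f.
Proof.
move=> hM; apply: bounded_linear_continuous; apply/linear_boundedP.
exists M; split; first exact: num_real.
by move=> r Mr x; rewrite (le_trans (hM x))// ler_wpM2r// ltW.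
Qed.

Lemma qnormM_le (p q : quat R) : `|p * q| <= 4 * `|p| * `|q|.
Proof.
apply: le_trans (ler_norm_qmod _) _; rewrite qmodM.
have -> : 4 * `|p| * `|q| = (2 * `|p|) * (2 * `|q|) by ring.
by rewrite ler_pM ?qmod_ge0// ler_qmod_norm.
Qed.

Global Instance is_diff_qmul V (f g df dg : V -> quat R) x :
  is_diff x f df -> is_diff x g dg ->
  is_diff x (fun z => f z * g z) (fun v => f x * dg v + df v * g x).
Proof.
move=> dfx dgx.
pose P := f x; pose Q := g x.
pose D (v : quat R * quat R) : quat R := P * v.2 + v.1 * Q.
have linD : linear D.
  move=> a u v; rewrite /D/= mulrDr mulrDl -scalerAl -scalerAr scalerDr.
  by rewrite addrACA.
pose DL : {linear _ -> _} := HB.pack D (GRing.isLinear.Build _ _ _ _ D linD).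
have DLE v : DL v = D v by [].
have contD : continuous DL.
  apply: (@linear_le_continuous _ _ _ (4 * `|P| + 4 * `|Q|)) => v.
  rewrite DLE /D mulrDl; apply: le_trans (ler_normD _ _) _.
  apply: lerD; apply: le_trans (qnormM_le _ _) _.
    by rewrite ler_wpM2l ?mulr_ge0// [leRHS]/Num.norm/= le_max lexx orbT.
  rewrite mulrAC ler_wpM2l ?mulr_ge0//.
  by rewrite [leRHS]/Num.norm/= le_max lexx.
have dM : is_diff ((P, Q) : quat R * quat R)
    (fun z : quat R * quat R => z.1 * z.2) DL.
  (* The remainder of the product at (P, Q) is exactly [h.1 * h.2], of norm at most 4 |h|^2; hence
     the radius e / 4. *)
  apply: (eps_is_diff contD) => e e0; exists (e / 4); first by rewrite divr_gt0.
  move=> h hlt.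
  have -> : ((P, Q) + h).1 * ((P, Q) + h).2 - P * Q - DL h = h.1 * h.2.
    rewrite DLE /D/= mulrDl !mulrDr -[LHS]addrA -opprD !addrA.
    by rewrite [X in X - _]addrC addrK.
  apply: le_trans (qnormM_le _ _) _.
  have h1 : `|h.1| <= `|h| by rewrite [leRHS]/Num.norm/= le_max lexx.
  have h2 : `|h.2| <= `|h| by rewrite [leRHS]/Num.norm/= le_max lexx orbT.
  rewrite (ler_pM _ _ _ h2) ?mulr_ge0//.
  by rewrite mulrC -ler_pdivlMr// ltW// (le_lt_trans h1).
exact: is_diff_comp (is_diff_pair dfx dgx) dM.
Qed.

Lemma is_derive_is_diff W (f : R -> W) (x : R) (l : W) :
  is_derive x (1 : R) f l -> is_diff x f (fun h => h *: l).
Proof.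
move=> [fx fl]; have dfx : differentiable f x by apply/derivable1_diffP.
apply: DiffDef => //; rewrite deriv1E//.
by rewrite derive1E fl.
Qed.

Lemma is_diff_comp_derive V W (f : R -> W) (u du : V -> R) (x : V) (l : W) :
  is_derive (u x) (1 : R) f l -> is_diff x u du ->
  is_diff x (f \o u) (fun h => du h *: l).
Proof.
by move=> /is_derive_is_diff fl ux; exact: is_diff_comp ux fl.
Qed.

Lemma is_diff_linear V W (f : {linear V -> W}) x : continuous f -> is_diff x f f.
Proof.
move=> cf; apply: DiffDef; first exact: linear_differentiable.
exact: diff_lin.
Qed.

Global Instance is_diff_fst V W (x : V * W) : is_diff x fst fst.
Proof.
pose f : {linear (V * W)%type -> V} := HB.pack fst
  (GRing.isLinear.Build _ _ _ _ (fst : (V * W)%type -> V) (fun _ _ _ => erefl)).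
apply: (is_diff_linear (f := f)).
apply: (@linear_le_continuous _ _ _ 1) => v.
by rewrite mul1r [leRHS]/Num.norm/= le_max lexx.
Qed.

Global Instance is_diff_snd V W (x : V * W) : is_diff x snd snd.
Proof.
pose f : {linear (V * W)%type -> W} := HB.pack snd
  (GRing.isLinear.Build _ _ _ _ (snd : (V * W)%type -> W) (fun _ _ _ => erefl)).
apply: (is_diff_linear (f := f)).
apply: (@linear_le_continuous _ _ _ 1) => v.
by rewrite mul1r [leRHS]/Num.norm/= le_max lexx orbT.
Qed.

Lemma is_diff_coord V (f df : V -> quat R) (j : 'I_4) x :
  is_diff x f df -> is_diff x (fun z => f z 0 j) (fun v => df v 0 j).
Proof.
move=> dfx.
have linc : linear (fun q : quat R => q 0 j : R) by move=> a u v; rewrite !mxE.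
pose cj : {linear quat R -> R} := HB.pack (fun q : quat R => q 0 j : R)
  (GRing.isLinear.Build _ _ _ _ (fun q : quat R => q 0 j : R) linc).
have cc : continuous cj.
  apply: (@linear_le_continuous _ _ _ 1) => v; rewrite mul1r.
  exact: ler_coord_norm.
exact: is_diff_comp dfx (is_diff_linear (f x) cc).
Qed.

Lemma is_diff_scale_cst V W (w : W) (u du : V -> R) x : is_diff x u du ->
  is_diff x (fun z => u z *: w) (fun h => du h *: w).
Proof.
move=> hu.
have lins : linear (fun t : R => t *: w) by move=> a b c; rewrite scalerDl scalerA.
pose sw : {linear R -> W} := HB.pack (fun t : R => t *: w)
  (GRing.isLinear.Build _ _ _ _ (fun t : R => t *: w) lins).
have cs : continuous sw.
  by apply: (@linear_le_continuous _ _ _ `|w|) => t; rewrite normrZ mulrC.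
exact: is_diff_comp hu (is_diff_linear (u x) cs).
Qed.

Lemma is_diff_slice (I : quat R) V (u v du dv : V -> R) x :
  is_diff x u du -> is_diff x v dv ->
  is_diff x (fun z => slice I (u z, v z)) (fun h => slice I (du h, dv h)).
Proof.
move=> hu hv.
have l1 := is_diff_scale_cst (1 : quat R) hu.
have l2 := is_diff_scale_cst I hv.
exact: is_diffD l1 l2.
Qed.

Lemma is_diff_derive V W (f df : V -> W) x v : is_diff x f df -> 'D_v f x = df v.
Proof. by move=> dfx; rewrite deriveE ?diff_val//. Qed.

Lemma diff_plane W (f : R * R -> W) z v : differentiable f z ->
  'd f z v = v.1 *: 'D_(1, 0) f z + v.2 *: 'D_(0, 1) f z.
Proof.
move=> dfz; rewrite !deriveE// -!linearZ -linearD; congr ('d f z _).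
by case: v => a b; congr pair; rewrite /= !scaler0 ?addr0 ?add0r [RHS]mulr1.
Qed.

End differential_calculus.

Section slice_holomorphic.
Variables (R : realType).
Implicit Types (I : quat R) (F : R * R -> quat R).

(** Holomorphy for the complex structure that left multiplication by I puts on H. *)
Definition holo I F := forall z,
  differentiable F z /\ 'D_(0, 1) F z = I * 'D_(1, 0) F z.

(** The Cauchy-Riemann equation makes the differential linear over C_I, so that ['D_(1, 0) F z] acts
    as the complex derivative. *)
Lemma holo_is_diff I F : holo I F -> forall z,
  is_diff z F (fun v => slice I v * 'D_(1, 0) F z).
Proof.
move=> hF z; have [dF CR] := hF z; apply: DiffDef => //.
apply/funext => v; rewrite diff_plane// CR /slice mulrDl -!scalerAl mul1r.
by [].
Qed.

Lemma is_diff_holo I F : imag_units I ->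
  (forall z, exists D, is_diff z F (fun v => slice I v * D)) -> holo I F.
Proof.
move=> hI hF z; have [D FD] := hF z; split=> //.
by rewrite !(is_diff_derive _ FD) slice01 slice10 mul1r.
Qed.

End slice_holomorphic.

Section complex_plane.
Variable R : realType.
Implicit Types (z w v : R * R) (I : quat R).

(* The multiplication and the exponential of C = R^2. *)
Definition cmul z w : R * R := (z.1 * w.1 - z.2 * w.2, z.1 * w.2 + z.2 * w.1).
Definition cexp z : R * R := (expR z.1 * cos z.2, expR z.1 * sin z.2).

Lemma slice_cmul I z w : imag_units I ->
  slice I (cmul z w) = slice I z * slice I w.
Proof. by move=> hI; rewrite sliceM. Qed.

Lemma cexpD z w : cexp (z + w) = cmul (cexp z) (cexp w).
Proof. by rewrite /cexp/cmul/= expRD cosD sinD; congr pair; ring. Qed.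

Lemma cmulA : associative (@cmul).
Proof. by move=> z w v; rewrite /cmul/=; congr pair; ring. Qed.

Lemma is_diff_cexp z : is_diff z cexp (cmul^~ (cexp z)).
Proof.
have e1 : is_diff z (fun u : R * R => expR u.1) (fun h => h.1 *: expR z.1).
  exact: (is_diff_comp_derive (is_derive_expR z.1) (is_diff_fst z)).
have c1 : is_diff z (fun u : R * R => cos u.2) (fun h => h.2 *: - sin z.2).
  exact: (is_diff_comp_derive (is_derive_cos z.2) (is_diff_snd z)).
have s1 : is_diff z (fun u : R * R => sin u.2) (fun h => h.2 *: cos z.2).
  exact: (is_diff_comp_derive (is_derive_sin z.2) (is_diff_snd z)).
apply: is_diff_eq (is_diff_pair (is_diffM e1 c1) (is_diffM e1 s1)) _.
apply/funext => h; rewrite /cmul/cexp !fctE/= /GRing.scale/=.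
by congr pair; ring.
Qed.

Lemma is_diff_cmul_cst c z : is_diff z (cmul^~ c) (cmul^~ c).
Proof.
have lin : linear (cmul^~ c).
  by move=> a u v; rewrite /cmul; congr pair; rewrite /= /GRing.scale/=; ring.
pose f : {linear (R * R)%type -> (R * R)%type} := HB.pack (cmul^~ c)
  (GRing.isLinear.Build _ _ _ _ (cmul^~ c) lin).
apply: (is_diff_linear (f := f)).
apply: (@linear_le_continuous _ _ _ _ (`|c.1| + `|c.2|)) => v.
have h1 : `|v.1| <= `|v| by rewrite [leRHS]/Num.norm/= le_max lexx.
have h2 : `|v.2| <= `|v| by rewrite [leRHS]/Num.norm/= le_max lexx orbT.
rewrite [leLHS]/Num.norm/= ge_max; apply/andP; split.
  apply: le_trans (ler_normB _ _) _; rewrite !normrM mulrDl.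
  by rewrite lerD// mulrC ler_wpM2l.
apply: le_trans (ler_normD _ _) _; rewrite !normrM mulrDl addrC.
by rewrite lerD// mulrC ler_wpM2l.
Qed.

(** The hypothesis on [g] says that it is entire with complex derivative [g']; this is the chain
    rule. *)
Lemma holo_comp I F (g g' : R * R -> R * R) : imag_units I -> holo I F ->
  (forall z, is_diff z g (cmul^~ (g' z))) -> holo I (F \o g).
Proof.
move=> hI hF hg; apply: is_diff_holo => // z.
exists (slice I (g' z) * 'D_(1, 0) F (g z)).
apply: is_diff_eq (is_diff_comp (hg z) (holo_is_diff hF (g z))) _.
by apply/funext => v /=; rewrite slice_cmul// mulrA.
Qed.

End complex_plane.

(** * Mean values over circles and against a Gaussian *)

Section antiderivative.
Variable R : realType.
Local Notation mu := (@lebesgue_measure R).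

Lemma is_derive_antiderivative (f : R -> R) (a x : R) : continuous f -> a < x ->
  is_derive x (1 : R) (fun u => \int[mu]_(t in `[a, u]) f t) (f x).
Proof.
move=> cf ax.
have xu : x < x + 1 by rewrite ltrDl.
have fi : mu.-integrable `[a, x + 1] (EFin \o f).
  apply: continuous_compact_integrable; first exact: segment_compact.
  exact: continuous_subspaceT.
have [dF F'] := continuous_FTC1_closed xu fi ax (cf x).
split; first exact: dF.
by rewrite -derive1E; exact: F'.
Qed.

Lemma integral_FTC (f F : R -> R) (a b : R) : a < b -> continuous f ->
  (forall x, a <= x <= b -> is_derive x (1 : R) F (f x)) ->
  (\int[mu]_(t in `[a, b]) (f t)%:E = (F b - F a)%:E)%E.
Proof.
move=> ab cf hF; rewrite EFinB; apply: continuous_FTC2 => //.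
- exact: continuous_subspaceT.
- have cF x : a <= x <= b -> {for x, continuous F}.
    move=> /hF[dF _]; apply: differentiable_continuous.
    exact/derivable1_diffP.
  split.
  + by move=> x; rewrite in_itv/= => /andP[/ltW ax /ltW xb]; have [] := hF x; rewrite ?ax.
  + by apply: cvg_at_right_filter; apply: cF; rewrite lexx ltW.
  + by apply: cvg_at_left_filter; apply: cF; rewrite lexx ltW.
- move=> x; rewrite in_itv/= => /andP[/ltW ax /ltW xb].
  by have [_ e] := hF x (introT andP (conj ax xb)); rewrite derive1E.
Qed.

End antiderivative.

Section circle_mean.
Variables (R : realType) (I : quat R) (h : R * R -> quat R).
Hypotheses (hI : imag_units I) (holoh : holo I h).
Local Notation mu := (@lebesgue_measure R).

Lemma holo_continuous : continuous h.
Proof. by move=> z; apply: differentiable_continuous; have [] := holoh z. Qed.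

Let cmul_le (z w : R * R) : `|cmul z w| <= 2 * `|z| * `|w|.
Proof.
have h1 : `|z.1| <= `|z| by rewrite [leRHS]/Num.norm/= le_max lexx.
have h2 : `|z.2| <= `|z| by rewrite [leRHS]/Num.norm/= le_max lexx orbT.
have h3 : `|w.1| <= `|w| by rewrite [leRHS]/Num.norm/= le_max lexx.
have h4 : `|w.2| <= `|w| by rewrite [leRHS]/Num.norm/= le_max lexx orbT.
have -> : 2 * `|z| * `|w| = `|z| * `|w| + `|z| * `|w| by ring.
rewrite [leLHS]/Num.norm/= ge_max; apply/andP; split.
  by apply: le_trans (ler_normB _ _) _; rewrite !normrM lerD// ler_pM.
by apply: le_trans (ler_normD _ _) _; rewrite !normrM lerD// ler_pM.
Qed.

Let cexp_le (z : R * R) : `|cexp z| <= expR z.1.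
Proof.
rewrite [leLHS]/Num.norm/= ge_max; apply/andP; split.
  apply: le_trans (_ : expR z.1 * `|cos z.2| <= _).
    by rewrite -[X in X * _](gtr0_norm (expR_gt0 z.1)) -normrM.
  by rewrite ler_piMr ?expR_ge0// cos_max.
apply: le_trans (_ : expR z.1 * `|sin z.2| <= _).
  by rewrite -[X in X * _](gtr0_norm (expR_gt0 z.1)) -normrM.
by rewrite ler_piMr ?expR_ge0// sin_max.
Qed.

(* In the logarithmic coordinates [z = w exp (s + i t)] circles become vertical
   segments and, by periodicity, Goursat's theorem shows that the mean over them
   does not depend on [s]; let [s] tend to [-oo]. *)
Lemma circle_mean (w : R * R) (j : 'I_4) :
  (\int[mu]_(t in `[0%R, (2 * pi)%R]) (h (rotation (cos t) (sin t) w) 0 j)%:E =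
   (2 * pi * h 0 0 j)%:E)%E.
Proof.
pose phi z := h (cmul (cexp z) w).
have hphi : holo I phi.
  apply: (@holo_comp _ _ _ (fun z => cmul (cexp z) w)
    (fun z => cmul (cexp z) w)) => // z.
  apply: is_diff_eq (is_diff_comp (is_diff_cexp z) (is_diff_cmul_cst w _)) _.
  by apply/funext => v /=; rewrite cmulA.
(* Because - I I = 1, the factor - I turns the Cauchy-Riemann equation of [phi] into the relation
   [AB] that Goursat's theorem assumes. *)
pose A z : R := phi z 0 j; pose B z : R := (- I * phi z) 0 j.
have A_diff z : is_diff z A (fun v => (slice I v * 'D_(1, 0) phi z) 0 j).
  exact: is_diff_coord (holo_is_diff hphi z).
have B_diff z : is_diff z B (fun v => (- I * (slice I v * 'D_(1, 0) phi z)) 0 j).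
  apply: is_diff_coord.
  apply: is_diff_eq (is_diff_qmul (is_diff_cst (- I) z) (holo_is_diff hphi z)) _.
  by apply/funext => v /=; rewrite mul0r addr0.
have dA z : differentiable A z by [].
have dB z : differentiable B z by [].
have AB z : 'D_(1, 0) A z = 'D_(0, 1) B z.
  rewrite (is_diff_derive _ (A_diff z)) (is_diff_derive _ (B_diff z)).
  by rewrite slice10 slice01 mul1r mulrA mulNr imag_unitM// opprK mul1r.
have cA s : continuous (fun t => A (s, t)).
  move=> t; apply: (@continuous_comp _ _ _ (fun t => (s, t)) A).
    apply: differentiable_continuous.
    by apply: ex_diff; exact: is_diff_pair (is_diff_cst s t) (is_diff_id t).
  exact: differentiable_continuous.
have cB t : continuous (fun s => B (s, t)).
  move=> s; apply: (@continuous_comp _ _ _ (fun s => (s, t)) B).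
    apply: differentiable_continuous.
    by apply: ex_diff; exact: is_diff_pair (is_diff_id s) (is_diff_cst t s).
  exact: differentiable_continuous.
have pi20 : 0 < 2 * pi :> R by rewrite mulr_gt0// pi_gt0.
(* The integrals start at -1, and at [s - 1] for [H] below, because [is_derive_antiderivative] wants
   points strictly to the right of the base point. *)
pose G s u := \int[mu]_(t in `[-1, u]) A (s, t).
have GA s t : 0 <= t <= 2 * pi -> is_derive t (1 : R) (G s) (A (s, t)).
  move=> /andP[t0 _]; apply: is_derive_antiderivative => //.
  by apply: lt_le_trans t0.
have meanG s : s < 0 -> G 0 (2 * pi) - G 0 0 = G s (2 * pi) - G s 0.
  move=> s0.
  pose H r u := \int[mu]_(x in `[s - 1, r]) B (x, u).
  have HB' r t : s <= r <= 0 -> is_derive r (1 : R) (H ^~ t) (B (r, t)).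
    move=> /andP[sr _].
    apply: (@is_derive_antiderivative _ (fun x => B (x, t))) => //.
    by apply: lt_le_trans sr; rewrite ltrBlDr ltrDl.
  have := goursat_rectangle dA dB AB GA HB' (ltW s0) (ltW pi20).
  (* By periodicity the two horizontal sides carry the same integral, so the [H] terms cancel. *)
  have H2pi r : H r (2 * pi) = H r 0.
    apply: eq_Rintegral => x _; rewrite /B /phi /cexp/=.
    by rewrite mulr_natl cos2pi sin2pi cos0 sin0.
  rewrite !H2pi; move: (H 0 0) (H s 0) (G 0 _) (G 0 0) (G s _) (G s 0).
  by move=> k l a b c d; lra.
have e : G 0 (2 * pi) - G 0 0 = 2 * pi * h 0 0 j.
  apply/eqP; rewrite -subr_eq0 -normr_le0; apply/ler_addgt0Pr => e e0.
  rewrite add0r.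
  have e'0 : 0 < e / (2 * pi) by rewrite divr_gt0.
  have [d /= d0 hd] : exists2 d : R, 0 < d & forall z, `|z| < d ->
      `|h z 0 j - h 0 0 j| < e / (2 * pi).
    have := @holo_continuous 0 => /cvgr_dist_lt /(_ _ e'0) /nbhs_ballP[d d0 hd].
    exists d => // z zd; have := hd z; rewrite -ball_normE/= sub0r normrN.
    move=> /(_ zd); apply: le_lt_trans; rewrite distrC.
    have -> : h 0 0 j - h z 0 j = (h 0 - h z) 0 j by rewrite !mxE.
    exact: ler_coord_norm.
  (* Chosen so that 2 r |w| = d - r < d, the summand 1 allowing w = 0. With s at most ln r, exp(s +
     i t) w then stays within distance d of 0. *)
  pose r := d / (2 * `|w| + 1).
  have w0 : 0 < 2 * `|w| + 1 by rewrite ltr_wpDl// mulr_ge0.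
  have r0 : 0 < r by rewrite divr_gt0.
  pose s := Num.min (ln r) (-1).
  have s0 : s < 0 by rewrite gt_min orbC ltrN10.
  have sr : expR s <= r.
    by rewrite -[leRHS](@lnK R)// ler_expR ge_min lexx.
  have [xi hxi Gxi] := MVT_closed (ltW pi20) (@GA s).
  rewrite (meanG s s0) Gxi subr0 mulrC -mulrBr normrM (gtr0_norm pi20) mulrC.
  rewrite -ler_pdivlMr// ltW// hd//.
  apply: le_lt_trans (cmul_le _ _) _.
  apply: (@le_lt_trans _ _ (2 * r * `|w|)).
    by rewrite ler_wpM2r// ler_wpM2l// (le_trans (cexp_le _)).
  have hr : r * (2 * `|w| + 1) = d by rewrite divfK// gt_eqF.
  have -> : 2 * r * `|w| = d - r by rewrite -[X in _ = X - _]hr; ring.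
  by rewrite ltrBlDr ltrDl.
rewrite -e.
rewrite -(integral_FTC pi20 (cA 0) (GA 0)).
apply: eq_integral => t _.
rewrite /A /phi /cexp/= expR0 !mul1r /rotation /cmul/=.
by rewrite (addrC (cos t * w.2)).
Qed.

End circle_mean.

Section gaussian.
Variable R : realType.
Implicit Types (z : R * R).
Local Notation mR := (measurableTypeR R).
Local Notation mu := (@lebesgue_measure R).
Local Notation plane := (@plane_measure R).

Lemma plane_sigma_finite : sigma_finite setT plane.
Proof.
pose D (n : nat) : set mR := `[- n%:R, n%:R]%classic.
exists (fun n => D n `*` D n).
  apply/seteqP; split => // -[x y] _.
  exists (Num.truncn (`|x| + `|y|)).+1 => //.
  have h := truncnS_gt (`|x| + `|y|).
  have [hx hy] : `|x| <= (Num.truncn (`|x| + `|y|)).+1%:R /\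
      `|y| <= (Num.truncn (`|x| + `|y|)).+1%:R.
    by split; apply: le_trans (ltW h); rewrite ?lerDl ?lerDr.
  by split; rewrite /D/= in_itv/= -ler_norml.
move=> n; have mD : measurable (D n) by exact: measurable_itv.
split; first exact: measurableX.
have -> : plane (D n `*` D n) = (mu (D n) * mu (D n))%E by exact: product_measure1E.
have muD : (mu (D n) < +oo)%E.
  by rewrite lebesgue_measure_itv/=; case: ifPn => // _; rewrite -EFinB ltry.
by rewrite lte_mul_pinfty// ge0_fin_numE.
Qed.

Definition gaussian (a : R) z : R := expR (- (a * (z.1 ^+ 2 + z.2 ^+ 2))).

Lemma gaussian_ge0 a z : 0 <= gaussian a z.
Proof. exact: expR_ge0. Qed.

Lemma measurable_gaussian a : measurable_fun [set: mR * mR] (gaussian a : mR * mR -> mR).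
Proof.
apply: measurableT_comp; first exact: measurable_expR.
apply: measurableT_comp => //; apply: measurable_funM => //.
by apply: measurable_funD; apply: measurable_funX.
Qed.

Lemma integral_gaussian (a : R) : 0 < a ->
  (\int[plane]_z (gaussian a z)%:E = (pi / a)%:E)%E.
Proof.
move=> a0.
(* 1 / (2 a) is the variance of the normal law whose density is proportional to exp(- a x^2); [c]
   below is the integral of that exponential, the square root of pi / a. *)
pose s := Num.sqrt ((a *+ 2)^-1).
have s2 : s ^+ 2 = (a *+ 2)^-1 by rewrite sqr_sqrtr// invr_ge0 mulrn_wge0// ltW.
have s0 : s != 0 by rewrite sqrtr_eq0 -ltNge invr_gt0 pmulrn_lgt0.
pose c : R := (normal_peak s)^-1.
have c2 : c * c = pi / a.
  rewrite /c /normal_peak invrK -expr2 sqr_sqrtr; last first.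
    by rewrite mulrn_wge0// mulr_ge0 ?sqr_ge0 ?pi_ge0.
  by rewrite s2; field; rewrite gt_eqF.
have c0 : 0 <= c by rewrite invr_ge0 normal_peak_ge0.
have pdf x : expR (- (a * x ^+ 2)) = c * normal_pdf 0 s x.
  have -> : normal_pdf 0 s x = normal_peak s * normal_fun 0 s x.
    by rewrite /normal_pdf (negbTE s0).
  rewrite /c mulKf; last first.
    by rewrite gt_eqF// normal_peak_gt0.
  rewrite /normal_fun subr0 s2; congr expR; field.
  by rewrite gt_eqF.
have int1 : (\int[mu]_x (expR (- (a * x ^+ 2)))%:E = c%:E)%E.
  under eq_integral do rewrite pdf EFinM.
  rewrite ge0_integralZl//; first by rewrite integral_normal_pdf mule1.
  - apply/measurable_EFinP; exact: measurable_normal_pdf.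
  - by move=> x _; rewrite lee_fin normal_pdf_ge0.
have me : measurable_fun [set: mR] (fun x : mR => (expR (- (a * x ^+ 2)))%:E).
  apply/measurable_EFinP; apply: measurableT_comp; first exact: measurable_expR.
  by apply: measurableT_comp => //; apply: measurable_funM => //; exact: measurable_funX.
transitivity (\int[mu]_x \int[mu]_y (gaussian a (x, y))%:E)%E.
  apply: fubini_tonelli1 => //=.
    by apply/measurable_EFinP; exact: measurable_gaussian.
  by move=> z; rewrite lee_fin gaussian_ge0.
transitivity (\int[mu]_x ((expR (- (a * x ^+ 2)))%:E * c%:E))%E.
  apply: eq_integral => x _; rewrite -int1 -ge0_integralZl//;
    do ?by move=> *; rewrite lee_fin expR_ge0.
  by apply: eq_integral => y _; rewrite /gaussian mulrDr opprD expRD EFinM.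
rewrite ge0_integralZr//; do ?by move=> *; rewrite lee_fin expR_ge0.
by rewrite int1 -EFinM c2.
Qed.

Lemma integrable_gaussian (a : R) : 0 < a ->
  plane.-integrable setT (fun z => (gaussian a z)%:E).
Proof.
move=> a0; apply/integrableP; split.
  by apply/measurable_EFinP; exact: measurable_gaussian.
under eq_integral do rewrite gee0_abs ?lee_fin ?gaussian_ge0//.
by rewrite integral_gaussian// ltry.
Qed.

(** This is [integral_averaging] for the rotations: they preserve the Gaussian and the plane
    measure, and [circle_mean] evaluates the average of h over each circle. *)
Lemma gaussian_mean_value (I : quat R) (h : R * R -> quat R) (a : R) (j : 'I_4) :
  imag_units I -> holo I h -> 0 < a ->
  plane.-integrable setT (fun z => (h z 0 j * gaussian a z)%:E) ->
  (\int[plane]_z (h z 0 j * gaussian a z)%:E = (h 0 0 j * (pi / a))%:E)%E.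
Proof.
move=> hI hh a0 hi; rewrite [RHS]EFinM -(integral_gaussian a0).
have hj : continuous (fun z => h z 0 j : R).
  move=> z; apply: differentiable_continuous.
  by have := is_diff_coord j (holo_is_diff hh z) => -[].
have mk := continuous_measurable_fun2 hj.
have pi20 : 0 < 2 * pi :> R by rewrite mulr_gt0// pi_gt0.
pose rho (w : (mR * mR) * mR) : mR * mR := rotation (cos w.2) (sin w.2) w.1.
have mrho : measurable_fun [set: (mR * mR) * mR] rho.
  have mc : measurable_fun [set: (mR * mR) * mR]
      ((fun w => cos w.2) : (mR * mR) * mR -> mR).
    apply: (@measurableT_comp _ _ _ _ _ _ (cos : mR -> mR)) => //.
    by apply: continuous_measurable_fun; exact: continuous_cos.
  have ms : measurable_fun [set: (mR * mR) * mR]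
      ((fun w => sin w.2) : (mR * mR) * mR -> mR).
    apply: (@measurableT_comp _ _ _ _ _ _ (sin : mR -> mR)) => //.
    by apply: continuous_measurable_fun; exact: continuous_sin.
  have m1 : measurable_fun [set: (mR * mR) * mR]
      ((fun w => w.1.1) : (mR * mR) * mR -> mR).
    exact: (measurableT_comp measurable_fst measurable_fst).
  have m2 : measurable_fun [set: (mR * mR) * mR]
      ((fun w => w.1.2) : (mR * mR) * mR -> mR).
    exact: (measurableT_comp measurable_snd measurable_fst).
  apply: measurable_fun_pair.
    by apply: measurable_funB; exact: measurable_funM.
  by apply: measurable_funD; exact: measurable_funM.
have rho_cont z : continuous (fun t => h (rotation (cos t) (sin t) z) 0 j : R).
  move=> t; apply: (@continuous_comp _ _ _
      (fun t => rotation (cos t) (sin t) z) (fun z => h z 0 j)); last exact: hj.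
  apply: differentiable_continuous.
  have cd := is_derive_is_diff (is_derive_cos t).
  have sd := is_derive_is_diff (is_derive_sin t).
  have [] // := is_diff_pair (is_diffB (is_diffM cd (is_diff_cst z.1 t))
      (is_diffM sd (is_diff_cst z.2 t)))
    (is_diffD (is_diffM sd (is_diff_cst z.1 t))
      (is_diffM cd (is_diff_cst z.2 t))).
have mD : measurable (`[0, 2 * pi]%classic : set mR) by exact: measurable_itv.
have muD : mu `[0, 2 * pi]%classic = (2 * pi)%:E.
  by rewrite lebesgue_measure_itv/= lte_fin pi20 oppr0 adde0.
(* Fubini's theorem asks for a sigma-finite measure, so the product measure is repackaged with that
   structure. *)
pose pm : {sigma_finite_measure set (mR * mR)%type -> \bar R} :=
  HB.pack (mu \x mu)%E
    (Measure_isSigmaFinite.Build _ _ _ (mu \x mu)%E plane_sigma_finite).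
have := @integral_averaging _ _ _ mR R pm mu rho `[0, 2 * pi]%classic
  (2 * pi) (fun z => h z 0 j) (gaussian a) (h 0 0 j) mrho mD pi20.
apply => //.
- move=> s A mA.
  exact: (plane_preserving_rotation (cos2Dsin2 s)).2.
- exact: measurable_gaussian.
- move=> z s; rewrite /gaussian /rho /rotation/=; congr (expR (- (a * _))).
  have := cos2Dsin2 s; move: (cos s) (sin s) (z.1) (z.2) => c d x y e.
  have -> : x ^+ 2 + y ^+ 2 = (c ^+ 2 + d ^+ 2) * (x ^+ 2 + y ^+ 2) by rewrite e mul1r.
  ring.
- move=> z; apply: continuous_compact_integrable; first exact: segment_compact.
  by apply: continuous_subspaceT; exact: rho_cont.
- by move=> z; exact: (circle_mean hI hh z j).
- exact: integrable_gaussian.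
Qed.

End gaussian.

(** * The quaternionic exponential and Euler's formula on a slice *)

Section quaternion_series.
Variable R : realType.
Implicit Types (p q a b e l I : quat R) (u : nat -> quat R).

Lemma cvg_qmull a u l : u @ \oo --> l -> (fun n => a * u n) @ \oo --> a * l.
Proof.
move=> ul.
have cf : {for l, continuous (fun v : quat R => a * v)}.
  apply: differentiable_continuous.
  by apply: ex_diff; exact: is_diff_qmul (is_diff_cst a l) (is_diff_id l).
exact: cvg_comp ul cf.
Qed.

Lemma cvg_qmulr a u l : u @ \oo --> l -> (fun n => u n * a) @ \oo --> l * a.
Proof.
move=> ul.
have cf : {for l, continuous (fun v : quat R => v * a)}.
  apply: differentiable_continuous.
  by apply: ex_diff; exact: is_diff_qmul (is_diff_id l) (is_diff_cst a l).
exact: cvg_comp ul cf.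
Qed.

Lemma limn_unique u l : u @ \oo --> l -> limn u = l.
Proof. exact: cvg_lim. Qed.

Lemma qmod_cvg_le u l (C : R) : u @ \oo --> l ->
  (forall n, qmod (u n) <= C) -> qmod l <= C.
Proof.
move=> ul uC; apply/ler_addgt0Pr => e e0.
have e20 : 0 < e / 2 by rewrite divr_gt0.
have /cvgrPdist_lt/(_ _ e20)[N _ hN] := ul.
have := hN N (leqnn N) => /= h.
rewrite -(subrK (u N) l) (le_trans (ler_qmodD _ _))// addrC lerD//.
by apply: le_trans (ler_qmod_norm _) _; rewrite mulrC -ler_pdivlMr// ltW.
Qed.

Lemma cvg_qseries u (x : R) : (forall n, qmod (u n) <= exp_coeff x n) ->
  cvgn (series u).
Proof.
move=> ux; apply: normed_cvg.
apply: (series_le_cvg (v_ := exp_coeff x)) => [n|n|n|].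
- exact: normr_ge0.
- exact: le_trans (qmod_ge0 _) (ux n).
- exact: le_trans (ler_norm_qmod _) (ux n).
- exact: is_cvg_series_exp_coeff.
Qed.

Lemma cvg_qexp q : series (fun n => n`!%:R^-1 *: q ^+ n) @ \oo --> qexp q.
Proof.
apply: (cvg_qseries (x := qmod q)) => n.
by rewrite qmodZ qmodX ger0_norm ?invr_ge0// mulrC.
Qed.

Lemma cvg_estar (nu : R) q p :
  series (fun n => (nu ^+ n / n`!%:R) *: (q ^+ n * qconj p ^+ n)) @ \oo -->
  estar nu q p.
Proof.
apply: (cvg_qseries (x := `|nu| * (qmod q * qmod p))) => n.
rewrite qmodZ qmodM !qmodX qmod_conj /exp_coeff/= normrM normrX.
by rewrite (ger0_norm (_ : 0 <= n`!%:R^-1)) ?invr_ge0// !exprMn mulrAC.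
Qed.

Lemma intertwineX e a b n : e * a = b * e -> e * a ^+ n = b ^+ n * e.
Proof.
move=> h; elim: n => [|n ih]; first by rewrite !expr0 mulr1 mul1r.
by rewrite exprS mulrA h -mulrA ih mulrA -exprS.
Qed.

(** An intertwining relation rather than a conjugation by [e], because [e] may vanish: the
    coefficient (1 - J I)/2 is 0 for J = - I. *)
Lemma qexp_intertwine e a b : e * a = b * e -> e * qexp a = qexp b * e.
Proof.
move=> h; have h1 := @cvg_qmull e _ _ (@cvg_qexp a).
have h2 := @cvg_qmulr e _ _ (@cvg_qexp b).
rewrite -(limn_unique h1) -(limn_unique h2); congr (limn _).
apply/funext => n; rewrite /series/= mulr_sumr mulr_suml.
by apply: eq_bigr => i _; rewrite -scalerAr (intertwineX _ h) scalerAl.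
Qed.

(** Without its first two terms the exponential series is dominated by m^2 times the series of
    exp(m), since (i + 2)! is at least i!. *)
Lemma qexp_taylor q :
  qmod (qexp q - 1 - q) <= qmod q ^+ 2 * expR (qmod q).
Proof.
set m := qmod q; have m0 : 0 <= m := qmod_ge0 q.
have h : (fun n => series (fun n => n`!%:R^-1 *: q ^+ n) (n + 2)%N - (1 + q))
    @ \oo --> qexp q - (1 + q).
  apply: cvgB; last exact: cvg_cst.
  by rewrite (cvg_shiftn 2); exact: cvg_qexp.
rewrite -addrA -opprD; apply: (qmod_cvg_le h) => n.
rewrite /series/= addn2 !big_nat_recl//= expr0 expr1 !invr1 !scale1r addrA.
rewrite [X in qmod (X - _)]addrC addrK.
apply: le_trans (ler_qmod_sum _ _) _.
apply: (@le_trans _ _ (m ^+ 2 * series (exp_coeff m) n)).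
  rewrite /series/= mulr_sumr; apply: ler_sum => i _.
  rewrite qmodZ qmodX ger0_norm ?invr_ge0// /exp_coeff/= -/m.
  rewrite [m ^+ i.+2](exprD _ 2 i) mulrC -mulrA ler_wpM2l ?exprn_ge0//.
  rewrite ler_wpM2l ?exprn_ge0// lef_pV2 ?posrE ?ltr0n ?fact_gt0// ler_nat.
  by rewrite !factS mulnA leq_pmull// muln_gt0.
rewrite ler_wpM2l ?exprn_ge0// /expR.
apply: nondecreasing_cvgn_le; last exact: is_cvg_series_exp_coeff.
apply/nondecreasing_seqP => k; rewrite /series/= big_nat_recr//= lerDl.
exact: exp_coeff_ge0.
Qed.

End quaternion_series.

Section qexp_slice.
Variables (R : realType) (x y : R).

(* The powers of x + i y in C = R^2. *)
Let pw n : R * R := iter n (cmul (x, y)) (1, 0).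
(** [a] and [b] are the coefficients, as power series in an auxiliary real variable t, of the real
    and imaginary parts of exp(t (x + i y)). These parts solve a linear differential equation in t,
    and Euler's formula is read off at t = 1. *)
Let a n : R := (pw n).1 / n`!%:R.
Let b n : R := (pw n).2 / n`!%:R.

Let pw_le n : `|(pw n).1| + `|(pw n).2| <= (`|x| + `|y|) ^+ n.
Proof.
elim: n => [|n ih]; first by rewrite expr0/= normr1 normr0 addr0.
rewrite exprS; apply: le_trans (ler_wpM2l _ ih) => //=.
rewrite /cmul/=; move: (pw n) => [u v] /=.
apply: le_trans (lerD (ler_normB _ _) (ler_normD _ _)) _.
by rewrite !normrM; lra.
Qed.

Let cvg_ps (c : nat -> R) t : (forall n, `|c n| <= (`|x| + `|y|) ^+ n / n`!%:R) ->
  cvgn (pseries c t).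
Proof.
move=> hc; apply: normed_cvg.
apply: (series_le_cvg (v_ := exp_coeff ((`|x| + `|y|) * `|t|))) => [n|n|n|].
- exact: normr_ge0.
- by rewrite /exp_coeff/= divr_ge0// exprn_ge0// mulr_ge0// addr_ge0.
- rewrite /= normrM normrX /exp_coeff/= exprMn mulrAC.
  by rewrite ler_wpM2r// exprn_ge0.
- exact: is_cvg_series_exp_coeff.
Qed.

Let a_le n : `|a n| <= (`|x| + `|y|) ^+ n / n`!%:R.
Proof.
rewrite normrM (ger0_norm (_ : 0 <= n`!%:R^-1)) ?invr_ge0// ler_wpM2r ?invr_ge0//.
by apply: le_trans (pw_le n); rewrite lerDl.
Qed.

Let b_le n : `|b n| <= (`|x| + `|y|) ^+ n / n`!%:R.
Proof.
rewrite normrM (ger0_norm (_ : 0 <= n`!%:R^-1)) ?invr_ge0// ler_wpM2r ?invr_ge0//.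
by apply: le_trans (pw_le n); rewrite lerDr.
Qed.

Let diffs_a : pseries_diffs a = (fun n => x * a n - y * b n).
Proof.
apply/funext => n; rewrite /pseries_diffs /a /b factS natrM.
rewrite (_ : pw n.+1 = cmul (x, y) (pw n))// /cmul/=.
have : n`!%:R != 0 :> R by rewrite pnatr_eq0 -lt0n fact_gt0.
have : n.+1%:R != 0 :> R by rewrite pnatr_eq0.
move: (pw n) n`!%:R n.+1%:R => [u v] f m m0 f0 /=.
by field; rewrite m0 f0.
Qed.

Let diffs_b : pseries_diffs b = (fun n => x * b n + y * a n).
Proof.
apply/funext => n; rewrite /pseries_diffs /a /b factS natrM.
rewrite (_ : pw n.+1 = cmul (x, y) (pw n))// /cmul/=.
have : n`!%:R != 0 :> R by rewrite pnatr_eq0 -lt0n fact_gt0.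
have : n.+1%:R != 0 :> R by rewrite pnatr_eq0.
move: (pw n) n`!%:R n.+1%:R => [u v] f m m0 f0 /=.
by field; rewrite m0 f0.
Qed.

Let A t := limn (pseries a t).
Let B t := limn (pseries b t).

Let cvg_comb (c d : R) t : pseries (fun n => c * a n + d * b n) t @ \oo -->
  c * A t + d * B t.
Proof.
have -> : pseries (fun n => c * a n + d * b n) t =
    (fun n => c * pseries a t n + d * pseries b t n).
  apply/funext => n; rewrite /pseries /series/= !mulr_sumr -big_split/=.
  by apply: eq_bigr => i _; ring.
by apply: cvgD; apply: cvgMr; exact: cvg_ps.
Qed.

Let dA t : is_derive t (1 : R) A (x * A t - y * B t).
Proof.
have e1 : pseries_diffs a = (fun n => x * a n + - y * b n).
  by rewrite diffs_a; apply/funext => n; ring.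
have e2 : pseries_diffs (pseries_diffs a) =
    (fun n => (x * x - y * y) * a n + (- y * x - x * y) * b n).
  rewrite diffs_a; apply/funext => n.
  have := congr1 (@^~ n) diffs_a; have := congr1 (@^~ n) diffs_b.
  rewrite /pseries_diffs mulrBr !(mulrCA n.+1%:R) => -> ->; ring.
apply: is_derive_eq (_ : is_derive t 1 _ (limn (pseries (pseries_diffs a) t))) _.
  apply: (@pseries_snd_diffs R a (`|t| + 1) t); rewrite ?e2 ?e1.
  - exact: cvg_ps.
  - by apply: cvgP; exact: cvg_comb.
  - by apply: cvgP; exact: cvg_comb.
  - by rewrite [ltRHS]ger0_norm ?addr_ge0// ltrDl.
by rewrite e1 (cvg_lim (@Rhausdorff R) (@cvg_comb _ _ t)) ?mulNr// addrC.
Qed.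

Let dB t : is_derive t (1 : R) B (x * B t + y * A t).
Proof.
have e1 : pseries_diffs b = (fun n => y * a n + x * b n).
  by rewrite diffs_b; apply/funext => n; ring.
have e2 : pseries_diffs (pseries_diffs b) =
    (fun n => (x * y + y * x) * a n + (x * x - y * y) * b n).
  rewrite diffs_b; apply/funext => n.
  have := congr1 (@^~ n) diffs_a; have := congr1 (@^~ n) diffs_b.
  rewrite /pseries_diffs mulrDr !(mulrCA n.+1%:R) => -> ->; ring.
apply: is_derive_eq (_ : is_derive t 1 _ (limn (pseries (pseries_diffs b) t))) _.
  apply: (@pseries_snd_diffs R b (`|t| + 1) t); rewrite ?e2 ?e1.
  - exact: cvg_ps.
  - by apply: cvgP; exact: cvg_comb.
  - by apply: cvgP; exact: cvg_comb.
  - by rewrite [ltRHS]ger0_norm ?addr_ge0// ltrDl.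
by rewrite e1 (cvg_lim (@Rhausdorff R) (@cvg_comb _ _ t)) ?mulNr// addrC.
Qed.

Let ps0 (c : nat -> R) : limn (pseries c 0) = c 0%N.
Proof.
apply: (cvg_lim (@Rhausdorff R)); rewrite -(cvg_shiftS (pseries c 0)).
rewrite (_ : (fun n => _) = cst (c 0%N)); first exact: cvg_cst.
apply/funext => n; rewrite /pseries /series/= big_nat_recl//= expr0 mulr1.
by rewrite big1 ?addr0// => i _; rewrite exprS mul0r mulr0.
Qed.

Let AB1 : A 1 = expR x * cos y /\ B 1 = expR x * sin y.
Proof.
pose c t := cos (t * y); pose s t := sin (t * y); pose e t := expR (- (t * x)).
have dc t : is_derive t (1 : R) c (- (y * s t)).
  apply: is_derive_eq; rewrite /GRing.scale/= /s; ring.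
have ds t : is_derive t (1 : R) s (y * c t).
  apply: is_derive_eq; rewrite /GRing.scale/= /c; ring.
have de t : is_derive t (1 : R) e (- (x * e t)).
  apply: is_derive_eq; rewrite /GRing.scale/= /e; ring.
(* The functions in [P] and [Q] are the real and imaginary parts of exp(t (x + i y)) times exp(- t
   x) (cos(t y) - i sin(t y)); they are constant. *)
have P t : is_derive t (1 : R) (e * (A * c + B * s)) 0.
  apply: (is_derive_eq (is_deriveM (de t)
    (is_deriveD (is_deriveM (dA t) (dc t)) (is_deriveM (dB t) (ds t))))).
  by rewrite !fctE /GRing.scale/=; ring.
have Q t : is_derive t (1 : R) (e * (B * c - A * s)) 0.
  apply: (is_derive_eq (is_deriveM (de t)
    (is_deriveB (is_deriveM (dB t) (dc t)) (is_deriveM (dA t) (ds t))))).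
  by rewrite !fctE /GRing.scale/=; ring.
have A0 : A 0 = 1 by rewrite /A ps0 /a/= fact0 divr1.
have B0 : B 0 = 0 by rewrite /B ps0 /b/= mul0r.
have := is_derive_0_is_cst 1 0 P; have := is_derive_0_is_cst 1 0 Q.
rewrite !fctE A0 B0 /e /c /s !mul1r !mul0r oppr0 expR0 cos0 sin0 expRN.
rewrite ?(mul1r, mul0r, mulr0, mulr1, subr0, addr0) => Q1 P1.
have ei : (expR x)^-1 != 0 by rewrite invr_neq0 ?gt_eqF ?expR_gt0.
have {}Q1 : B 1 * cos y - A 1 * sin y = 0.
  by apply: (mulfI ei); rewrite Q1 mulr0.
have {}P1 : A 1 * cos y + B 1 * sin y = expR x.
  by apply: (mulfI ei); rewrite P1 mulVf// gt_eqF ?expR_gt0.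
have := cos2Dsin2 y; rewrite -P1.
move: (A 1) (B 1) (cos y) (sin y) Q1 => u v p q h1 h2.
split.
  have -> : (u * p + v * q) * p = u * (p ^+ 2 + q ^+ 2) + q * (v * p - u * q).
    by ring.
  by rewrite h1 h2 mulr1 mulr0 addr0.
have -> : (u * p + v * q) * q = v * (p ^+ 2 + q ^+ 2) - p * (v * p - u * q).
  by ring.
by rewrite h1 h2 mulr1 mulr0 subr0.
Qed.

Lemma qexp_slice I : imag_units I -> qexp (slice I (x, y)) = slice I (cexp (x, y)).
Proof.
move=> hI; have pwE n : slice I (x, y) ^+ n = slice I (pw n).
  elim: n => [|n ih]; first by rewrite expr0 slice10.
  by rewrite exprS ih -slice_cmul.
have h : (fun n => pseries a 1 n *: (1 : quat R) + pseries b 1 n *: I) @ \oo -->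
    A 1 *: (1 : quat R) + B 1 *: I.
  by apply: cvgD; apply: cvgZr_tmp; exact: cvg_ps.
rewrite /cexp/= -(AB1).1 -(AB1).2 /slice/= -(limn_unique h); congr (limn _).
apply/funext => n; rewrite /pseries /series/= !scaler_suml -big_split/=.
apply: eq_bigr => i _; rewrite pwE /slice !expr1n !mulr1 scalerDr !scalerA.
by rewrite /a /b !(mulrC _^-1).
Qed.

End qexp_slice.

(** * The representation formula and examples of holomorphic functions *)

Section representation.
Variable R : realType.
Implicit Types (I J : quat R) (z v : R * R) (f : quat R -> quat R).

Definition cconj z : R * R := (z.1, - z.2).

(* The coefficients of the representation formula
   f(x + J y) = (1 - J I)/2 f(x + I y) + (1 + J I)/2 f(x - I y). *)
Definition rep_coef J I : quat R := 2^-1 *: (1 - J * I).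
Definition rep_coefc J I : quat R := 2^-1 *: (1 + J * I).

Lemma rep_coefD J I : rep_coef J I + rep_coefc J I = 1.
Proof. by apply: quatP; rewrite /rep_coef /rep_coefc !quatX; field. Qed.

(** (1 - J I) I = I + J = J (1 - J I), so the coefficient intertwines I with J. In
    [rep_coefc_slice], 1 + J I intertwines - I with J, whence the conjugate of z. *)
Lemma rep_coef_slice J I z : imag_units I -> imag_units J ->
  rep_coef J I * slice I z = slice J z * rep_coef J I.
Proof.
move=> hI hJ; rewrite /rep_coef -scalerAl -scalerAr; congr (_ *: _).
rewrite /slice !mulrDl !mulrDr -!scalerAl -!scalerAr !mul1r !mulr1 ?mulNr ?mulrN.
rewrite !mulrA -(mulrA J I I) (imag_unitM hI) (imag_unitM hJ).
by rewrite mulrN1 mulN1r; apply: quatP; rewrite !quatX; ring.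
Qed.

Lemma rep_coefc_slice J I z : imag_units I -> imag_units J ->
  rep_coefc J I * slice I (cconj z) = slice J z * rep_coefc J I.
Proof.
move=> hI hJ; rewrite /rep_coefc -scalerAl -scalerAr; congr (_ *: _).
rewrite /slice /cconj/= !mulrDl !mulrDr -!scalerAl -!scalerAr !mul1r !mulr1.
rewrite !mulrA -(mulrA J I I) (imag_unitM hI) (imag_unitM hJ).
by rewrite mulrN1 mulN1r; apply: quatP; rewrite !quatX; ring.
Qed.

Lemma is_diff_cconj z : is_diff z cconj cconj.
Proof.
by apply: is_diff_eq (is_diff_pair (is_diff_fst z) (is_diffN (is_diff_snd z))) _.
Qed.

Lemma slice_hyperholomorphicP I f : imag_units I ->
  slice_hyperholomorphic f <->
  holo I (f \o slice I) /\ forall J z, imag_units J ->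
    f (slice J z) = rep_coef J I * f (slice I z) +
      rep_coefc J I * f (slice I (cconj z)).
Proof.
move=> hI; split.
- case=> alpha [beta [fE sym dif CR]]; split.
    have -> : f \o slice I = (fun z => alpha z + I * beta z).
      by apply/funext => z /=; rewrite fE.
    move=> z; have [da db] := dif z.
    have dA := differentiableP da; have dB := differentiableP db.
    have d := is_diffD dA (is_diff_qmul (is_diff_cst I z) dB).
    split; first by case: d.
    have e v : 'D_v (fun z => alpha z + I * beta z) z =
        'D_v alpha z + I * 'D_v beta z.
      by rewrite (is_diff_derive v d) fctE mul0r addr0 (deriveE _ da) (deriveE _ db).
    rewrite !e; have := CR z; move: ('D_(1, 0) alpha z) ('D_(0, 1) alpha z).
    move: ('D_(1, 0) beta z) ('D_(0, 1) beta z) => b1 b2 a1 a2 [/eqP].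
    rewrite subr_eq0 => /eqP -> /eqP; rewrite addr_eq0 => /eqP ->.
    by rewrite mulrDr mulrA (imag_unitM hI) mulN1r addrC.
  move=> J [x y] hJ; rewrite !fE//; have [-> ->] := sym x y.
  move: (alpha _) (beta _) => a b.
  rewrite /rep_coef /rep_coefc -!scalerAl mulrBl !mulrDl !mulrDr !mul1r !mulrN.
  rewrite !mulrA -(mulrA J I I) (imag_unitM hI) mulrN1 mulNr.
  by apply: quatP; rewrite !quatX; field.
- move=> [hF rep]; pose F := f \o slice I.
  have dF z := holo_is_diff hF z.
  have dFc z := is_diff_comp (is_diff_cconj z) (dF (cconj z)).
  (* If F = alpha + I beta, conjugating z changes the sign of beta only. So alpha is the even part
     of F, and [beta] below its odd part multiplied by - I. *)
  pose alpha z := 2^-1 *: (F z + F (cconj z)).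
  pose beta z := 2^-1 *: (I * (F (cconj z) - F z)).
  pose D z := 'D_(1, 0) (f \o slice I) z.
  have dalpha z : is_diff z alpha (fun v =>
      2^-1 *: (slice I v * D z + slice I (cconj v) * D (cconj z))).
    exact: is_diffZ (is_diffD (dF z) (dFc z)).
  have dbeta z : is_diff z beta (fun v =>
      2^-1 *: (I * (slice I (cconj v) * D (cconj z) - slice I v * D z))).
    apply: is_diff_eq (is_diffZ _ (is_diff_qmul (is_diff_cst I z)
      (is_diffB (dFc z) (dF z)))) _.
    by apply/funext => v; rewrite !fctE /= mul0r addr0.
  exists alpha, beta; split.
  + move=> J z hJ; rewrite rep// /alpha /beta /F/=.
    move: (f _) (f _) => a b; rewrite /rep_coef /rep_coefc -!scalerAl.
    by rewrite mulrBl mulrDl !mul1r -scalerAr mulrA; apply: quatP; rewrite !quatX; field.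
  + move=> x y; rewrite /alpha /beta /cconj/= opprK; split; first by rewrite addrC.
    by rewrite -scalerN -mulrN opprB.
  + by move=> z; split; [case: (dalpha z)|case: (dbeta z)].
  + move=> z; rewrite !(is_diff_derive _ (dalpha z)) !(is_diff_derive _ (dbeta z)).
    move: (D z) (D (cconj z)) => a b.
    rewrite /cconj/= oppr0 !slice10 slice01 !mul1r.
    have -> : slice I (0, -1) = - I.
      by rewrite /slice/= scale0r add0r scaleN1r.
    have e x : I * (I * x) = - x by rewrite mulrA (imag_unitM hI) mulN1r.
    rewrite !mulNr !mulrBr mulrN !e.
    by split; apply: quatP; rewrite !quatX; field.
Qed.

End representation.

Section holomorphic_functions.
Variable R : realType.
Implicit Types (I : quat R) (F G : R * R -> quat R).

Lemma is_diff_cmul (V : normedModType R) (f g df dg : V -> (R * R)%type) x :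
  is_diff x f df -> is_diff x g dg ->
  is_diff x (fun z => cmul (f z) (g z))
    (fun v => cmul (df v) (g x) + cmul (f x) (dg v)).
Proof.
move=> hf hg.
have f1 := is_diff_comp hf (is_diff_fst (f x)).
have f2 := is_diff_comp hf (is_diff_snd (f x)).
have g1 := is_diff_comp hg (is_diff_fst (g x)).
have g2 := is_diff_comp hg (is_diff_snd (g x)).
apply: is_diff_eq (is_diff_pair
  (is_diffB (is_diffM f1 g1) (is_diffM f2 g2))
  (is_diffD (is_diffM f1 g2) (is_diffM f2 g1))) _.
apply/funext => v; rewrite /cmul !fctE/= /GRing.scale/=.
by congr pair; rewrite /=; ring.
Qed.

Lemma holoD I F G : holo I F -> holo I G -> holo I (fun z => F z + G z).
Proof.
move=> hF hG z; have d := is_diffD (holo_is_diff hF z) (holo_is_diff hG z).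
have e v : 'D_v (fun z => F z + G z) z =
    slice I v * 'D_(1, 0) F z + slice I v * 'D_(1, 0) G z.
  by rewrite (is_diff_derive v d).
split; first by case: d.
by rewrite !e slice10 slice01 !mul1r [RHS]mulrDr.
Qed.

Lemma holoMr I F (c : quat R) : holo I F -> holo I (fun z => F z * c).
Proof.
move=> hF z; have d := is_diff_qmul (holo_is_diff hF z) (is_diff_cst c z).
have e v : 'D_v (fun z => F z * c) z = slice I v * 'D_(1, 0) F z * c.
  by rewrite (is_diff_derive v d) mulr0 add0r.
split; first by case: d.
by rewrite !e slice10 slice01 !mul1r mulrA.
Qed.

Lemma is_diff_slice_id I (z : R * R) : is_diff z (slice I) (slice I).
Proof.
apply: is_diff_eq (is_diff_slice I (is_diff_fst z) (is_diff_snd z)) _.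
by apply/funext => -[].
Qed.

Lemma holo_slice I : imag_units I -> holo I (slice I).
Proof.
move=> hI; apply: is_diff_holo => // z; exists 1.
by apply: is_diff_eq (is_diff_slice_id I z) _; apply/funext => v; rewrite mulr1.
Qed.

(** Both the kernel on a slice and the holomorphic factor left after completing the square are
    exponentials of quadratic polynomials. *)
Definition cexp_quad (a b c z : R * R) : R * R :=
  cexp (cmul a (cmul z z) + cmul b z + c).

Lemma is_diff_cexp_quad a b c z : exists d, is_diff z (cexp_quad a b c) ((@cmul R)^~ d).
Proof.
pose g z := cmul a (cmul z z) + cmul b z + c.
have iz := is_diff_id z.
have h := is_diffD (is_diffD (is_diff_cmul (is_diff_cst a z) (is_diff_cmul iz iz))
   (is_diff_cmul (is_diff_cst b z) iz)) (is_diff_cst c z).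
exists (cmul (cmul a z + cmul a z + b) (cexp (g z))).
apply: is_diff_eq (is_diff_comp h (is_diff_cexp _)) _.
apply/funext => v; rewrite /cmul !fctE/= -/(g z).
by congr pair; rewrite /=; ring.
Qed.

(** The left factor takes values in C_I and so commutes with I, which lets I come out on the left of
    both terms of the product rule. *)
Lemma holo_cexp_quad I F a b c : imag_units I -> holo I F ->
  holo I (fun z => slice I (cexp_quad a b c z) * F z).
Proof.
move=> hI hF z; have [d hd] := is_diff_cexp_quad a b c z.
have s := is_diff_comp hd (is_diff_slice_id I (cexp_quad a b c z)).
have D := is_diff_qmul s (holo_is_diff hF z).
set E := slice I (cexp_quad a b c z) in D.
have e v : 'D_v (fun z => slice I (cexp_quad a b c z) * F z) z =
    E * (slice I v * 'D_(1, 0) F z) + slice I (cmul v d) * F z.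
  by rewrite (is_diff_derive v D).
split; first by case: D.
rewrite !e !slice_cmul// slice10 slice01 !mul1r [RHS]mulrDr.
congr (_ + _); last by rewrite mulrA.
by rewrite !mulrA -[in LHS](slice01 I) sliceC// slice01.
Qed.

Lemma holo_cst I (c : quat R) : holo I (cst c).
Proof.
by move=> z; split=> //; rewrite !derive_cst mulr0.
Qed.

Lemma holo_shift I F w : imag_units I -> holo I F -> holo I (fun z => F (z + w)).
Proof.
move=> hI hF; apply: (holo_comp (g := fun z => z + w) (g' := fun=> (1, 0)) hI hF).
move=> z; apply: is_diff_eq (is_diffD (is_diff_id z) (is_diff_cst w z)) _.
by apply/funext => v; rewrite fctE /= addr0 /cmul; case: v => a b /=; congr pair; ring.
Qed.

End holomorphic_functions.

(** * The kernel on one slice and across slices *)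

Section kernel.
Variables (R : realType) (gamma : R).
Hypothesis gamma_gt0 : 0 < gamma.
Implicit Types (I J p q e : quat R) (z w u : R * R).

Local Notation g2 := ((gamma ^+ 2)^-1).
Local Notation K := (rbf_kernel gamma).

Definition kexp z w : R * R :=
  cexp (- (g2 *: cmul (z - cconj w) (z - cconj w))).

(** The weight on a slice, where (q - conj q)^2 = (2 I y)^2 = - 4 y^2. *)
Definition wt z : R := expR (- (4 * g2 * z.2 ^+ 2)).

Lemma wt_ge0 z : 0 <= wt z. Proof. exact: expR_ge0. Qed.

Lemma rbf_weight_slice I z : imag_units I ->
  rbf_weight gamma (slice I z) = (wt z)%:A.
Proof.
move=> hI; rewrite /rbf_weight qconj_slice// -sliceB [slice _ _ ^+ 2]expr2.
rewrite -slice_cmul// -sliceZ.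
case: z => x y; rewrite /cmul/= [_ *: _](_ : _ = (- (4 * g2 * y ^+ 2), 0)).
  by rewrite qexp_slice// /cexp/= cos0 sin0 mulr1 mulr0 slice_real.
by congr pair; rewrite /= /GRing.scale/=; ring.
Qed.

Lemma rbf_kernel_slice I z w : imag_units I ->
  K (slice I z) (slice I w) = slice I (kexp z w).
Proof.
move=> hI; rewrite /rbf_kernel qconj_slice// -/(cconj w).
have sq u : qexp (- (g2 *: slice I u ^+ 2)) = slice I (cexp (- (g2 *: cmul u u))).
  rewrite [slice _ _ ^+ 2]expr2 -slice_cmul// -sliceZ -sliceN.
  by case: (- _) => a b; exact: qexp_slice.
(* On one slice q and conj p commute, so the star exponential is an ordinary exponential. *)
have -> : estar (2 / gamma ^+ 2) (slice I z) (slice I w) =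
    slice I (cexp ((2 * g2) *: cmul z (cconj w))).
  transitivity (qexp ((2 * g2) *: (slice I z * slice I (cconj w)))).
    congr (limn _); apply/funext => n; apply: eq_bigr => i _.
    rewrite qconj_slice// -/(cconj w) [in RHS]exprZn.
    rewrite (exprMn_comm _ (sliceC z (cconj w) hI)).
    by rewrite scalerA [in RHS]mulrC.
  by rewrite -slice_cmul// -sliceZ; case: (_ *: _) => a b; exact: qexp_slice.
rewrite !sq -!slice_cmul// -!cexpD /kexp; congr (slice I (cexp _)).
case: z w => x y [a b]; rewrite /cmul/cconj/=.
by congr pair; rewrite /= /GRing.scale/=; ring.
Qed.

Lemma qexp_sq_intertwine e (p q : quat R) (c : R) : e * p = q * e ->
  e * qexp (- (c *: p ^+ 2)) = qexp (- (c *: q ^+ 2)) * e.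
Proof.
move=> h; apply: qexp_intertwine.
by rewrite mulrN mulNr -scalerAr -scalerAl (intertwineX _ h).
Qed.

Lemma estar_addr (nu : R) (q p q1 p1 q2 p2 b1 b2 : quat R) :
  (forall n, q ^+ n * qconj p ^+ n = q1 ^+ n * qconj p1 ^+ n * b1 +
     q2 ^+ n * qconj p2 ^+ n * b2) ->
  estar nu q p = estar nu q1 p1 * b1 + estar nu q2 p2 * b2.
Proof.
move=> h.
have l1 := @cvg_qmulr _ b1 _ _ (@cvg_estar _ nu q1 p1).
have l2 := @cvg_qmulr _ b2 _ _ (@cvg_estar _ nu q2 p2).
rewrite -(limn_unique (cvgD l1 l2)); congr (limn _); apply/funext => n.
rewrite /series fctE/= !mulr_suml -big_split/=.
by apply: eq_bigr => i _; rewrite h scalerDr -!scalerAl.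
Qed.

Lemma estar_addl (nu : R) (q p q1 p1 q2 p2 a1 a2 : quat R) :
  (forall n, q ^+ n * qconj p ^+ n = a1 * (q1 ^+ n * qconj p1 ^+ n) +
     a2 * (q2 ^+ n * qconj p2 ^+ n)) ->
  estar nu q p = a1 * estar nu q1 p1 + a2 * estar nu q2 p2.
Proof.
move=> h.
have l1 := @cvg_qmull _ a1 _ _ (@cvg_estar _ nu q1 p1).
have l2 := @cvg_qmull _ a2 _ _ (@cvg_estar _ nu q2 p2).
rewrite -(limn_unique (cvgD l1 l2)); congr (limn _); apply/funext => n.
rewrite /series fctE/= !mulr_sumr -big_split/=.
by apply: eq_bigr => i _; rewrite h scalerDr -!scalerAr.
Qed.

Let mul_addr (A S S1 S2 B B1 B2 e e' : quat R) :
  S = S1 * e + S2 * e' -> e * B = B1 * e -> e' * B = B2 * e' ->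
  A * S * B = A * S1 * B1 * e + A * S2 * B2 * e'.
Proof. by move=> -> h h'; rewrite mulrDr mulrDl -!mulrA h h'. Qed.

Let mul_addl (B S S1 S2 A A1 A2 e e' : quat R) :
  S = e * S1 + e' * S2 -> e * A1 = A * e -> e' * A2 = A * e' ->
  A * S * B = e * (A1 * S1 * B) + e' * (A2 * S2 * B).
Proof. by move=> -> h h'; rewrite mulrDr mulrDl !mulrA h h'. Qed.

(** Insert e + e' = 1 between the powers of q and of conj p. Moved to the right, e and e' carry conj
    p over to slice I. In [rbf_kernel_repl] they move to the left instead, through the powers of
    q. *)
Lemma rbf_kernel_repr I J z w : imag_units I -> imag_units J ->
  K (slice I z) (slice J w) = K (slice I z) (slice I w) * rep_coef I J +
    K (slice I z) (slice I (cconj w)) * rep_coefc I J.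
Proof.
move=> hI hJ; set e := rep_coef I J; set e' := rep_coefc I J.
have he : e * qconj (slice J w) = qconj (slice I w) * e.
  by rewrite !qconj_slice//; exact: rep_coef_slice.
have he' : e' * qconj (slice J w) = qconj (slice I (cconj w)) * e'.
  by rewrite !qconj_slice// [RHS](_ : _ = slice I w * e') ?rep_coefc_slice//=
    opprK -surjective_pairing.
have ee : e + e' = 1 by exact: rep_coefD.
apply: mul_addr; [|exact: qexp_sq_intertwine|exact: qexp_sq_intertwine].
apply: estar_addr => n.
rewrite -!mulrA -(intertwineX _ he) -(intertwineX _ he').
by rewrite -mulrDr -mulrDl ee mul1r.
Qed.

Lemma rbf_kernel_repl I J z p : imag_units I -> imag_units J ->
  K (slice J z) p = rep_coef J I * K (slice I z) p +
    rep_coefc J I * K (slice I (cconj z)) p.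
Proof.
move=> hI hJ; set e := rep_coef J I; set e' := rep_coefc J I.
have he : e * slice I z = slice J z * e by exact: rep_coef_slice.
have he' : e' * slice I (cconj z) = slice J z * e' by exact: rep_coefc_slice.
have ee : e + e' = 1 by exact: rep_coefD.
apply: mul_addl; [|exact: qexp_sq_intertwine|exact: qexp_sq_intertwine].
apply: estar_addl => n.
rewrite !mulrA (intertwineX _ he) (intertwineX _ he').
by rewrite -!mulrA -mulrDr -mulrDl ee mul1r.
Qed.

Lemma slice_hyperholomorphic_kernel p : slice_hyperholomorphic (K ^~ p).
Proof.
(* On the slice of p itself the kernel is an exponential with values in C_J; the representation
   formula covers the other slices. *)
have [J hJ [w ->]] := exists_slice p.
apply/(slice_hyperholomorphicP _ hJ); split; last first.
  by move=> J' z hJ'; exact: rbf_kernel_repl.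
have -> : (K ^~ (slice J w)) \o slice J = (fun z => slice J (cexp_quad
     (- g2, 0) (2 * g2 * w.1, - (2 * g2 * w.2))
     (- (g2 * (w.1 ^+ 2 - w.2 ^+ 2)), 2 * g2 * w.1 * w.2) z) * 1).
  apply/funext => z /=; rewrite rbf_kernel_slice// mulr1; congr (slice J (cexp _)).
  case: z w => x y [a b]; rewrite /cmul/cconj/=.
  by congr pair; rewrite /= /GRing.scale/=; ring.
exact/holo_cexp_quad/holo_cst.
Qed.

(** Completing the square in the real exponent. All norms of kernels and of their remainders are
    reduced to Gaussian integrals in this way. *)
Lemma qmod_kexp I z w : imag_units I ->
  qmod (slice I (kexp z w)) ^+ 2 * wt z =
  expR (4 * g2 * w.2 ^+ 2) * gaussian (2 * g2) (z - w).
Proof.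
move=> hI; rewrite qmod_slice// /kexp /cexp/= !exprMn -mulrDr cos2Dsin2 mulr1.
rewrite expr2 /wt /gaussian -!expRD; congr expR.
by rewrite /cmul/cconj/= /GRing.scale/=; ring.
Qed.

End kernel.

(** * Weighted square norms and pairings of quaternion-valued functions *)

Section quaternion_integral.
Context d (T : measurableType d) (R : realType) (mu : {measure set T -> \bar R}).
Implicit Types (F G X : T -> quat R) (a b : quat R).

Definition qmeas F := forall j : 'I_4, measurable_fun setT (fun z => F z 0 j).

(** [qintble] and [qint] are [qintegrable] and [qintegral] over an arbitrary measure, and unfold to
    them for the plane measure. *)
Definition qintble F :=
  [/\ mu.-integrable setT (fun z => (qre (F z))%:E),
      mu.-integrable setT (fun z => (qim_i (F z))%:E),
      mu.-integrable setT (fun z => (qim_j (F z))%:E) &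
      mu.-integrable setT (fun z => (qim_k (F z))%:E)].

Definition qint F : quat R :=
  mkquat (\int[mu]_z qre (F z)) (\int[mu]_z qim_i (F z))
    (\int[mu]_z qim_j (F z)) (\int[mu]_z qim_k (F z)).

Lemma qmeas_coords F : qmeas F -> [/\ measurable_fun setT (fun z => qre (F z)),
  measurable_fun setT (fun z => qim_i (F z)),
  measurable_fun setT (fun z => qim_j (F z)) &
  measurable_fun setT (fun z => qim_k (F z))].
Proof. by move=> h; split; apply: h. Qed.

Lemma qmeasP F : measurable_fun setT (fun z => qre (F z)) ->
  measurable_fun setT (fun z => qim_i (F z)) ->
  measurable_fun setT (fun z => qim_j (F z)) ->
  measurable_fun setT (fun z => qim_k (F z)) -> qmeas F.
Proof.
move=> h0 h1 h2 h3 [[|[|[|[|//]]]] hj].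
- by rewrite (_ : Ordinal hj = 0)//; apply: val_inj.
- by rewrite (_ : Ordinal hj = 1)//; apply: val_inj.
- by rewrite (_ : Ordinal hj = 2)//; apply: val_inj.
- by rewrite (_ : Ordinal hj = 3)//; apply: val_inj.
Qed.

Lemma qmeasM F G : qmeas F -> qmeas G -> qmeas (fun z => F z * G z).
Proof.
move=> /qmeas_coords[f0 f1 f2 f3] /qmeas_coords[g0 g1 g2 g3].
apply: qmeasP; under eq_fun do rewrite !quatX;
  do 3?[apply: measurable_funD|apply: measurable_funB];
  do ?[exact: measurable_funM|apply: measurableT_comp => //; exact: measurable_funM].
Qed.

Lemma qmeasD F G : qmeas F -> qmeas G -> qmeas (fun z => F z + G z).
Proof.
move=> mF mG j; under eq_fun do rewrite mxE; exact: measurable_funD.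
Qed.

Lemma qmeas_conj F : qmeas F -> qmeas (fun z => qconj (F z)).
Proof.
move=> /qmeas_coords[f0 f1 f2 f3]; apply: qmeasP;
  under eq_fun do rewrite !quatX; rewrite //; exact: measurableT_comp.
Qed.

Lemma qmeas_scale (u : T -> R) F : measurable_fun setT u -> qmeas F ->
  qmeas (fun z => u z *: F z).
Proof.
move=> mu' mF j; under eq_fun do rewrite mxE; exact: measurable_funM.
Qed.

Lemma qmeas_cst a : qmeas (fun=> a). Proof. by move=> j. Qed.

Lemma measurable_qmod_sqr F : qmeas F ->
  measurable_fun setT (fun z => qmod (F z) ^+ 2).
Proof.
move=> /qmeas_coords[f0 f1 f2 f3]; under eq_fun do rewrite qmod_sqr.
by do 3?[apply: measurable_funD]; exact: measurable_funX.
Qed.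

(** Each coordinate of a F, F a or conj F is a real combination of the four coordinates of F;
    linearity of the integral over H, on both sides, follows from this case. *)
Let comb4 (c0 c1 c2 c3 : R) F : qintble F ->
  mu.-integrable setT (fun z => (c0 * qre (F z) + c1 * qim_i (F z) +
    c2 * qim_j (F z) + c3 * qim_k (F z))%:E) /\
  \int[mu]_z (c0 * qre (F z) + c1 * qim_i (F z) + c2 * qim_j (F z) +
    c3 * qim_k (F z)) =
  c0 * qre (qint F) + c1 * qim_i (qint F) + c2 * qim_j (qint F) +
    c3 * qim_k (qint F).
Proof.
move=> [h0 h1 h2 h3]; rewrite /qint !quatX.
have i0 := integrableZl measurableT c0 h0.
have i1 := integrableZl measurableT c1 h1.
have i2 := integrableZl measurableT c2 h2.
have i3 := integrableZl measurableT c3 h3.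
have i01 := integrableD measurableT i0 i1.
have i012 := integrableD measurableT i01 i2.
split; first exact: (integrableD measurableT i012 i3).
by rewrite RintegralD// RintegralD// RintegralD// !RintegralZl.
Qed.

Let comb4E (c0 c1 c2 c3 : R) F (u : T -> R) : qintble F ->
  (forall z, u z = c0 * qre (F z) + c1 * qim_i (F z) +
    c2 * qim_j (F z) + c3 * qim_k (F z)) ->
  mu.-integrable setT (fun z => (u z)%:E) /\
  \int[mu]_z u z = c0 * qre (qint F) + c1 * qim_i (qint F) +
    c2 * qim_j (qint F) + c3 * qim_k (qint F).
Proof.
move=> iF hu; rewrite (_ : u = fun z => c0 * qre (F z) + c1 * qim_i (F z) +
    c2 * qim_j (F z) + c3 * qim_k (F z)); last exact/funext.
exact: comb4.
Qed.

Lemma qint_mull a F : qintble F ->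
  qintble (fun z => a * F z) /\ qint (fun z => a * F z) = a * qint F.
Proof.
move=> iF.
have [|j0 e0] := @comb4E (qre a) (- qim_i a) (- qim_j a) (- qim_k a) F
  (fun z => qre (a * F z)) iF; first by move=> z; rewrite !quatX; ring.
have [|j1 e1] := @comb4E (qim_i a) (qre a) (- qim_k a) (qim_j a) F
  (fun z => qim_i (a * F z)) iF; first by move=> z; rewrite !quatX; ring.
have [|j2 e2] := @comb4E (qim_j a) (qim_k a) (qre a) (- qim_i a) F
  (fun z => qim_j (a * F z)) iF; first by move=> z; rewrite !quatX; ring.
have [|j3 e3] := @comb4E (qim_k a) (- qim_j a) (qim_i a) (qre a) F
  (fun z => qim_k (a * F z)) iF; first by move=> z; rewrite !quatX; ring.
split => //; rewrite [in LHS]/qint e0 e1 e2 e3.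
move: (qint F) => q; apply: quatP; rewrite !quatX; ring.
Qed.

Lemma qint_mulr a F : qintble F ->
  qintble (fun z => F z * a) /\ qint (fun z => F z * a) = qint F * a.
Proof.
move=> iF.
have [|j0 e0] := @comb4E (qre a) (- qim_i a) (- qim_j a) (- qim_k a) F
  (fun z => qre (F z * a)) iF; first by move=> z; rewrite !quatX; ring.
have [|j1 e1] := @comb4E (qim_i a) (qre a) (qim_k a) (- qim_j a) F
  (fun z => qim_i (F z * a)) iF; first by move=> z; rewrite !quatX; ring.
have [|j2 e2] := @comb4E (qim_j a) (- qim_k a) (qre a) (qim_i a) F
  (fun z => qim_j (F z * a)) iF; first by move=> z; rewrite !quatX; ring.
have [|j3 e3] := @comb4E (qim_k a) (qim_j a) (- qim_i a) (qre a) F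
  (fun z => qim_k (F z * a)) iF; first by move=> z; rewrite !quatX; ring.
split => //; rewrite [in LHS]/qint e0 e1 e2 e3.
move: (qint F) => q; apply: quatP; rewrite !quatX; ring.
Qed.

Lemma qint_conj F : qintble F -> qint (fun z => qconj (F z)) = qconj (qint F).
Proof.
move=> iF.
have [|j0 e0] := @comb4E 1 0 0 0 F (fun z => qre (qconj (F z))) iF.
  by move=> z; rewrite !quatX; ring.
have [|j1 e1] := @comb4E 0 (-1) 0 0 F (fun z => qim_i (qconj (F z))) iF.
  by move=> z; rewrite !quatX; ring.
have [|j2 e2] := @comb4E 0 0 (-1) 0 F (fun z => qim_j (qconj (F z))) iF.
  by move=> z; rewrite !quatX; ring.
have [|j3 e3] := @comb4E 0 0 0 (-1) F (fun z => qim_k (qconj (F z))) iF.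
  by move=> z; rewrite !quatX; ring.
rewrite [in LHS]/qint e0 e1 e2 e3.
move: (qint F) => q; apply: quatP; rewrite !quatX; ring.
Qed.

Lemma qintD F G : qintble F -> qintble G ->
  qintble (fun z => F z + G z) /\ qint (fun z => F z + G z) = qint F + qint G.
Proof.
move=> [f0 f1 f2 f3] [g0 g1 g2 g3].
have D (u v : T -> R) : mu.-integrable setT (fun z => (u z)%:E) ->
    mu.-integrable setT (fun z => (v z)%:E) ->
    mu.-integrable setT (fun z => (u z + v z)%:E).
  by move=> iu iv; exact: (integrableD measurableT iu iv).
split.
  by split; (under eq_fun do rewrite !quatX); exact: D.
rewrite /qint.
have e0 : \int[mu]_z qre (F z + G z) = \int[mu]_z (qre (F z) + qre (G z)).
  by apply: eq_Rintegral => z _; rewrite !quatX.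
have e1 : \int[mu]_z qim_i (F z + G z) = \int[mu]_z (qim_i (F z) + qim_i (G z)).
  by apply: eq_Rintegral => z _; rewrite !quatX.
have e2 : \int[mu]_z qim_j (F z + G z) = \int[mu]_z (qim_j (F z) + qim_j (G z)).
  by apply: eq_Rintegral => z _; rewrite !quatX.
have e3 : \int[mu]_z qim_k (F z + G z) = \int[mu]_z (qim_k (F z) + qim_k (G z)).
  by apply: eq_Rintegral => z _; rewrite !quatX.
by rewrite e0 e1 e2 e3 !RintegralD//; apply: quatP; rewrite !quatX.
Qed.

Lemma qmod_le_coords a (C : R) : `|qre a| <= C -> `|qim_i a| <= C ->
  `|qim_j a| <= C -> `|qim_k a| <= C -> qmod a <= 2 * C.
Proof.
move=> h0 h1 h2 h3; have C0 : 0 <= C by apply: le_trans h0.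
rewrite -(ler_pXn2r (n:=2)) ?nnegrE ?mulr_ge0 ?qmod_ge0// exprMn qmod_sqr.
have sq x : `|x| <= C -> x ^+ 2 <= C ^+ 2.
  by move=> h; rewrite -real_normK ?num_real// lerXn2r ?nnegrE.
by have := sq _ h0; have := sq _ h1; have := sq _ h2; have := sq _ h3; lra.
Qed.

Variable w : T -> R.
Hypotheses (mw : measurable_fun setT w) (w0 : forall z, 0 <= w z).

Definition sqnorm F : \bar R := (\int[mu]_z (qmod (F z) ^+ 2 * w z)%:E)%E.

Definition pairing X F z : quat R := qconj (X z) * F z * (w z)%:A.

Lemma sqnorm_ge0 F : (0 <= sqnorm F)%E.
Proof.
by apply: integral_ge0 => z _; rewrite lee_fin mulr_ge0// exprn_ge0// qmod_ge0.
Qed.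

Let measurable_sq F : qmeas F ->
  measurable_fun setT (fun z => (qmod (F z) ^+ 2 * w z)%:E).
Proof.
by move=> mF; apply/measurable_EFinP/measurable_funM => //; exact: measurable_qmod_sqr.
Qed.

Lemma integrable_sqnorm F : qmeas F -> (sqnorm F < +oo)%E ->
  mu.-integrable setT (fun z => (qmod (F z) ^+ 2 * w z)%:E).
Proof.
move=> mF F_fin; apply/integrableP; split; first exact: measurable_sq.
under eq_integral.
  move=> z _; rewrite gee0_abs ?lee_fin ?mulr_ge0// ?exprn_ge0 ?qmod_ge0//.
  over.
exact: F_fin.
Qed.

Let young (x y t : R) : 0 < t -> x * y <= (t * x ^+ 2 + t^-1 * y ^+ 2) / 2.
Proof.
move=> t0; have tn : t != 0 by rewrite gt_eqF.
have := sqr_ge0 (t * x - y); rewrite -(pmulr_rge0 _ (_ : 0 < t^-1)) ?invr_gt0//.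
have -> : t^-1 * (t * x - y) ^+ 2 = t * x ^+ 2 + t^-1 * y ^+ 2 - 2 * (x * y).
  by field.
by move: (t * x ^+ 2) (t^-1 * y ^+ 2) (x * y) => u v s; lra.
Qed.

Let pairing_bound X F (t : R) z : 0 < t ->
  qmod (pairing X F z) <=
  t / 2 * (qmod (X z) ^+ 2 * w z) + t^-1 / 2 * (qmod (F z) ^+ 2 * w z).
Proof.
move=> t0; rewrite /pairing !qmodM qmodZ qmod1 mulr1 qmod_conj ger0_norm//.
have := ler_wpM2r (w0 z) (young (qmod (X z)) (qmod (F z)) t0).
by move/le_trans; apply; rewrite le_eqVlt; apply/orP; left; apply/eqP; ring.
Qed.

Lemma qmeas_pairing X F : qmeas X -> qmeas F -> qmeas (pairing X F).
Proof.
move=> mX mF; apply: qmeasM; first by apply: qmeasM => //; exact: qmeas_conj.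
apply: qmeas_scale => //; exact: qmeas_cst.
Qed.

Lemma pairing_integrable X F : qmeas X -> qmeas F ->
  (sqnorm X < +oo)%E -> (sqnorm F < +oo)%E -> qintble (pairing X F).
Proof.
move=> mX mF X_fin F_fin.
have iX := integrableZl measurableT (1 / 2) (integrable_sqnorm mX X_fin).
have iF := integrableZl measurableT (1^-1 / 2) (integrable_sqnorm mF F_fin).
have iS := integrableD measurableT iX iF.
have [m0 m1 m2 m3] := qmeas_coords (qmeas_pairing mX mF).
have dom (u : T -> R) : measurable_fun setT u ->
    (forall z, `|u z| <= qmod (pairing X F z)) ->
    mu.-integrable setT (fun z => (u z)%:E).
  move=> mu' hu; apply: le_integrable iS => //; first exact/measurable_EFinP.
  move=> z _; rewrite lee_fin.
  apply: le_trans (hu z) _; apply: le_trans (pairing_bound X F z ltr01) _.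
  exact: ler_norm.
by split; apply: dom => // z; [exact: ler_qre_qmod|exact: ler_qim_i_qmod|
  exact: ler_qim_j_qmod|exact: ler_qim_k_qmod].
Qed.

(** A substitute for Cauchy-Schwarz with a free weight t. Each coordinate is bounded with the
    constants t / 2 and 1 / (2 t), and [qmod_le_coords] then costs a factor 2. *)
Lemma pairing_le X F (t a b : R) : qmeas X -> qmeas F -> 0 < t ->
  (sqnorm X <= a%:E)%E -> (sqnorm F <= b%:E)%E ->
  qmod (qint (pairing X F)) <= t * a + t^-1 * b.
Proof.
move=> mX mF t0 Xa Fb.
have X_fin : (sqnorm X < +oo)%E by rewrite (le_lt_trans Xa)// ltry.
have F_fin : (sqnorm F < +oo)%E by rewrite (le_lt_trans Fb)// ltry.
have jX := integrable_sqnorm mX X_fin; have jF := integrable_sqnorm mF F_fin.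
have iX := integrableZl measurableT (t / 2) jX.
have iF := integrableZl measurableT (t^-1 / 2) jF.
have iS := integrableD measurableT iX iF.
have [m0 m1 m2 m3] := pairing_integrable mX mF X_fin F_fin.
have Xa' : \int[mu]_z (qmod (X z) ^+ 2 * w z) <= a.
  by rewrite -lee_fin fineK ?ge0_fin_numE ?sqnorm_ge0.
have Fb' : \int[mu]_z (qmod (F z) ^+ 2 * w z) <= b.
  by rewrite -lee_fin fineK ?ge0_fin_numE ?sqnorm_ge0.
have bound (u : T -> R) : mu.-integrable setT (fun z => (u z)%:E) ->
    (forall z, `|u z| <= qmod (pairing X F z)) ->
    `|\int[mu]_z u z| <= t / 2 * a + t^-1 / 2 * b.
  move=> iu hu; apply: le_trans (le_normr_Rintegral measurableT iu) _.
  apply: (@le_trans _ _ (\int[mu]_z (t / 2 * (qmod (X z) ^+ 2 * w z) +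
      t^-1 / 2 * (qmod (F z) ^+ 2 * w z)))).
    apply: le_Rintegral => //; first exact: integrable_norm iu.
    by move=> z _; apply: le_trans (hu z) _; exact: pairing_bound.
  rewrite RintegralD// !RintegralZl//.
  by apply: lerD; rewrite ler_wpM2l// divr_ge0// ?invr_ge0 ltW.
have -> : t * a + t^-1 * b = 2 * (t / 2 * a + t^-1 / 2 * b).
  by field; rewrite gt_eqF.
by apply: qmod_le_coords; rewrite /qint !quatX; apply: bound => // z;
  [exact: ler_qre_qmod|exact: ler_qim_i_qmod|
  exact: ler_qim_j_qmod|exact: ler_qim_k_qmod].
Qed.

Lemma sqnormD_le F G : qmeas F -> qmeas G ->
  (sqnorm (fun z => (F z + G z)%R) <= 2%:E * sqnorm F + 2%:E * sqnorm G)%E.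
Proof.
move=> mF mG; rewrite -!ge0_integralZl//; try exact: measurable_sq;
  try by move=> z _; rewrite lee_fin mulr_ge0// exprn_ge0 ?qmod_ge0.
have ge0 (H : T -> quat R) z : (0 <= 2%:E * (qmod (H z) ^+ 2 * w z)%:E)%E.
  by rewrite mule_ge0// lee_fin mulr_ge0// exprn_ge0 ?qmod_ge0.
rewrite -ge0_integralD//; try by apply: measurable_funeM; exact: measurable_sq.
apply: ge0_le_integral => //.
- by move=> z _; rewrite lee_fin mulr_ge0// exprn_ge0 ?qmod_ge0.
- by apply: (measurable_sq (F := fun z => F z + G z)); exact: qmeasD.
- by apply: emeasurable_funD; apply: measurable_funeM; exact: measurable_sq.
- move=> z _; rewrite -!EFinM -EFinD lee_fin !mulrA -mulrDl ler_wpM2r//.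
  have h := ler_qmodD (F z) (G z).
  apply: (@le_trans _ _ ((qmod (F z) + qmod (G z)) ^+ 2)).
    by rewrite lerXn2r ?nnegrE ?addr_ge0 ?qmod_ge0.
  by have := sqr_ge0 (qmod (F z) - qmod (G z)); nra.
Qed.

Lemma sqnormMr F a : qmeas F ->
  sqnorm (fun z => F z * a) = ((qmod a ^+ 2)%:E * sqnorm F)%E.
Proof.
move=> mF; rewrite -ge0_integralZl//; try exact: measurable_sq;
  try by move=> z _; rewrite lee_fin mulr_ge0// exprn_ge0 ?qmod_ge0.
  by apply: eq_integral => z _; rewrite -EFinM qmodM; congr EFin; ring.
by rewrite lee_fin exprn_ge0 ?qmod_ge0.
Qed.

End quaternion_integral.

Lemma measurable_wt (R : realType) (gamma : R) :
  measurable_fun [set: measurableTypeR R * measurableTypeR R] (wt gamma).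
Proof.
apply: measurableT_comp; first exact: measurable_expR.
apply: measurableT_comp => //; apply: measurable_funM => //.
exact: measurable_funX.
Qed.

(** * The reproducing formula on one slice *)

Section reproducing.
Variables (R : realType) (gamma : R).
Hypothesis gamma_gt0 : 0 < gamma.
Implicit Types (I J p q : quat R) (z u : R * R) (F X : R * R -> quat R).
Implicit Types f g : quat R -> quat R.

Local Notation mR := (measurableTypeR R).
Local Notation plane := (@plane_measure R).
Local Notation g2 := ((gamma ^+ 2)^-1).
Local Notation K := (rbf_kernel gamma).
Local Notation W := (wt gamma : mR * mR -> R).
Local Notation N F := (@sqnorm _ (mR * mR)%type R plane W F).
Local Notation ip X F := (@pairing _ (mR * mR)%type R W X F).
Local Notation qmeas F := (@qmeas _ (mR * mR)%type R F).

Let g2_gt0 : 0 < g2. Proof. by rewrite invr_gt0 exprn_gt0. Qed.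

Let c_gt0 : 0 < 2 / (pi * gamma ^+ 2).
Proof. by rewrite divr_gt0// mulr_gt0 ?pi_gt0// exprn_gt0. Qed.

Let mW : measurable_fun setT W. Proof. exact: measurable_wt. Qed.

Let W_ge0 z : 0 <= W z. Proof. exact: wt_ge0. Qed.

Lemma continuous_qmeas F : continuous F -> qmeas F.
Proof.
move=> cF j; apply: continuous_measurable_fun2 => z.
apply: (@continuous_comp _ _ _ F (fun q : quat R => q 0 j)); first exact: cF.
by apply: differentiable_continuous; exact: differentiable_coord.
Qed.

Lemma holo_qmeas I F : holo I F -> qmeas F.
Proof. by move=> /holo_continuous/continuous_qmeas. Qed.

Lemma rbf_sqnormE I f : imag_units I ->
  rbf_sqnorm gamma I f = ((2 / (pi * gamma ^+ 2))%:E * N (f \o slice I))%E.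
Proof.
move=> hI; congr (_ * _)%E; apply: eq_integral => z _.
by rewrite rbf_weight_slice// !quatX mulr1.
Qed.

Lemma rbf_sqnorm_fin I f : imag_units I ->
  (rbf_sqnorm gamma I f < +oo)%E <-> (N (f \o slice I) < +oo)%E.
Proof.
move=> hI; rewrite rbf_sqnormE//; have := sqnorm_ge0 plane W_ge0 (f \o slice I).
move=> N0; split; last first.
  by move=> h; rewrite lte_mul_pinfty// lee_fin ltW.
case: (N _) N0 => [r| |]//= _; first by rewrite !ltry.
by rewrite gt0_muley ?lte_fin// ltxx.
Qed.

Lemma rbf_innerE I f g : imag_units I ->
  rbf_inner gamma I f g = (2 / (pi * gamma ^+ 2)) *:
    qint plane (ip (g \o slice I) (f \o slice I)).
Proof.
move=> hI; rewrite /rbf_inner; congr (_ *: qintegral _).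
by apply/funext => z; rewrite /rbf_integrand/= rbf_weight_slice.
Qed.

Lemma sqnorm_kexp_fin I u : imag_units I ->
  (N (fun z => slice I (kexp gamma z u)) < +oo)%E.
Proof.
move=> hI; have a0 : 0 < 2 * g2 by rewrite mulr_gt0.
have := integrable_preserving (plane_preserving_shift (- u)).1
  (plane_preserving_shift (- u)).2 (integrable_gaussian a0).
move=> /(integrableZl measurableT (expR (4 * g2 * u.2 ^+ 2))) /integrableP[_].
apply: le_lt_trans; rewrite le_eqVlt; apply/orP; left; apply/eqP.
apply: eq_integral => z _; rewrite qmod_kexp//.
by rewrite gee0_abs ?mule_ge0 ?lee_fin ?expR_ge0.
Qed.

Lemma qmeas_kexp I u : imag_units I -> qmeas (fun z => slice I (kexp gamma z u)).
Proof.
move=> hI; have [h _] := (slice_hyperholomorphicP (K ^~ (slice I u)) hI).1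
  (slice_hyperholomorphic_kernel gamma _).
rewrite [X in qmeas X](_ : _ = (K ^~ (slice I u)) \o slice I).
  exact: holo_qmeas h.
by apply/funext => z /=; rewrite rbf_kernel_slice.
Qed.

(** For z = x + i y and v = u.2, one has - (conj z)^2 - 4 y^2 = z^2 - 2 |z|^2 and 4 i v conj z - 8 v
    y = 4 i v z. Thus the weight turns the antiholomorphic exponent into a holomorphic one plus that
    of a Gaussian. *)
Lemma pairing_shift I F z u : imag_units I ->
  ip (fun z => slice I (kexp gamma z u)) F (z + u) =
  gaussian (2 * g2) z *: (slice I (cexp_quad (g2, 0) (0, 4 * g2 * u.2) 0 z) *
    F (z + u)).
Proof.
move=> hI; rewrite /pairing qconj_slice//.
rewrite -[in LHS]scalerAr mulr1 -mulrA scalerAl.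
rewrite scalerAl; congr (_ * _); rewrite -!sliceZ; congr slice.
rewrite /kexp /cexp_quad; set v := - _; set v' := _ + 0.
have e1 : W (z + u) * expR v.1 = gaussian (2 * g2) z * expR v'.1.
  rewrite /wt /gaussian -!expRD; congr expR.
  by rewrite /v /v' /cmul /cconj/= /GRing.scale/=; ring.
have e2 : v'.2 = - v.2 by rewrite /v /v' /cmul /cconj/= /GRing.scale/=; ring.
move: v v' e1 e2 => v v' e1 e2; rewrite /cexp e2 cosN sinN.
by congr pair; rewrite /= /GRing.scale/= ?mulrN mulrA e1 -mulrA ?mulrN.
Qed.

(** Translation by u centres the Gaussian at 0, and 2 / (pi gamma^2) is the inverse of its mass pi
    gamma^2 / 2. *)
Lemma reproducing_slice I F u : imag_units I -> holo I F -> (N F < +oo)%E ->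
  (2 / (pi * gamma ^+ 2)) *:
    qint plane (ip (fun z => slice I (kexp gamma z u)) F) = F u.
Proof.
move=> hI hF F_fin; have a0 : 0 < 2 * g2 by rewrite mulr_gt0.
set P := ip _ F.
have iP : qintble plane P.
  apply: pairing_integrable => //; [exact: qmeas_kexp|exact: holo_qmeas hF|].
  exact: sqnorm_kexp_fin.
pose h z := slice I (cexp_quad (g2, 0) (0, 4 * g2 * u.2) 0 z) * F (z + u).
have hh : holo I h := holo_cexp_quad _ _ _ hI (holo_shift u hI hF).
have h0 : h 0 = F u.
  rewrite /h add0r (_ : cexp_quad _ _ _ 0 = (1, 0)) ?slice10 ?mul1r//.
  rewrite /cexp_quad [X in cexp X](_ : _ = 0).
    by rewrite /cexp/= expR0 cos0 sin0 mulr1 mulr0.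
  by congr pair; rewrite /cmul/=; ring.
have [ps1 ps2] := plane_preserving_shift u.
have coord (j : 'I_4) : plane.-integrable setT (fun z => (P z 0 j)%:E) ->
    \int[plane]_z (P z 0 j) = F u 0 j * (pi / (2 * g2)).
  move=> iPj.
  have e : (fun z => (P (z + u) 0 j)%:E) =
      (fun z => (h z 0 j * gaussian (2 * g2) z)%:E).
    by apply/funext => z; rewrite /P pairing_shift// mxE mulrC.
  rewrite /Rintegral -(integral_preserving ps1 ps2 iPj) e.
  rewrite (gaussian_mean_value hI hh a0) ?h0//.
  by rewrite -e; exact: (integrable_preserving ps1 ps2 iPj).
have [i0 i1 i2 i3] := iP.
have e : 2 / (pi * gamma ^+ 2) * (pi / (2 * g2)) = 1.
  have pn : pi != 0 :> R by rewrite gt_eqF// pi_gt0.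
  have gn : gamma != 0 by rewrite gt_eqF.
  by move: (@pi R) pn => a an; field; rewrite gn an.
apply: quatP; rewrite /qint !quatX (coord _ i0, coord _ i1, coord _ i2, coord _ i3);
  by rewrite mulrCA e mulr1.
Qed.

End reproducing.

(** * Bounds on values and on Taylor remainders *)

Section kernel_bounds.
Variables (R : realType) (gamma : R).
Hypothesis gamma_gt0 : 0 < gamma.
Variable I : quat R.
Hypothesis hI : imag_units I.
Implicit Types (z u h : R * R) (F X : R * R -> quat R).

Local Notation mR := (measurableTypeR R).
Local Notation plane := (@plane_measure R).
Local Notation g2 := ((gamma ^+ 2)^-1).
Local Notation W := (wt gamma : mR * mR -> R).
Local Notation N F := (@sqnorm _ (mR * mR)%type R plane W F).
Local Notation ip X F := (@pairing _ (mR * mR)%type R W X F).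
Local Notation qmeas F := (@qmeas _ (mR * mR)%type R F).
Local Notation c := (2 / (pi * gamma ^+ 2)).
Local Notation k u := (fun z => slice I (kexp gamma z u)).

Let g2_gt0 : 0 < g2. Proof. by rewrite invr_gt0 exprn_gt0. Qed.

Let c_gt0 : 0 < c.
Proof. by rewrite divr_gt0// mulr_gt0 ?pi_gt0// exprn_gt0. Qed.

Let mW : measurable_fun setT W. Proof. exact: measurable_wt. Qed.

Let W_ge0 z : 0 <= W z. Proof. exact: wt_ge0. Qed.

Lemma sqnorm_fine F : (N F < +oo)%E -> N F = (fine (N F))%:E.
Proof. by move=> h; rewrite fineK// ge0_fin_numE// sqnorm_ge0. Qed.

(* The choice t = e in the weighted arithmetic-geometric mean inequality
   [pairing_le] makes the bound linear in e. *)
Lemma pairing_sqr_le X F (a e m : R) : qmeas X -> qmeas F -> 0 < e -> 0 < m ->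
  (N X <= (a * m ^+ 2)%:E)%E -> (N F <= (e ^+ 2)%:E)%E ->
  qmod (qint plane (ip X F)) <= (a + 1) * e * m.
Proof.
move=> mX mF e0 m0 Xa Fe.
have t0 : 0 < e / m by rewrite divr_gt0.
apply: le_trans (pairing_le mW W_ge0 mX mF t0 Xa Fe) _.
by rewrite le_eqVlt; apply/orP; left; apply/eqP; field; rewrite !gt_eqF.
Qed.

(** The constant is fixed before F, so that it serves all differences of a Cauchy sequence at
    once. *)
Lemma reproducing_bound u : exists2 C : R, 0 <= C & forall F e, holo I F ->
  0 < e -> (N F <= (e ^+ 2)%:E)%E -> qmod (F u) <= C * e.
Proof.
have a_fin := sqnorm_kexp_fin gamma_gt0 u hI.
pose a := fine (N (k u)).
have a0 : 0 <= a by rewrite fine_ge0// sqnorm_ge0.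
exists (c * (a + 1)); first by rewrite mulr_ge0 ?addr_ge0// ltW.
move=> F e hF e0 Fe; have F_fin : (N F < +oo)%E by rewrite (le_lt_trans Fe)// ltry.
rewrite -(reproducing_slice gamma_gt0 u hI hF F_fin) qmodZ gtr0_norm// -(mulrA c).
rewrite (ler_wpM2l (ltW c_gt0))// -[(a + 1) * e]mulr1.
apply: pairing_sqr_le => //; [exact: qmeas_kexp|exact: holo_qmeas hF|].
by rewrite expr1n mulr1 -sqnorm_fine.
Qed.

(* The derivative of [k u] with respect to [u], and the error made in replacing
   [k (u + h)] by its first order expansion at [u]. *)
Let dk u z : quat R := slice I (kexp gamma z u) * slice I (2 * g2 *: (z - cconj u)).
Let rem u h z : quat R := slice I (kexp gamma z (u + h)) -
  slice I (kexp gamma z u) - dk u z * slice I (cconj h).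

(** From 1 + x / 2 <= exp(x / 2); in [rem_le] it absorbs the square of [T] into an exponential. *)
Let sqr_le_expR (x : R) : 0 <= x -> x ^+ 2 <= 4 * expR x.
Proof.
move=> x0; have h := expR_ge1Dx (x / 2).
have -> : expR x = expR (x / 2) ^+ 2.
  by rewrite expr2 -expRD; congr expR; field.
have h2 : (1 + x / 2) ^+ 2 <= expR (x / 2) ^+ 2.
  by rewrite lerXn2r ?nnegrE ?expR_ge0// addr_ge0// divr_ge0.
nra.
Qed.

Let kexp_shift u h z : kexp gamma z (u + h) = cmul (kexp gamma z u)
  (cexp (g2 *: (2 *: cmul (z - cconj u) (cconj h) - cmul (cconj h) (cconj h)))).
Proof.
rewrite /kexp -cexpD; congr cexp; rewrite /cmul/cconj/=.
by congr pair; rewrite /= /GRing.scale/=; ring.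
Qed.

(** Factoring out k_u(z) leaves exp(s) - 1 - s - h'^2 / gamma^2, where h' is the conjugate of h and
    s = (2 r h' - h'^2) / gamma^2: subtracting [dk] removes only the part of s linear in h'. Both
    exp(s) - 1 - s and h'^2 / gamma^2 are bounded by m^2 times an exponential in |r|. *)
Let rem_le u h z : qmod (slice I h) <= 1 ->
  qmod (rem u h z) <= qmod (slice I (kexp gamma z u)) *
    (qmod (slice I h) ^+ 2 * ((4 + g2) *
      expR (2 * (g2 * (2 * qmod (slice I (z - cconj u)) + 1))))).
Proof.
move=> m1; set m := qmod (slice I h); set r := z - cconj u; set hb := cconj h.
have mE : qmod (slice I hb) = m by rewrite /hb /cconj -qconj_slice// qmod_conj.
have m0 : 0 <= m := qmod_ge0 _.
set rho := qmod (slice I r); have r0 : 0 <= rho := qmod_ge0 _.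
(* Since m <= 1 gives m^2 <= m, |s| is at most m T, hence also at most T. *)
set T := g2 * _; have T0 : 0 <= T.
  by apply: mulr_ge0 (ltW g2_gt0) _; rewrite addr_ge0// mulr_ge0.
pose zeta := g2 *: (2 *: cmul r hb - cmul hb hb).
pose s := slice I zeta.
have sE : qexp s = slice I (cexp zeta).
  by rewrite /s (surjective_pairing zeta); exact: qexp_slice.
have -> : rem u h z = slice I (kexp gamma z u) *
    ((qexp s - 1 - s) - slice I (g2 *: cmul hb hb)).
  rewrite /rem /dk kexp_shift slice_cmul// -/r -/hb -/zeta -sE.
  have e : s + slice I (g2 *: cmul hb hb) = slice I (2 * g2 *: r) * slice I hb.
    rewrite -slice_cmul// -sliceD /s /zeta; congr slice.
    by rewrite /cmul; congr pair; rewrite /= /GRing.scale/=; ring.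
  by rewrite -(addrA (_ - 1)) -opprD e !mulrBr mulr1 mulrA.
have s_le : qmod s <= m * T.
  rewrite /s /zeta sliceZ sliceB sliceZ !slice_cmul// qmodZ gtr0_norm//.
  have h1 : qmod (2 *: (slice I r * slice I hb) - slice I hb * slice I hb) <=
      2 * (rho * m) + m * m.
    apply: le_trans (ler_qmodB _ _) _.
    by rewrite qmodZ !qmodM !mE ger0_norm.
  apply: le_trans (ler_wpM2l (ltW g2_gt0) h1) _.
  have mm : m * m <= m by rewrite ler_piMl.
  rewrite /T [leRHS]mulrCA (ler_wpM2l (ltW g2_gt0))//; lra.
have s_leT : qmod s <= T by apply: le_trans s_le _; rewrite ler_piMl.
rewrite qmodM ler_wpM2l ?qmod_ge0//.
apply: le_trans (ler_qmodB _ _) _.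
have t1 : qmod (qexp s - 1 - s) <= m ^+ 2 * (4 * expR (2 * T)).
  apply: le_trans (qexp_taylor s) _.
  apply: (@le_trans _ _ ((m * T) ^+ 2 * expR T)).
    apply: ler_pM; rewrite ?exprn_ge0 ?qmod_ge0 ?expR_ge0 ?ler_expR//.
    by rewrite lerXn2r ?nnegrE ?qmod_ge0// mulr_ge0.
  rewrite exprMn -mulrA ler_wpM2l ?exprn_ge0//.
  have -> : expR (2 * T) = expR T * expR T by rewrite -expRD; congr expR; ring.
  by rewrite mulrA ler_wpM2r ?expR_ge0// sqr_le_expR.
have t2 : qmod (slice I (g2 *: cmul hb hb)) <= m ^+ 2 * (g2 * expR (2 * T)).
  rewrite sliceZ slice_cmul// qmodZ qmodM mE gtr0_norm// -expr2 mulrC.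
  rewrite ler_wpM2l ?exprn_ge0// ler_peMr ?(ltW g2_gt0)//.
  by rewrite -[X in X <= _]expR0 ler_expR mulr_ge0.
apply: le_trans (lerD t1 t2) _.
by rewrite -mulrDr -mulrDl.
Qed.

(** Half of the Gaussian decay pays for the exponential growth: rho <= dm + 2 |u.2| and 8 dm <= dm^2
    + 16, whence 20 = 16 + 4. *)
Let gauss_rho u z :
  expR (4 * (g2 * (2 * qmod (slice I (z - cconj u)) + 1))) *
    gaussian (2 * g2) (z - u) <=
  expR (g2 * (20 + 16 * `|u.2|)) * gaussian g2 (z - u).
Proof.
rewrite /gaussian -!expRD ler_expR; set rho := qmod _.
set d := z - u; pose dm := qmod (slice I d).
have dm2 : dm ^+ 2 = d.1 ^+ 2 + d.2 ^+ 2 by exact: qmod_slice.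
have rho_le : rho <= dm + 2 * `|u.2|.
  rewrite /rho [z - cconj u](_ : _ = d + (0, 2 * u.2)).
    rewrite sliceD; apply: le_trans (ler_qmodD _ _) _; rewrite lerD2l.
    by rewrite /slice/= scale0r add0r qmodZ qmod_imag_unit// mulr1 normrM ger0_norm.
  by rewrite /d /cconj; congr pair; rewrite /=; ring.
rewrite -dm2; have := sqr_ge0 (dm - 4) => sq.
have -> : 4 * (g2 * (2 * rho + 1)) - 2 * g2 * dm ^+ 2 =
   g2 * (8 * rho + 4 - 2 * dm ^+ 2) by ring.
have -> : g2 * (20 + 16 * `|u.2|) - g2 * dm ^+ 2 =
   g2 * (20 + 16 * `|u.2| - dm ^+ 2) by ring.
rewrite (ler_wpM2l (ltW g2_gt0))//; move: (`|u.2|) rho_le => b; nra.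
Qed.

Let qmeas_dk u : qmeas (dk u).
Proof.
apply: qmeasM; first exact: qmeas_kexp.
apply: (@holo_qmeas _ I).
have hh : holo I (fun z => slice I (z - cconj u) * (2 * g2)%:A).
  exact: holoMr _ (holo_shift _ hI (holo_slice hI)).
rewrite [X in holo I X](_ : _ = fun z => slice I (z - cconj u) * (2 * g2)%:A)//.
by apply/funext => z; rewrite sliceZ -scalerAr mulr1.
Qed.

Let qmeas_rem u h : qmeas (rem u h).
Proof.
have m0 := @qmeas_kexp R gamma I u hI; have m1 := @qmeas_kexp R gamma I (u + h) hI.
have m2 := qmeasM (@qmeas_dk u) (@qmeas_cst _ _ _ (- slice I (cconj h))).
have m3 := qmeasM m0 (@qmeas_cst _ _ _ (- 1)).
rewrite [X in qmeas X](_ : _ = fun z => slice I (kexp gamma z (u + h)) +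
    slice I (kexp gamma z u) * - 1 + dk u z * - slice I (cconj h)).
  exact: qmeasD (qmeasD m1 m3) m2.
by apply/funext => z; rewrite /rem !mulrN mulr1.
Qed.

(** By [rem_le], [qmod_kexp] and [gauss_rho], the weighted squared modulus of the remainder is at
    most |h|^4 times a translated Gaussian, up to a constant depending on u only. *)
Lemma sqnorm_rem_le u : exists2 M : R, 0 <= M & forall h, qmod (slice I h) <= 1 ->
  (N (rem u h) <= (M * (qmod (slice I h) ^+ 2) ^+ 2)%:E)%E.
Proof.
pose A := (4 + g2) ^+ 2 * expR (4 * g2 * u.2 ^+ 2) * expR (g2 * (20 + 16 * `|u.2|)).
have A0 : 0 <= A by do 2?[apply: mulr_ge0]; rewrite ?expR_ge0 ?sqr_ge0.
exists (A * (pi / g2)); first by rewrite mulr_ge0// divr_ge0 ?pi_ge0// (ltW g2_gt0).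
move=> h m1; set m := qmod (slice I h).
have B0 : 0 <= A * (m ^+ 2) ^+ 2 by rewrite mulr_ge0// sqr_ge0.
have mg : measurable_fun [set: mR * mR] (fun z : mR * mR => (gaussian g2 (z - u))%:E).
  apply/measurable_EFinP.
  exact: (measurableT_comp (measurable_gaussian _) (plane_preserving_shift (- u)).1).
apply: (@le_trans _ _ (\int[plane]_z ((A * (m ^+ 2) ^+ 2)%:E *
    (gaussian g2 (z - u)%R)%:E))%E).
  apply: ge0_le_integral => //.
  - by move=> z _; rewrite lee_fin mulr_ge0 ?wt_ge0// exprn_ge0 ?qmod_ge0.
  - apply/measurable_EFinP; apply: measurable_funM; last exact: mW.
    by apply: measurable_qmod_sqr; exact: qmeas_rem.
  - exact: measurable_funeM.
  - move=> z _; rewrite -EFinM lee_fin.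
    have h1 := rem_le u z m1; set kz := qmod (slice I (kexp gamma z u)) in h1.
    set rho := qmod (slice I (z - cconj u)) in h1.
    have h2 : qmod (rem u h z) ^+ 2 <= (kz * (m ^+ 2 * ((4 + g2) *
        expR (2 * (g2 * (2 * rho + 1)))))) ^+ 2.
      rewrite lerXn2r ?nnegrE ?qmod_ge0// mulr_ge0 ?qmod_ge0//.
      by rewrite mulr_ge0 ?sqr_ge0// mulr_ge0 ?expR_ge0// addr_ge0// ltW.
    apply: le_trans (ler_wpM2r (wt_ge0 _ _) h2) _.
    have -> : (kz * (m ^+ 2 * ((4 + g2) * expR (2 * (g2 * (2 * rho + 1)))))) ^+ 2
        * wt gamma z = ((m ^+ 2) ^+ 2 * (4 + g2) ^+ 2) *
        (expR (4 * (g2 * (2 * rho + 1))) * (kz ^+ 2 * wt gamma z)).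
      have -> : expR (4 * (g2 * (2 * rho + 1))) = expR (2 * (g2 * (2 * rho + 1))) ^+ 2.
        by rewrite [RHS]expr2 -expRD; congr expR; ring.
      ring.
    rewrite /kz qmod_kexp//.
    have B : 0 <= (m ^+ 2) ^+ 2 * (4 + g2) ^+ 2 * expR (4 * g2 * u.2 ^+ 2).
      by apply: mulr_ge0; [apply: mulr_ge0; exact: sqr_ge0|exact: expR_ge0].
    apply: le_trans (le_trans _ (ler_wpM2l B (gauss_rho u z))) _.
      by rewrite -/rho le_eqVlt; apply/orP; left; apply/eqP; ring.
    by rewrite /A le_eqVlt; apply/orP; left; apply/eqP; ring.
rewrite ge0_integralZl//; last first.
  by move=> z _; rewrite lee_fin gaussian_ge0.
rewrite (ge0_integral_preserving (plane_preserving_shift (- u)).1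
  (plane_preserving_shift (- u)).2 (f := fun z => (gaussian g2 z)%:E)); last 2 first.
- by apply/measurable_EFinP; exact: measurable_gaussian.
- by move=> z; rewrite lee_fin gaussian_ge0.
by rewrite integral_gaussian// -EFinM lee_fin mulrAC.
Qed.

Lemma qmod_slice_le h : qmod (slice I h) <= 2 * `|h|.
Proof.
have h1 : `|h.1| <= `|h| by rewrite [leRHS]/Num.norm/= le_max lexx.
have h2 : `|h.2| <= `|h| by rewrite [leRHS]/Num.norm/= le_max lexx orbT.
apply: le_trans (ler_qmodD _ _) _; rewrite !qmodZ qmod1 qmod_imag_unit// !mulr1.
by rewrite mulr_natl mulr2n lerD.
Qed.

Lemma quadratic_is_diff F u (D : quat R) (B : R) :
  (forall h, qmod (slice I h) <= 1 ->
    qmod (F (u + h) - F u - slice I h * D) <= B * qmod (slice I h) ^+ 2) ->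
  is_diff u F (fun v => slice I v * D).
Proof.
move=> FB.
have lin : linear (fun v : R * R => slice I v * D).
  by move=> a v w; rewrite sliceD sliceZ mulrDl scalerAl.
pose DL : {linear (R * R)%type -> quat R} := HB.pack (fun v : R * R => slice I v * D)
  (GRing.isLinear.Build _ _ _ _ (fun v : R * R => slice I v * D) lin).
have cD : continuous DL.
  apply: (@linear_le_continuous _ _ _ DL (2 * qmod D)) => v.
  apply: le_trans (ler_norm_qmod _) _; rewrite qmodM mulrAC.
  by rewrite ler_wpM2r ?qmod_ge0// qmod_slice_le.
apply: (eps_is_diff cD) => e e0.
have B0 : 0 < 4 * `|B| + 1 by rewrite ltr_wpDl// mulr_ge0.
(* The radius 1/2 gives |slice I h| <= 1, the modulus being at most twice the sup norm; the other
   radius makes 4 |B| |h|^2 at most e |h|. *)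
exists (Num.min 2^-1 (e / (4 * `|B| + 1))).
  by rewrite lt_min invr_gt0 ltr0n/= divr_gt0.
move=> h; rewrite lt_min => /andP[h1 h2].
have m1 := qmod_slice_le h.
apply: le_trans (ler_norm_qmod _) _; apply: le_trans (FB h _) _.
  by apply: le_trans m1 _; rewrite mulrC -ler_pdivlMr// div1r ltW.
apply: (@le_trans _ _ (`|B| * (2 * `|h|) ^+ 2)).
  apply: (@le_trans _ _ (`|B| * qmod (slice I h) ^+ 2)).
    by rewrite ler_wpM2r ?exprn_ge0 ?qmod_ge0// ler_norm.
  by rewrite ler_wpM2l// lerXn2r ?nnegrE ?qmod_ge0// mulr_ge0.
have -> : `|B| * (2 * `|h|) ^+ 2 = 4 * `|B| * `|h| * `|h| by ring.
rewrite ler_wpM2r//; move: h2; rewrite ltr_pdivlMr// => /ltW; apply: le_trans.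
by rewrite mulrDr mulr1 mulrC lerDl.
Qed.

(** By the reproducing formula, the Taylor remainder of F, with [D0] as derivative, is the pairing
    of [rem u h] with F up to the normalizing constant. The pairing conjugates its first argument,
    so the conjugate of h at the right of [rem] comes out as h on the left. *)
Lemma taylor_bound u : exists2 C : R, 0 <= C & forall F e h, holo I F ->
  0 < e -> (N F <= (e ^+ 2)%:E)%E -> qmod (slice I h) <= 1 ->
  qmod (F (u + h) - F u - slice I h * 'D_(1, 0) F u) <=
    C * e * qmod (slice I h) ^+ 2.
Proof.
have [M M0 hM] := sqnorm_rem_le u.
exists (c * (M + 1)); first by rewrite mulr_ge0 ?addr_ge0// ltW.
move=> F e h hF e0 Fe h1.
have F_fin : (N F < +oo)%E by rewrite (le_lt_trans Fe)// ltry.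
have mF := holo_qmeas hF.
have mk v : qmeas (k v) := @qmeas_kexp R gamma I v hI.
have k_fin v := sqnorm_kexp_fin gamma_gt0 v hI.
have rem_fin v : qmod (slice I v) <= 1 -> (N (rem u v) < +oo)%E.
  by move=> /hM /le_lt_trans; apply; rewrite ltry.
(* [dk u] equals [k (u + 1) - k u - rem u 1], and all three terms have finite norm. *)
have dk_fin : (N (dk u) < +oo)%E.
  have m1 : qmod (slice I (1, 0)) <= 1 by rewrite slice10 qmod1.
  have -> : dk u = (fun z => (slice I (kexp gamma z (u + (1, 0))) +
      slice I (kexp gamma z u) * - 1) + rem u (1, 0) z * - 1).
    apply/funext => z; rewrite /rem /cconj/= oppr0 slice10 !mulr1 !mulrN1.
    by rewrite opprB addrCA subrr addr0.
  have mN X : qmeas X -> qmeas (fun z => X z * - 1).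
    by move=> mX; apply: qmeasM => //; exact: qmeas_cst.
  have fN X : qmeas X -> (N X < +oo)%E -> (N (fun z => (X z * - 1)%R) < +oo)%E.
    by move=> mX X_fin; rewrite (sqnormMr plane mW W_ge0)// qmodN qmod1 expr1n mul1e.
  have fD X Y : qmeas X -> qmeas Y -> (N X < +oo)%E -> (N Y < +oo)%E ->
      (N (fun z => (X z + Y z)%R) < +oo)%E.
    move=> mX mY X_fin Y_fin.
    apply: le_lt_trans (sqnormD_le _ mW W_ge0 mX mY) _.
    by rewrite lte_add_pinfty// lte_mul_pinfty// ?lee_fin.
  apply: (fD); [apply: qmeasD => //; exact: mN|apply: (mN); exact: qmeas_rem| |].
    by apply: (fD) => //; [exact: mN|exact: fN].
  by apply: (fN); [exact: qmeas_rem|exact: rem_fin].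
have pI X := @pairing_integrable _ _ R plane W mW W_ge0 X F.
pose D0 := c *: qint plane (ip (dk u) F).
have key v : qmod (slice I v) <= 1 ->
    F (u + v) - F u - slice I v * D0 = c *: qint plane (ip (rem u v) F).
  move=> v1.
  have alg (x y d s f w : quat R) : qconj (x - y - d * s) * f * w =
      qconj x * f * w + - 1 * (qconj y * f * w) + - qconj s * (qconj d * f * w).
    by rewrite !qconjD !qconjN qconjM !mulrDl !mulNr mul1r !mulrA.
  have cs : qconj (slice I (cconj v)) = slice I v.
    by rewrite qconj_slice//= opprK -surjective_pairing.
  have -> : ip (rem u v) F = (fun z => (ip (k (u + v)) F z + - 1 * ip (k u) F z) +
      - slice I v * ip (dk u) F z).
    by apply/funext => z; rewrite /pairing /rem alg cs.
  have i1 := pI _ (mk (u + v)) mF (k_fin _) F_fin.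
  have i2 := pI _ (mk u) mF (k_fin _) F_fin.
  have i3 := pI _ (@qmeas_dk u) mF dk_fin F_fin.
  have [j2 e2] := qint_mull (- 1) i2; have [j3 e3] := qint_mull (- slice I v) i3.
  have [j12 e12] := qintD i1 j2; have [_ ->] := qintD j12 j3.
  have alg' (t : R) (a x y z : quat R) :
      t *: (x + - 1 * y + - a * z) = t *: x - t *: y - a * (t *: z).
    by rewrite !scalerDr mulN1r mulNr !scalerN scalerAr.
  rewrite e12 e2 e3 alg'; congr (_ - _ - _); apply: esym.
    exact: reproducing_slice.
  exact: reproducing_slice.
have main v : qmod (slice I v) <= 1 ->
    qmod (F (u + v) - F u - slice I v * D0) <=
    c * (M + 1) * e * qmod (slice I v) ^+ 2.
  (* [pairing_sqr_le] wants a positive m, so the trivial increment is treated apart. *)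
  move=> v1; have := qmod_ge0 (slice I v); rewrite le_eqVlt => /orP[/eqP v0|v0].
    have sv0 : slice I v = 0 by apply: qmod_eq0.
    have v00 : v = 0.
      have := qmod_slice v hI; rewrite -v0 expr0n/= => /esym/eqP.
      rewrite paddr_eq0 ?sqr_ge0// !sqrf_eq0 => /andP[/eqP a0 /eqP b0].
      by rewrite (surjective_pairing v) a0 b0.
    by rewrite v00 addr0 subrr slice0 mul0r subr0 qmod0 expr0n mulr0.
  rewrite key// qmodZ gtr0_norm// -2!(mulrA c) (ler_wpM2l (ltW c_gt0))//.
  by apply: pairing_sqr_le => //; [exact: exprn_gt0|exact: hM].
(* The quadratic bound itself identifies [D0] as the derivative of F at u. *)
suff -> : 'D_(1, 0) F u = D0 by exact: main.
by rewrite (is_diff_derive _ (quadratic_is_diff main)) slice10 mul1r.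
Qed.

End kernel_bounds.

(** * Limits of quaternion sequences and Fatou's lemma *)

Section limits.
Variable R : realType.

Lemma cvg_quat_cauchy (u : nat -> quat R) :
  (forall e : R, 0 < e -> exists n0 : nat, forall m n, (n0 <= m)%N -> (n0 <= n)%N ->
    qmod (u m - u n) < e) -> cvgn u.
Proof.
move=> hu; apply/cauchy_cvgP/cauchy_exP => e e0; have [n0 h] := hu e e0.
exists (u n0), n0 => // n /= n0n; rewrite -ball_normE/=.
by apply: le_lt_trans (ler_norm_qmod _) _; exact: h.
Qed.

Lemma cvg_qmod_sqr (u : nat -> quat R) l : u @ \oo --> l ->
  (fun n => qmod (u n) ^+ 2) @ \oo --> qmod l ^+ 2.
Proof.
move=> ul.
have cj (j : 'I_4) : (fun n => u n 0 j) @ \oo --> l 0 j.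
  have cf : {for l, continuous (fun q : quat R => q 0 j)}.
    by apply: differentiable_continuous; exact: differentiable_coord.
  exact: cvg_comp ul cf.
have -> : (fun n => qmod (u n) ^+ 2) = (fun n => u n 0 0 * u n 0 0 +
    u n 0 1 * u n 0 1 + u n 0 2 * u n 0 2 + u n 0 3 * u n 0 3).
  by apply/funext => n; rewrite qmod_sqr !expr2.
rewrite qmod_sqr !expr2.
by apply: cvgD; [apply: cvgD; [apply: cvgD|]|]; apply: cvgM; exact: cj.
Qed.

Context d (T : measurableType d) (mu : {measure set T -> \bar R}) (w : T -> R).
Hypotheses (mw : measurable_fun setT w) (w0 : forall z, 0 <= w z).

Lemma sqnorm_fatou (G : nat -> T -> quat R) (F : T -> quat R) (b : \bar R) :
  (forall n, qmeas (G n)) -> (forall z, (fun n => G n z) @ \oo --> F z) ->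
  (forall n, (sqnorm mu w (G n) <= b)%E) -> (sqnorm mu w F <= b)%E.
Proof.
move=> mG GF Gb.
have h0 n z : (0 <= (qmod (G n z) ^+ 2 * w z)%:E)%E.
  by rewrite lee_fin mulr_ge0// exprn_ge0 ?qmod_ge0.
have mh n : measurable_fun setT (fun z => (qmod (G n z) ^+ 2 * w z)%:E).
  by apply/measurable_EFinP/measurable_funM => //; exact: measurable_qmod_sqr.
have := fatou mu measurableT mh (fun n z _ => h0 n z).
have -> : (\int[mu]_z limn_einf (fun n => (qmod (G n z) ^+ 2 * w z)%:E) =
    sqnorm mu w F)%E.
  apply: eq_integral => z _; apply: (cvg_limn_einf_sup _).1.
  apply: cvg_EFin; first exact: nearW.
  by apply: cvgM; [exact: cvg_qmod_sqr|exact: cvg_cst].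
move=> /le_trans; apply; rewrite limn_einf_lim.
apply: lime_le; first exact: is_cvg_einfs.
apply: nearW => n; apply: le_trans (Gb n).
by apply: ereal_inf_lbound; exists n => //=.
Qed.

End limits.

(** * Inner product, kernel and definiteness of the norm *)

Section rbf_hilbert_space.
Variables (R : realType) (gamma : R).
Hypothesis gamma_gt0 : 0 < gamma.
Variable I : quat R.
Hypothesis hI : imag_units I.
Implicit Types (f g h : quat R -> quat R) (z : R * R) (p q a : quat R).

Local Notation mR := (measurableTypeR R).
Local Notation plane := (@plane_measure R).
Local Notation W := (wt gamma : mR * mR -> R).
Local Notation N F := (@sqnorm _ (mR * mR)%type R plane W F).
Local Notation ip X F := (@pairing _ (mR * mR)%type R W X F).
Local Notation qmeas F := (@qmeas _ (mR * mR)%type R F).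
Local Notation c := (2 / (pi * gamma ^+ 2)).
Local Notation K := (rbf_kernel gamma).
Local Notation V := (rbf_space gamma I).

Let c_gt0 : 0 < c.
Proof. by rewrite divr_gt0// mulr_gt0 ?pi_gt0// exprn_gt0. Qed.

Let W_ge0 z : 0 <= W z. Proof. exact: wt_ge0. Qed.

Let mW : measurable_fun setT W. Proof. exact: measurable_wt. Qed.

Lemma rbf_spaceP f : V f <-> [/\ holo I (f \o slice I),
  (N (f \o slice I) < +oo)%E & forall J z, imag_units J ->
    f (slice J z) = rep_coef J I * f (slice I z) +
      rep_coefc J I * f (slice I (cconj z))].
Proof.
split.
  by move=> [/(slice_hyperholomorphicP _ hI)[hf rep] /(rbf_sqnorm_fin gamma_gt0 _ hI)].
move=> [hf f_fin rep]; split; first exact/(slice_hyperholomorphicP _ hI).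
exact/(rbf_sqnorm_fin gamma_gt0 _ hI).
Qed.

Lemma rbf_space_qmeas f : V f -> qmeas (f \o slice I).
Proof. by move=> /rbf_spaceP[hf _ _]; exact: holo_qmeas hf. Qed.

Lemma rbf_space_fin f : V f -> (N (f \o slice I) < +oo)%E.
Proof. by case/rbf_spaceP. Qed.

Lemma rbf_space_add f g : V f -> V g -> V (fun x => f x + g x).
Proof.
move=> Vf Vg; have mf := rbf_space_qmeas Vf; have mg := rbf_space_qmeas Vg.
have [hf f_fin rf] := (rbf_spaceP f).1 Vf.
have [hg g_fin rg] := (rbf_spaceP g).1 Vg.
apply/rbf_spaceP; split; first exact: holoD hf hg.
  apply: le_lt_trans (sqnormD_le plane mW W_ge0 mf mg) _.
  by rewrite lte_add_pinfty// lte_mul_pinfty// ?lee_fin.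
by move=> J z hJ; rewrite rf// rg// !mulrDr addrACA.
Qed.

Lemma rbf_space_scale f a : V f -> V (fun x => f x * a).
Proof.
move=> Vf; have mf := rbf_space_qmeas Vf.
have [hf f_fin rf] := (rbf_spaceP f).1 Vf.
apply/rbf_spaceP; split; first exact: holoMr hf.
  by rewrite (sqnormMr plane mW W_ge0)// lte_mul_pinfty// lee_fin exprn_ge0 ?qmod_ge0.
by move=> J z hJ; rewrite rf// mulrDl !mulrA.
Qed.

Lemma rbf_space_sub f g : V f -> V g -> V (fun x => f x - g x).
Proof.
move=> Vf Vg; rewrite (_ : (fun x => _) = fun x => f x + g x * - 1).
  by apply: rbf_space_add => //; exact: rbf_space_scale.
by apply/funext => x; rewrite mulrN1.
Qed.

Lemma rbf_space_zero : V (fun=> 0).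
Proof.
apply/rbf_spaceP; split; first exact: holo_cst.
  rewrite /sqnorm integral0_eq ?ltry// => z _.
  by rewrite qmod0 expr0n mul0r.
by move=> J z hJ; rewrite !mulr0 addr0.
Qed.

(** The point p may lie on another slice J; on slice I the kernel at p is then a combination of the
    kernels at v and at its conjugate, with constant right coefficients. *)
Lemma rbf_space_kernel p : V (K ^~ p).
Proof.
have [J hJ [v ->]] := exists_slice p.
have [hK rK] := (slice_hyperholomorphicP _ hI).1
  (slice_hyperholomorphic_kernel gamma (slice J v)).
apply/rbf_spaceP; split => //.
have m u : qmeas (fun z => slice I (kexp gamma z u)) by exact: qmeas_kexp.
have mM X a : qmeas X -> qmeas (fun z => X z * a).
  by move=> mX; apply: qmeasM => //; exact: qmeas_cst.
have -> : (K ^~ (slice J v)) \o slice I = (fun z =>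
    slice I (kexp gamma z v) * rep_coef I J +
    slice I (kexp gamma z (cconj v)) * rep_coefc I J).
  by apply/funext => z /=; rewrite (rbf_kernel_repr _ _ _ hI hJ) !rbf_kernel_slice.
apply: le_lt_trans (sqnormD_le plane mW W_ge0 (mM _ _ (m _)) (mM _ _ (m _))) _.
rewrite !(sqnormMr plane mW W_ge0)//.
by rewrite lte_add_pinfty// lte_mul_pinfty// ?lee_fin// lte_mul_pinfty//
  ?lee_fin ?exprn_ge0 ?qmod_ge0// sqnorm_kexp_fin.
Qed.

Lemma rbf_pairing_integrable f g : V f -> V g ->
  qintble plane (ip (g \o slice I) (f \o slice I)).
Proof.
move=> Vf Vg; apply: (pairing_integrable mW W_ge0); do ?exact: rbf_space_qmeas.
  exact: rbf_space_fin.
exact: rbf_space_fin.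
Qed.

Lemma qconj_rep_coef (J J' : quat R) : imag_units J -> imag_units J' ->
  qconj (rep_coef J J') = rep_coef J' J.
Proof.
move=> hJ hJ'; rewrite /rep_coef qconjZ qconjD qconjN qconjM qconj1.
by rewrite !imag_unit_conj// mulrNN.
Qed.

Lemma qconj_rep_coefc (J J' : quat R) : imag_units J -> imag_units J' ->
  qconj (rep_coefc J J') = rep_coefc J' J.
Proof.
move=> hJ hJ'; rewrite /rep_coefc qconjZ qconjD qconjM qconj1.
by rewrite !imag_unit_conj// mulrNN.
Qed.

(** Conjugation in the pairing moves the right coefficients of [rbf_kernel_repr] to the left and
    exchanges I and J in them; they become those of the representation formula for f at p. *)
Lemma rbf_reproducing f p : V f -> f p = rbf_inner gamma I f (K ^~ p).
Proof.
move=> Vf; have [hf f_fin rf] := (rbf_spaceP f).1 Vf.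
have [J hJ [v ->]] := exists_slice p.
rewrite rbf_innerE//; set F := f \o slice I.
pose k u z := slice I (kexp gamma z u).
have -> : ip ((K ^~ (slice J v)) \o slice I) F = (fun z =>
    rep_coef J I * ip (k v) F z + rep_coefc J I * ip (k (cconj v)) F z).
  apply/funext => z; rewrite /pairing/= (rbf_kernel_repr _ _ _ hI hJ).
  rewrite !rbf_kernel_slice// qconjD !qconjM qconj_rep_coef// qconj_rep_coefc//.
  by rewrite !mulrDl !mulrA.
have mF := rbf_space_qmeas Vf.
have ki u : qintble plane (ip (k u) F).
  apply: (pairing_integrable mW W_ge0) => //; [exact: qmeas_kexp|].
  exact: sqnorm_kexp_fin.
have [i1 e1] := qint_mull (rep_coef J I) (ki v).
have [i2 e2] := qint_mull (rep_coefc J I) (ki (cconj v)).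
have [_ ->] := qintD i1 i2.
have alg (t : R) (a1 a2 x1 x2 : quat R) :
    t *: (a1 * x1 + a2 * x2) = a1 * (t *: x1) + a2 * (t *: x2).
  by rewrite scalerDr !scalerAr.
have r u : c *: qint plane (ip (k u) F) = F u.
  exact: reproducing_slice.
rewrite e1 e2 alg rf//.
by congr (_ * _ + _ * _); apply: esym; exact: r.
Qed.

Lemma rbf_inner_add f g h : V f -> V g -> V h ->
  rbf_inner gamma I (fun x => f x + g x) h =
  rbf_inner gamma I f h + rbf_inner gamma I g h.
Proof.
move=> Vf Vg Vh; rewrite !rbf_innerE// -scalerDr; congr (_ *: _).
have [_ <-] := qintD (rbf_pairing_integrable Vf Vh) (rbf_pairing_integrable Vg Vh).
by congr (qint _ _); apply/funext => z; rewrite /pairing/= mulrDr mulrDl.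
Qed.

Lemma rbf_inner_scale f g a : V f -> V g ->
  rbf_inner gamma I (fun x => f x * a) g = rbf_inner gamma I f g * a.
Proof.
move=> Vf Vg; rewrite !rbf_innerE// -scalerAl; congr (_ *: _).
have [_ <-] := qint_mulr a (rbf_pairing_integrable Vf Vg).
congr (qint _ _); apply/funext => z; rewrite /pairing/=.
by rewrite -!scalerAr !mulr1 -scalerAl mulrA.
Qed.

Lemma rbf_inner_conj f g : V f -> V g ->
  rbf_inner gamma I g f = qconj (rbf_inner gamma I f g).
Proof.
move=> Vf Vg; rewrite !rbf_innerE// qconjZ; congr (_ *: _).
rewrite -(qint_conj (rbf_pairing_integrable Vf Vg)); congr (qint _ _).
apply/funext => z; rewrite /pairing/= !qconjM qconjK qconjZ qconj1.
by rewrite -scalerAr mulr1 -scalerAl mul1r.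
Qed.

Lemma rbf_norm_sqr f : V f -> rbf_norm gamma I f ^+ 2 = c * fine (N (f \o slice I)).
Proof.
move=> Vf; rewrite /rbf_norm rbf_sqnormE// (sqnorm_fine (rbf_space_fin Vf)) /=.
by rewrite sqr_sqrtr// mulr_ge0 ?(ltW c_gt0)// fine_ge0// sqnorm_ge0.
Qed.

Lemma rbf_inner_norm f : V f ->
  rbf_inner gamma I f f = (rbf_norm gamma I f ^+ 2)%:A.
Proof.
move=> Vf; rewrite rbf_norm_sqr// rbf_innerE// -[RHS]scalerA; congr (_ *: _).
have pE z : ip (f \o slice I) (f \o slice I) z =
    (qmod (f (slice I z)) ^+ 2 * wt gamma z)%:A.
  by rewrite /pairing mul_qconj -scalerAr -scalerAl mulr1 scalerA mulrC.
have i0 (u : mR * mR -> R) : (forall z, u z = 0) -> \int[plane]_z u z = 0.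
  by move=> h; rewrite /Rintegral integral0_eq// => z _; rewrite h.
apply: quatP; rewrite /qint !quatX.
- rewrite mulr1; apply: eq_Rintegral => z _.
  by rewrite pE !quatX mulr1.
- by rewrite mulr0; apply: i0 => z; rewrite pE !quatX mulr0.
- by rewrite mulr0; apply: i0 => z; rewrite pE !quatX mulr0.
- by rewrite mulr0; apply: i0 => z; rewrite pE !quatX mulr0.
Qed.

Lemma rbf_norm_le f (e : R) : V f -> 0 <= e -> (N (f \o slice I) <= (e ^+ 2)%:E)%E ->
  rbf_norm gamma I f <= Num.sqrt c * e.
Proof.
move=> Vf e0 fe; have n0 : rbf_norm gamma I f \is Num.nneg by rewrite nnegrE sqrtr_ge0.
have s0 : Num.sqrt c * e \is Num.nneg by rewrite nnegrE mulr_ge0// sqrtr_ge0.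
rewrite -(ler_pXn2r (ltn0Sn 1) n0 s0) rbf_norm_sqr// exprMn.
rewrite sqr_sqrtr ?(ltW c_gt0)// (ler_wpM2l (ltW c_gt0))//.
by rewrite -lee_fin -sqnorm_fine// rbf_space_fin.
Qed.

Lemma rbf_norm_lt f (e : R) : V f -> 0 < e -> rbf_norm gamma I f < Num.sqrt c * e ->
  (N (f \o slice I) <= (e ^+ 2)%:E)%E.
Proof.
move=> Vf e0; have n0 : rbf_norm gamma I f \is Num.nneg by rewrite nnegrE sqrtr_ge0.
have s0 : Num.sqrt c * e \is Num.nneg.
  by rewrite nnegrE mulr_ge0 ?(ltW e0)// sqrtr_ge0.
rewrite -(ltr_pXn2r (ltn0Sn 1) n0 s0) rbf_norm_sqr// exprMn.
rewrite sqr_sqrtr ?(ltW c_gt0)// ltr_pM2l// => h.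
by rewrite (sqnorm_fine (rbf_space_fin Vf)) lee_fin ltW.
Qed.

(** Point evaluations are bounded by the norm, so f vanishes at every point of slice I and not just
    almost everywhere; the representation formula does the rest. *)
Lemma rbf_norm_eq0 f : V f -> rbf_norm gamma I f = 0 -> f = (fun=> 0).
Proof.
move=> Vf f0; have [hf f_fin rf] := (rbf_spaceP f).1 Vf.
have fz z : f (slice I z) = 0.
  apply: qmod_eq0; apply/eqP; rewrite eq_le qmod_ge0 andbT.
  apply/ler_addgt0Pr => e e0; rewrite add0r.
  have [C C0 hC] := reproducing_bound gamma_gt0 hI z.
  have e'0 : 0 < e / (C + 1) by rewrite divr_gt0// ltr_wpDl.
  apply: le_trans (hC _ (e / (C + 1)) hf e'0 _) _.
    by apply: rbf_norm_lt; rewrite // f0 mulr_gt0// sqrtr_gt0.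
  by rewrite mulrA ler_pdivrMr ?ltr_wpDl// mulrC ler_wpM2l ?(ltW e0)// lerDl.
apply/funext => q; have [J hJ [z ->]] := exists_slice q.
by rewrite rf// !fz !mulr0 addr0.
Qed.

End rbf_hilbert_space.

(** * Completeness *)

Section rbf_completeness.
Variables (R : realType) (gamma : R).
Hypothesis gamma_gt0 : 0 < gamma.
Variable I : quat R.
Hypothesis hI : imag_units I.
Implicit Types (f g h : quat R -> quat R) (z : R * R).

Local Notation mR := (measurableTypeR R).
Local Notation plane := (@plane_measure R).
Local Notation W := (wt gamma : mR * mR -> R).
Local Notation N F := (@sqnorm _ (mR * mR)%type R plane W F).
Local Notation qmeas F := (@qmeas _ (mR * mR)%type R F).
Local Notation c := (2 / (pi * gamma ^+ 2)).
Local Notation V := (rbf_space gamma I).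

Lemma holo_limit (F : nat -> R * R -> quat R) (G : R * R -> quat R) (e : R) :
  0 < e -> (forall n, holo I (F n)) -> (forall n, N (F n) <= (e ^+ 2)%:E)%E ->
  (forall z, (fun n => F n z) @ \oo --> G z) ->
  (forall z, cvgn (fun n => 'D_(1, 0) (F n) z)) -> holo I G.
Proof.
move=> e0 hF Fe FG DF; apply: (is_diff_holo hI) => z.
have [C C0 hC] := taylor_bound gamma_gt0 hI z.
exists (limn (fun n => 'D_(1, 0) (F n) z)).
apply: (quadratic_is_diff hI (B := C * e)) => h h1.
pose r n := F n (z + h) - F n z - slice I h * 'D_(1, 0) (F n) z.
apply: (@qmod_cvg_le _ r); last by move=> n; exact: hC.
apply: cvgB; first exact: cvgB.
exact: (@cvg_qmull _ _ _ _ (DF z)).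
Qed.

Lemma rbf_cauchy_sqnorm (u : nat -> quat R -> quat R) : (forall n, V (u n)) ->
  (forall e : R, 0 < e -> exists n0 : nat, forall m n, (n0 <= m)%N -> (n0 <= n)%N ->
    rbf_norm gamma I (fun x => u m x - u n x) < e) ->
  forall e : R, 0 < e -> exists n0 : nat, forall m n, (n0 <= m)%N -> (n0 <= n)%N ->
    (N (fun z => u m (slice I z) - u n (slice I z))%R <= (e ^+ 2)%:E)%E.
Proof.
move=> Vu cu e e0.
have c0 : 0 < c by rewrite divr_gt0// mulr_gt0 ?pi_gt0// exprn_gt0.
have [|n0 hn0] := cu (Num.sqrt c * e); first by rewrite mulr_gt0// sqrtr_gt0.
exists n0 => m n n0m n0n.
by apply: (rbf_norm_lt gamma_gt0 hI (rbf_space_sub gamma_gt0 hI (Vu m) (Vu n)) e0);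
  exact: hn0.
Qed.

Lemma rbf_complete (u : nat -> quat R -> quat R) : (forall n, V (u n)) ->
  (forall e : R, 0 < e -> exists n0 : nat, forall m n, (n0 <= m)%N -> (n0 <= n)%N ->
    rbf_norm gamma I (fun x => u m x - u n x) < e) ->
  exists2 f, V f & (rbf_norm gamma I (fun x => u n x - f x) @[n --> \oo] --> (0 : R)).
Proof.
move=> Vu cu; have dN := rbf_cauchy_sqnorm Vu cu.
pose F n z := u n (slice I z).
have hF n : holo I (F n) by have [] := (rbf_spaceP gamma_gt0 hI _).1 (Vu n).
have mF n : qmeas (F n) by exact: holo_qmeas (hF n).
have hB m n : holo I (fun z => F m z - F n z).
  by have [] := (rbf_spaceP gamma_gt0 hI _).1 (rbf_space_sub gamma_gt0 hI (Vu m) (Vu n)).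
have small (C e : R) : 0 <= C -> 0 < e -> exists2 d, 0 < d & C * d < e.
  move=> C0 e0; exists (e / (C + 1)); first by rewrite divr_gt0// ltr_wpDl.
  by rewrite mulrA ltr_pdivrMr ?ltr_wpDl// mulrC ltr_pM2l// ltrDl.
have cF z : cvgn (fun n => F n z).
  apply: cvg_quat_cauchy => e e0.
  have [C C0 hC] := reproducing_bound gamma_gt0 hI z.
  have [d d0 Cd] := small C e C0 e0; have [n0 hn0] := dN d d0.
  exists n0 => m n n0m n0n; apply: le_lt_trans Cd.
  exact: (hC _ _ (hB m n) d0 (hn0 m n n0m n0n)).
(* By the Taylor bound with h = 1, the derivative at z is the difference of the values at z + 1 and
   z, up to a remainder at most T d. *)
have cDF z : cvgn (fun n => 'D_(1, 0) (F n) z).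
  apply: cvg_quat_cauchy => e e0.
  have [C C0 hC] := reproducing_bound gamma_gt0 hI z.
  have [C' C'0 hC'] := reproducing_bound gamma_gt0 hI (z + (1, 0)).
  have [T T0 hT] := taylor_bound gamma_gt0 hI z.
  have [d d0 Cd] := small (C + C' + T) e (addr_ge0 (addr_ge0 C0 C'0) T0) e0.
  have [n0 hn0] := dN d d0.
  exists n0 => m n n0m n0n; apply: le_lt_trans Cd.
  have s1 : slice I (1, 0) = 1 by rewrite /slice/= scale1r scale0r addr0.
  have b1 := hC _ _ (hB m n) d0 (hn0 m n n0m n0n).
  have b2 := hC' _ _ (hB m n) d0 (hn0 m n n0m n0n).
  have := hT _ _ (1, 0) (hB m n) d0 (hn0 m n n0m n0n).
  rewrite s1 qmod1 expr1n mulr1 mul1r => /(_ (lexx _)) b3.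
  have -> : 'D_(1, 0) (F m) z - 'D_(1, 0) (F n) z =
      'D_(1, 0) (fun z => F m z - F n z) z.
    by rewrite (deriveB (f := F m) (g := F n))//; apply: diff_derivable;
      [exact: (hF m z).1|exact: (hF n z).1].
  set D := 'D_(1, 0) _ z in b3 *.
  set x := F m (z + (1, 0)) - _ in b2 b3; set y := F m z - _ in b1 b3.
  have alg (a b t : quat R) : t = a + (- b + - (a - b - t)).
    by rewrite !opprB [t + _]addrC -[b - a + t]addrA addKr addrA subrr add0r.
  clearbody x y D; rewrite (alg x y D).
  apply: le_trans (ler_qmodD _ _) _.
  rewrite !mulrDl [C * d + _]addrC -[leRHS]addrA lerD//.
  by apply: le_trans (ler_qmodD _ _) _; rewrite !qmodN lerD.
(* The limit is taken at every point of H; off slice I, convergence comes from the representation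
   formula. *)
pose f q := limn (fun n => u n q).
have ulim z : (fun n => F n z) @ \oo --> f (slice I z) by exact: cF.
have rf J z : imag_units J -> f (slice J z) =
    rep_coef J I * f (slice I z) + rep_coefc J I * f (slice I (cconj z)).
  move=> hJ; apply: limn_unique.
  have -> : (fun n => u n (slice J z)) = (fun n =>
      rep_coef J I * F n z + rep_coefc J I * F n (cconj z)).
    apply/funext => n; have [_ _ r] := (rbf_spaceP gamma_gt0 hI _).1 (Vu n).
    exact: r.
  apply: cvgD; first exact: (@cvg_qmull _ _ _ _ (ulim z)).
  exact: (@cvg_qmull _ _ _ _ (ulim (cconj z))).
have mB m n : qmeas (fun z => F m z - F n z) by exact: holo_qmeas (hB m n).
have W_ge0 z : 0 <= W z by exact: wt_ge0.
have mW := measurable_wt gamma.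
have hf : holo I (f \o slice I).
  have [n0 hn0] := dN 1 ltr01.
  have Nn0 := rbf_space_fin gamma_gt0 hI (Vu n0).
  have fin0 : 0 <= fine (N (F n0)) by rewrite fine_ge0// sqnorm_ge0.
  have Nn0E := sqnorm_fine Nn0.
  (* [holo_limit] takes its bound in the form of a square. The tail has square norm at most 2 + 2 x,
     with x that of [F n0], and 3 + 2 x has a larger square. *)
  have sq (x : R) : 0 <= x -> 2 * 1 + 2 * x <= (3 + 2 * x) ^+ 2.
    by move=> x0; rewrite expr2; nra.
  have bound n : (N (F (n + n0)%N) <= ((3 + 2 * fine (N (F n0))) ^+ 2)%:E)%E.
    have -> : F (n + n0)%N = (fun z => (F (n + n0)%N z - F n0 z) + F n0 z).
      by apply/funext => z; rewrite subrK.
    apply: le_trans (sqnormD_le plane mW W_ge0 (mB _ _) (mF _)) _.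
    have := hn0 (n + n0)%N n0 (leq_addl _ _) (leqnn _); rewrite expr1n => h1.
    rewrite Nn0E; move: fin0; move: (fine _) => x x0.
    apply: (@le_trans _ _ (2 * 1 + 2 * x%:E)%E); first by rewrite leeD2r// lee_wpmul2l.
    by rewrite -!EFinM -EFinD lee_fin; exact: sq.
  have e0 : 0 < 3 + 2 * fine (N (F n0)) by rewrite ltr_wpDr// mulr_ge0.
  apply: (holo_limit e0 (fun n => hF (n + n0)%N) bound) => z.
    by rewrite (cvg_shiftn n0 (fun n => F n z)); exact: ulim.
  pose D n := 'D_(1, 0) (F n) z; have cD : cvgn D := cDF z.
  by move: cD; rewrite -(cvg_shiftn n0 D); exact: cvgP.
have tail (e : R) : 0 < e -> exists n0 : nat, forall n, (n0 <= n)%N ->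
    (N (fun z => F n z - f (slice I z))%R <= (e ^+ 2)%:E)%E.
  move=> e0; have [n0 hn0] := dN e e0; exists n0 => n n0n.
  (* Fatou's lemma is applied with n fixed and m tending to infinity. *)
  pose G m z := F n z - F (m + n0)%N z.
  have mG m : qmeas (G m) by exact: mB.
  apply: (@sqnorm_fatou _ _ _ _ _ mW W_ge0 G _ _ mG).
    move=> z; apply: cvgB; first exact: cvg_cst.
    by rewrite (cvg_shiftn n0 (fun n => F n z)); exact: ulim.
  by move=> m; apply: hn0; rewrite // leq_addl.
have Vf : V f.
  apply/(rbf_spaceP gamma_gt0 hI); split => //.
  have [n0 hn0] := tail 1 ltr01; have Nn0 := rbf_space_fin gamma_gt0 hI (Vu n0).
  have mf := holo_qmeas hf.
  have mN G : qmeas G -> qmeas (fun z => G z * - 1).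
    by move=> mG; apply: qmeasM => //; exact: qmeas_cst.
  have mFf : qmeas (fun z => F n0 z - f (slice I z)).
    have -> : (fun z => F n0 z - f (slice I z)) =
        (fun z => F n0 z + f (slice I z) * - 1) by apply/funext => z; rewrite mulrN1.
    by apply: qmeasD => //; exact: mN.
  have -> : f \o slice I = (fun z => F n0 z + (F n0 z - f (slice I z)) * - 1).
    by apply/funext => z /=; rewrite mulrN1 opprB addrC subrK.
  apply: le_lt_trans (sqnormD_le plane mW W_ge0 (mF _) (mN _ mFf)) _.
  rewrite (sqnormMr plane mW W_ge0)// lte_add_pinfty// lte_mul_pinfty// ?lee_fin//.
  rewrite lte_mul_pinfty// ?lee_fin ?exprn_ge0 ?qmod_ge0//.
  exact: le_lt_trans (hn0 n0 (leqnn _)) (ltry _).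
exists f => //; apply/cvgr0Pnorm_le => e e0.
have [d d0 cd] := small (Num.sqrt c) e (sqrtr_ge0 _) e0.
have [n0 hn0] := tail d d0; exists n0 => // n /= n0n.
rewrite ger0_norm ?sqrtr_ge0//; apply: le_trans (ltW cd).
apply: (rbf_norm_le gamma_gt0 hI (rbf_space_sub gamma_gt0 hI (Vu n) Vf) (ltW d0)).
exact: hn0.
Qed.

End rbf_completeness.

(** * Independence of the slice *)

Section slice_independence.
Variables (R : realType) (gamma : R).
Hypothesis gamma_gt0 : 0 < gamma.
Implicit Types (I J : quat R) (f : quat R -> quat R) (z : R * R).

Local Notation mR := (measurableTypeR R).
Local Notation plane := (@plane_measure R).
Local Notation W := (wt gamma : mR * mR -> R).
Local Notation N F := (@sqnorm _ (mR * mR)%type R plane W F).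

Lemma qmod_parallelogram (a b : quat R) :
  qmod (a + b) ^+ 2 + qmod (a - b) ^+ 2 = 2 * (qmod a ^+ 2 + qmod b ^+ 2).
Proof. by rewrite !qmod_sqr !quatX; ring. Qed.

Lemma slice_hyperholomorphic_pair f : slice_hyperholomorphic f ->
  exists S : R * R -> R, forall I z, imag_units I ->
    qmod (f (slice I z)) ^+ 2 + qmod (f (slice I (cconj z))) ^+ 2 = S z.
Proof.
move=> [a [b [fE ab _ _]]]; exists (fun z => 2 * (qmod (a z) ^+ 2 + qmod (b z) ^+ 2)).
move=> I [x y] hI; rewrite /cconj !fE//=; have [-> ->] := ab x y.
by rewrite mulrN qmod_parallelogram qmodM (qmod_imag_unit hI) mul1r.
Qed.

(** The weight and the plane measure are invariant under conjugation, so the integrals of the two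
    terms of [fS] coincide. As [slice_hyperholomorphic_pair] provides the same [S] for all units,
    this compares norms on different slices. *)
Lemma sqnorm_slice_double f (S : R * R -> R) I : imag_units I ->
  slice_hyperholomorphic f ->
  (forall z, qmod (f (slice I z)) ^+ 2 + qmod (f (slice I (cconj z))) ^+ 2 = S z) ->
  (N (f \o slice I) + N (f \o slice I) = \int[plane]_z (S z * W z)%:E)%E.
Proof.
move=> hI hf fS; have [hol _] := (slice_hyperholomorphicP f hI).1 hf.
pose h z := (qmod (f (slice I z)) ^+ 2 * W z)%:E.
have h0 z : (0%R <= h z)%E by rewrite lee_fin mulr_ge0 ?wt_ge0// exprn_ge0 ?qmod_ge0.
have mh : measurable_fun [set: mR * mR] h.
  apply/measurable_EFinP/measurable_funM; last exact: measurable_wt.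
  exact: measurable_qmod_sqr (holo_qmeas hol).
have [mc pc] := @plane_preserving_reflection R.
have e := ge0_integral_preserving mc pc mh h0.
have mhc : measurable_fun [set: mR * mR] (fun z => h (cconj z)).
  exact: measurableT_comp mh mc.
rewrite /sqnorm -[X in (_ + X)%E]e -(ge0_integralD plane measurableT (fun z _ => h0 z) mh
  (fun z _ => h0 (cconj z)) mhc).
apply: eq_integral => z _; rewrite -fS mulrDl EFinD; congr (_ + _)%E.
by rewrite /h /wt /= sqrrN.
Qed.

Lemma rbf_space_sub_slice I J : imag_units I -> imag_units J ->
  rbf_space gamma I `<=` rbf_space gamma J.
Proof.
move=> hI hJ f [hf /(rbf_sqnorm_fin gamma_gt0 _ hI) f_fin]; split=> //.
apply/(rbf_sqnorm_fin gamma_gt0 _ hJ).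
have [S fS] := slice_hyperholomorphic_pair hf.
have eI := sqnorm_slice_double hI hf (fun z => fS I z hI).
have eJ := sqnorm_slice_double hJ hf (fun z => fS J z hJ).
have J0 : (0 <= N (f \o slice J))%E by apply: sqnorm_ge0; exact: wt_ge0.
apply: (@le_lt_trans _ _ (N (f \o slice J) + N (f \o slice J))%E).
  by rewrite leeDl.
by rewrite eJ -eI lte_add_pinfty.
Qed.

End slice_independence.

(** * Assembly of the Hilbert space axioms and of the integral formula *)

Lemma rbf_rkhs (R : realType) (gamma : R) (I : quat R) : 0 < gamma -> imag_units I ->
  reproducing_kernel_hilbert_space (rbf_space gamma I) (rbf_inner gamma I)
    (rbf_norm gamma I) (rbf_kernel gamma).
Proof.
move=> gamma_gt0 hI; split; last 2 first.
- by move=> p; exact: rbf_space_kernel.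
- by move=> f p Vf; exact: rbf_reproducing.
split.
- exact: rbf_space_zero.
- by move=> f g Vf Vg; exact: rbf_space_add.
- by move=> f a Vf; exact: rbf_space_scale.
- by move=> f g h Vf Vg Vh; exact: rbf_inner_add.
- by move=> f g a Vf Vg; exact: rbf_inner_scale.
- by move=> f g Vf Vg; exact: rbf_inner_conj.
- by move=> f Vf; exact: rbf_inner_norm.
- by move=> f _; exact: sqrtr_ge0.
- by move=> f Vf; exact: rbf_norm_eq0.
- by move=> u Vu cu; exact: rbf_complete.
Qed.

Lemma rbf_integrand_qintegrable (R : realType) (gamma : R) (I : quat R)
    (f g : quat R -> quat R) : 0 < gamma -> imag_units I ->
  rbf_space gamma I f -> rbf_space gamma I g ->
  qintegrable (rbf_integrand gamma f g \o slice I).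
Proof.
move=> gamma_gt0 hI Vf Vg; have := rbf_pairing_integrable gamma_gt0 hI Vf Vg.
have -> // : pairing (wt gamma : measurableTypeR R * measurableTypeR R -> R)
    (g \o slice I) (f \o slice I) = rbf_integrand gamma f g \o slice I.
by apply/funext => z; rewrite /pairing /rbf_integrand/= rbf_weight_slice.
Qed.

Theorem theorem2p9 (R : realType) (gamma : R) (gamma_gt0 : 0 < gamma) :
  (forall I : quat R, imag_units I ->
     reproducing_kernel_hilbert_space (rbf_space gamma I) (rbf_inner gamma I)
       (rbf_norm gamma I) (rbf_kernel gamma)) /\
  (forall I J : quat R, imag_units I -> imag_units J ->
     rbf_space gamma I = rbf_space gamma J) /\
  (forall (I : quat R) (f : quat R -> quat R) (p : quat R),
     imag_units I -> rbf_space gamma I f ->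
     let F (z : R * R) := let q := slice I z in
       qconj (rbf_kernel gamma q p) * f q *
       qexp ((gamma ^+ 2)^-1 *: (q - qconj q) ^+ 2) in
     qintegrable F /\ f p = (2 / (pi * gamma ^+ 2)) *: qintegral F).
Proof.
split; first by move=> I hI; exact: rbf_rkhs.
split=> [I J hI hJ|I f p hI Vf F].
  by apply/seteqP; split; exact: rbf_space_sub_slice.
(* Integrability is proved along with the formula because [qintegral] assigns a value to every
   function. *)
split; last exact: (rbf_reproducing gamma_gt0 hI p Vf).
exact: (rbf_integrand_qintegrable gamma_gt0 hI Vf (rbf_space_kernel gamma_gt0 hI p)).
Qed.
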